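(* Let $(w,d,N,L)$ be a stable, reduced Levi–Schubert quadruple. Let $p_w$ be the minimal index with $1<p_w<b_L-1$ such that $h_{p_w+1}+\dots+h_{b_L}<2$, and if no such index exists set $p_w=b_L-1$. Then $(w,d,N,L)$ is multiplicity free (equivalently, $X(w)$ is a spherical $L$-variety) if and only if one of the following holds: (i) $b_L\le2$; (ii) $b_L=3$, and at least one of: $N_2=1$; $h_1+1\ge N_1$; ($N_2=h_2$ and $h_1+2\ge N_1$); ($h_2>0$ and $h_3<2$); ($h_2=0$ and $h_3\le2$); (iii) $b_L\ge4$, and either $p_w=2$, or $p_w>2$ and $h_1+\dots+h_{p_w-1}+1\ge N_1+\dots+N_{p_w-1}$.
   Context: Work over $\mathbb{C}$. $G_{d,N}$ is the Grassmannian of $d$-planes in $\mathbb{C}^N$ with its Plücker embedding; $B\subset GL_N$ upper triangular. $I_{d,N}$ is the set of sequences $(i_1<\dots<i_d)$ in $\{1,\dots,N\}$. For $w=(\ell_1,\dots,\ell_d)\in I_{d,N}$, $X(w)$ is the closure of $B\cdot[e_{\ell_1}\wedge\dots\wedge e_{\ell_d}]$ and $\mathbb{C}[X(w)]$ its Plücker homogeneous coordinate ring. A standard Levi $L\subseteq GL_N$ is given by $0=j_0<j_1<\dots<j_{b_L}=N$: invertible block diagonal matrices with blocks of sizes $N_k=j_k-j_{k-1}$, $L\cong GL_{N_1}\times\dots\times GL_{N_{b_L}}$; blocks $\mathrm{Bl}_k=\{j_{k-1}+1,\dots,j_k\}$. A Levi–Schubert quadruple $(w,d,N,L)$ ($1\le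 d<N$, $w\in I_{d,N}$) is stable if $X(w)$ is stable under left multiplication by $L$; reduced if $\ell_1\ne1$ and $\ell_d=N$; a stable quadruple is multiplicity free if each irreducible $L$-module occurs at most once in $\mathbb{C}[X(w)]$, and spherical if $X(w)$ has a dense open orbit of a Borel subgroup of $L$. $h_k=|\{j:\ell_j\in\mathrm{Bl}_k\}|$ for $1\le k\le b_L$. *)

(* Defs.v *)
From mathcomp Require Import all_boot all_algebra.
From mathcomp Require Import reals Rstruct.
From mathcomp.real_closed Require Import complex.
Set Implicit Arguments. Unset Strict Implicit. Unset Printing Implicit Defensive.
Import GRing.Theory.
Local Open Scope ring_scope.

Definition C : fieldType := (Rdefinitions.R)[i].

(* I_{d,N}: strictly increasing sequences (i_1<...<i_d) in {1..N}, encoded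
   0-based as strictly increasing maps 'I_d -> 'I_N. *)
Definition Idn (d N : nat) :=
  {f : {ffun 'I_d -> 'I_N} | [forall i : 'I_d, forall j : 'I_d, (i < j)%N ==> (f i < f j)%N]}.

(* Points of the Plücker space  /\^d C^N  (coordinates indexed by I_{d,N}). *)
Definition pt (d N : nat) := {ffun Idn d N -> C}.

Definition minor d N (g : 'M[C]_N) (I J : Idn d N) : C :=
  \det (\matrix_(a < d, b < d) g (val I a) (val J b)).

(* The action of g in GL_N on /\^d C^N:  g.e_J = \sum_I det(g_{I,J}) e_I. *)
Definition wedge d N (g : 'M[C]_N) (x : pt d N) : pt d N :=
  [ffun I => \sum_(J : Idn d N) minor g I J * x J].

(* The point e_{l_1} /\ ... /\ e_{l_d} for w = (l_1,...,l_d). *)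
Definition ew d N (w : Idn d N) : pt d N := [ffun I => (I == w)%:R].

Definition inB N (b : 'M[C]_N) : Prop :=
  b \in unitmx /\ forall i j : 'I_N, (j < i)%N -> b i j = 0.

Inductive polyfun (T : finType) : ({ffun T -> C} -> C) -> Prop :=
| pf_const (c : C) : polyfun (fun _ => c)
| pf_coord (t : T) : polyfun (fun x => x t)
| pf_add F G : polyfun F -> polyfun G -> polyfun (fun x => F x + G x)
| pf_mul F G : polyfun F -> polyfun G -> polyfun (fun x => F x * G x).

(* The affine cone over X(w): the Zariski closure of the orbit B . e_w in
   /\^d C^N (zero locus of all polynomials vanishing on B . e_w). *)
Definition inXhat d N (w : Idn d N) (x : pt d N) : Prop :=
  forall F, polyfun F ->
    (forall b, inB b -> F (wedge b (ew w)) = 0) -> F x = 0.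

(* The Plücker homogeneous coordinate ring C[X(w)], realised as the ring of
   restrictions to the cone of polynomial functions (functions are extended
   by 0 off the cone, so equality of functions is equality on the cone). *)
Definition isReg d N (w : Idn d N) (f : pt d N -> C) : Prop :=
  exists F, polyfun F /\
    (forall x, inXhat w x -> f x = F x) /\ (forall x, ~ inXhat w x -> f x = 0).

(* Standard Levi subgroups.  A Levi L is given by the list Ns = [N_1;...;N_b]
   of its (positive) block sizes, with sum N; b_L = size Ns.  blk Ns i is the
   0-based index of the block containing the 0-based index i. *)
Definition blk (Ns : seq nat) (i : nat) : nat :=
  count (fun k => sumn (take k Ns) <= i)%N (iota 1 (size Ns).-1).

Definition levi_ok (N : nat) (Ns : seq nat) : Prop :=
  sumn Ns = N /\ all (fun n => 0 < n)%N Ns.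

Definition inLevi N (Ns : seq nat) (g : 'M[C]_N) : Prop :=
  g \in unitmx /\ forall i j : 'I_N, blk Ns i <> blk Ns j -> g i j = 0.

Definition stable d N (w : Idn d N) (Ns : seq nat) : Prop :=
  forall g x, inLevi Ns g -> inXhat w x -> inXhat w (wedge g x).

Definition reduced d N (w : Idn d N) : Prop :=
  (forall a : 'I_d, val a = 0%N -> val (val w a) <> 0%N) /\
  (forall a : 'I_d, val a = d.-1 -> val (val w a) = N.-1).

Definition actf d N (g : 'M[C]_N) (f : pt d N -> C) : pt d N -> C :=
  fun x => f (wedge (invmx g) x).

Definition zerof d N : pt d N -> C := fun _ => 0.

Definition submod d N (w : Idn d N) (Ns : seq nat) (W : (pt d N -> C) -> Prop) :=
  [/\ forall f, W f -> isReg w f,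
      W (@zerof d N),
      forall f g, W f -> W g -> W (fun x => f x + g x),
      forall (c : C) f, W f -> W (fun x => c * f x)
    & forall g f, inLevi Ns g -> W f -> W (actf g f)].

Definition irred_submod d N (w : Idn d N) (Ns : seq nat) (W : (pt d N -> C) -> Prop) :=
  [/\ submod w Ns W,
      (exists2 f, W f & f <> @zerof d N)
    & forall W', submod w Ns W' -> (forall f, W' f -> W f) ->
        (forall f, W' f -> f = @zerof d N) \/ (forall f, W f -> W' f)].

Definition iso_submod d N (Ns : seq nat) (W1 W2 : (pt d N -> C) -> Prop) :=
  exists phi : (pt d N -> C) -> (pt d N -> C),
  [/\ (forall f, W1 f -> W2 (phi f)),
      (forall f g, W1 f -> W1 g -> phi (fun x => f x + g x) = (fun x => phi f x + phi g x)),
      (forall (c : C) f, W1 f -> phi (fun x => c * f x) = (fun x => c * phi f x)),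
      (forall g f, inLevi Ns g -> W1 f -> phi (actf g f) = actf g (phi f))
    & (forall f g, W1 f -> W1 g -> phi f = phi g -> f = g) /\
      (forall h, W2 h -> exists2 f, W1 f & phi f = h)].

(* Multiplicity free: each irreducible L-module occurs at most once in
   C[X(w)], i.e. any two isomorphic irreducible L-submodules coincide. *)
Definition mult_free d N (w : Idn d N) (Ns : seq nat) : Prop :=
  forall W1 W2, irred_submod w Ns W1 -> irred_submod w Ns W2 ->
    iso_submod Ns W1 W2 -> forall f, W1 f <-> W2 f.

Definition bL (Ns : seq nat) : nat := size Ns.
Definition Nk (Ns : seq nat) (k : nat) : nat := nth 0%N Ns k.-1.
Definition hk d N (w : Idn d N) (Ns : seq nat) (k : nat) : nat :=
  #|[set a : 'I_d | (blk Ns (val w a)).+1 == k]|.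

Definition pw d N (w : Idn d N) (Ns : seq nat) : nat :=
  head (bL Ns).-1
    [seq p <- iota 2 (bL Ns - 3) | (\sum_(p.+1 <= k < (bL Ns).+1) hk w Ns k < 2)%N].

(* Main.v *)
(** The point of X(w) spanned by the columns of an N x d matrix M is written
    pl M; X(w) is the closure of the set of all pl M with M i a = 0 below row
    w a.  Stability under L says that w consists of the h_k last elements of
    each block, and Gaussian elimination brings a generic M to E_w + Y, where Y
    lives on the rows outside w.  The Borel subgroup of L then acts on Y as the
    product of the Borel subgroups of GL(N_k - h_k) and GL(h_l) acts on the sum
    over k < l of the spaces of (N_k - h_k) x h_l matrices.

    In the cases (i)-(iii) this module has a dense orbit: elimination reduces Y
    to a 0/1 matrix whose support is a forest, and the torus acts transitively
    on the matrices with that support.  Two highest weight vectors of the same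
    weight are then proportional, as a combination vanishing at the base point
    vanishes on the orbit.

    In the other cases two monomials in Pluecker coordinates of L-highest
    weight vectors have the same weight without being proportional.  Viewed as
    tensors they are orthonormal for a Hermitian form for which g and its
    conjugate transpose are adjoint; a matrix coefficient <x a, a> depends only
    on the weight of a, because the big cell is dense in L.  Hence both vectors
    generate irreducible modules, which are isomorphic and distinct. *)

Require Import Defs.
From mathcomp Require Import all_boot all_order all_algebra all_fingroup.
From mathcomp Require Import boolp reals Rstruct.
From mathcomp.real_closed Require Import complex.
From mathcomp Require Import zify ring.

Set Implicit Arguments.
Unset Strict Implicit.
Unset Printing Implicit Defensive.

Import Order.TTheory GRing.Theory Num.Theory.
Local Open Scope ring_scope.

(** * Minors and the Cauchy-Binet formula *)

(** Density is used without topology. A set [Z] of matrices is only required to be closed under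
    group operations and under [line_closed]: a point lies in [Z] if a suitable line through it
    does, up to finitely many parameters. Elimination with perturbed pivots then spreads [Z] from
    one base point to everything, and the same device handles the big cell of the Levi. Submodules
    are arbitrary subspaces of an infinite-dimensional ring, so weight decompositions come from
    uniform degree bounds and interpolation instead of finite dimension. Tensors enter the negative
    direction because they carry an explicit Hermitian form. Restriction to the cone is injective on
    the module generated by one highest weight vector, since its kernel there is a submodule missing
    the generator. The two obstructions are classical: the cross-ratio of four points on a
    projective line and the triple ratio of three flags in a projective plane. Each is a quotient of
    two products of Pluecker coordinates of equal weight, and every excluded case leaves room for
    one of these configurations below [w]. *)

Lemma Idn_incr d N (I : Idn d N) (a b : 'I_d) :
  (a < b)%N -> (val I a < val I b)%N.
Proof.
by move=> ab; move/forallP: (valP I) => /(_ a) /forallP /(_ b) /implyP; apply.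
Qed.

Lemma Idn_le d N (I : Idn d N) (a b : 'I_d) :
  (val I a <= val I b)%N = (a <= b)%N.
Proof.
case: (ltngtP a b) => [ab|ba|/val_inj->]; last by rewrite leqnn.
- by rewrite ltnW // Idn_incr.
- by rewrite leqNgt Idn_incr.
Qed.

Lemma Idn_inj d N (I : Idn d N) : injective (val I).
Proof.
move=> a b e; apply: val_inj; apply/eqP.
by rewrite eqn_leq -!(Idn_le I) e leqnn.
Qed.

Definition mkIdn_subproof d N (f : 'I_d -> 'I_N)
  (H : forall a b : 'I_d, (a < b)%N -> (f a < f b)%N) :
  [forall i : 'I_d, forall j : 'I_d, (i < j)%N ==> (finfun f i < finfun f j)%N].
Proof.
by apply/forallP => a; apply/forallP => b; apply/implyP; rewrite !ffunE; apply: H.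
Qed.

Definition mkIdn d N (f : 'I_d -> 'I_N)
    (H : forall a b : 'I_d, (a < b)%N -> (f a < f b)%N) : Idn d N :=
  exist _ (finfun f) (mkIdn_subproof H).

Lemma mkIdnE d N f H a : val (@mkIdn d N f H) a = f a.
Proof. by rewrite /= ffunE. Qed.

Definition img d N (I : Idn d N) : {set 'I_N} := [set val I a | a : 'I_d].

Lemma mem_img d N (I : Idn d N) a : val I a \in img I.
Proof. exact: imset_f. Qed.

Lemma card_img d N (I : Idn d N) : #|img I| = d.
Proof. by rewrite card_imset ?card_ord //; exact: Idn_inj. Qed.

(** Strong induction on the position: once the enumerations agree before [a], the value [val B a] is
    some [val A c], and [c < a] would make [B] repeat an earlier value. So [A] is at most [B] at
    [a], and symmetrically. *)
Lemma img_inj d N : injective (@img d N).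
Proof.
move=> I J eIJ.
have sub (A B : Idn d N) : img A = img B ->
    forall x : nat, forall a : 'I_d, val a = x ->
      (forall b : 'I_d, (b < a)%N -> val A b = val B b) -> (val A a <= val B a)%N.
  move=> eAB x a _ IH.
  have /imsetP[c _ ec]: val B a \in img A by rewrite eAB mem_img.
  rewrite ec Idn_le leqNgt; apply/negP => ca.
  by have := IH c ca; rewrite -ec => /Idn_inj ac; rewrite ac ltnn in ca.
apply: val_inj; apply/ffunP => a.
move: {2}(val a).+1 (ltnSn (val a)) => n; elim: n a => // n IHn a.
rewrite ltnS => an.
have IH (b : 'I_d) : (b < a)%N -> val I b = val J b.
  by move=> ba; apply: IHn; apply: leq_trans ba an.
apply: val_inj; apply/eqP; rewrite eqn_leq.
rewrite (sub I J eIJ _ a erefl IH) (sub J I (esym eIJ) _ a erefl) // => b ba.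
by rewrite IH.
Qed.

Lemma Idn_of_set d N (A : {set 'I_N}) : #|A| = d -> exists I : Idn d N, img I = A.
Proof.
move=> cA; pose f (a : 'I_d) := enum_val (cast_ord (esym cA) a).
have Hs : sorted ltn (map val (enum A)).
  rewrite sorted_map.
  have -> : enum A = [seq x <- enum 'I_N | x \in A] by rewrite enumT.
  apply: sorted_filter => [x y z|]; first exact: ltn_trans.
  by rewrite -sorted_map val_enum_ord iota_ltn_sorted.
have H (a b : 'I_d) : (a < b)%N -> (f a < f b)%N.
  move=> ab; rewrite /f.
  have [i0 _] : exists i0 : 'I_N, true by exists (f a).
  rewrite !(enum_val_nth i0) /=.
  have sz : size (map val (enum A)) = d by rewrite size_map -cardE.
  have := sorted_ltn_nth ltn_trans 0%N Hs.
  move=> /(_ a b); rewrite !inE !sz !ltn_ord => /(_ isT isT ab).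
  by rewrite !(nth_map i0) // -cardE cA ltn_ord.
exists (mkIdn H); apply/setP => x; apply/imsetP/idP => [[a _ ->]|xA].
  by rewrite mkIdnE enum_valP.
exists (cast_ord cA (enum_rank_in xA x)) => //.
by rewrite mkIdnE /f cast_ordK enum_rankK_in.
Qed.

Lemma Idn_factor d N (I : Idn d N) (phi : 'I_d -> 'I_N) :
  injective phi -> (forall a, phi a \in img I) ->
  exists s : 'S_d, forall a, phi a = val I (s a).
Proof.
move=> phiI phim.
have ex a : exists b, phi a == val I b.
  by have /imsetP[b _ ->] := phim a; exists b.
pose f a := xchoose (ex a).
have fE a : phi a = val I (f a) by apply/eqP; exact: (xchooseP (ex a)).
have fI : injective f by move=> a b e; apply: phiI; rewrite !fE e.
by exists (perm fI) => a; rewrite permE.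
Qed.

Section CauchyBinet.
Variable R : comNzRingType.

Lemma det_mulmx_expand d N (A : 'M[R]_(d, N)) (B : 'M[R]_(N, d)) :
  \det (A *m B) =
  \sum_(f : {ffun 'I_d -> 'I_N})
    (\prod_i A i (f i)) * \det (\matrix_(i, j) B (f i) j).
Proof.
transitivity (\sum_(s : 'S_d) (-1) ^+ s *
   \sum_(f : {ffun 'I_d -> 'I_N}) \prod_i (A i (f i) * B (f i) (s i))).
  apply: eq_bigr => s _; congr (_ * _).
  rewrite -(bigA_distr_bigA (fun i j => A i j * B j (s i))) /=.
  by apply: eq_bigr => i _; rewrite mxE.
rewrite (eq_bigr (fun s : 'S_d => \sum_(f : {ffun 'I_d -> 'I_N})
   (-1) ^+ s * \prod_i (A i (f i) * B (f i) (s i)))); last first.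
  by move=> s _; rewrite big_distrr.
rewrite exchange_big /=; apply: eq_bigr => f _.
rewrite big_distrr /=; apply: eq_bigr => s _.
rewrite big_split /= mulrCA; congr (_ * (_ * _)).
by apply: eq_bigr => i _; rewrite mxE.
Qed.

Theorem det_mulmx_minors d N (A : 'M[R]_(d, N)) (B : 'M[R]_(N, d)) :
  \det (A *m B) =
  \sum_(I : Idn d N) \det (\matrix_(i, j) A i (val I j)) *
                     \det (\matrix_(i, j) B (val I i) j).
Proof.
rewrite det_mulmx_expand.
(* [h] lists each injective map once, as the increasing enumeration of its image composed with a
   permutation; a non-injective map gives two equal rows and contributes 0. *)
pose h (p : Idn d N * 'S_d) : {ffun 'I_d -> 'I_N} := [ffun a => val p.1 (p.2 a)].
have hI : injective h.
  case=> I s [J t] /ffunP e.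
  have eIJ : I = J.
    apply: img_inj; apply/setP => x; apply/imsetP/imsetP => -[a _ ->].
      by exists (t ((s^-1)%g a)) => //; have := e ((s^-1)%g a); rewrite !ffunE /= permKV.
    by exists (s ((t^-1)%g a)) => //; have := e ((t^-1)%g a); rewrite !ffunE /= permKV.
  rewrite eIJ in e *; congr (_, _); apply/permP => a.
  by have := e a; rewrite !ffunE => /Idn_inj.
pose T (f : {ffun 'I_d -> 'I_N}) :=
  (\prod_i A i (f i)) * \det (\matrix_(i, j) B (f i) j).
transitivity (\sum_(f in h @: setT) T f).
  rewrite [RHS]big_mkcond /=; apply: eq_bigr => f _; case: ifPn => // nf.
  have [inj|ninj] := boolP (injectiveb f).
    case/negP: nf; have [I iI] : exists I : Idn d N, img I = [set f a | a : 'I_d].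
      by apply: Idn_of_set; rewrite card_imset ?card_ord //; apply/injectiveP.
    have [] := @Idn_factor d N I f; first exact/injectiveP.
      by move=> a; rewrite iI imset_f.
    by move=> s fE; apply/imsetP; exists (I, s) => //; apply/ffunP => a; rewrite ffunE fE.
  have /injectivePn[a [b nab eab]] := ninj.
  rewrite (@determinant_alternate _ _ _ a b) ?mulr0 // => j.
  by rewrite !mxE eab.
rewrite big_imset /=; last by move=> p q _ _; apply: hI.
rewrite (eq_bigl predT); last by move=> p; rewrite inE.
rewrite -(pair_bigA _ (fun I s => T (h (I, s)))) /=; apply: eq_bigr => I _.
rewrite {1}/determinant big_distrl /=; apply: eq_bigr => s _.
rewrite /T.
have -> : (\matrix_(i, j) B (h (I, s) i) j) = perm_mx s *m (\matrix_(i, j) B (val I i) j).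
  by rewrite -row_permE; apply/matrixP => i j; rewrite !mxE ffunE.
rewrite det_mulmx det_perm mulrA [_ * (-1) ^+ s]mulrC; congr (_ * _ * _).
by apply: eq_bigr => i _; rewrite !mxE ffunE.
Qed.

End CauchyBinet.

(** * Points of the cone over X(w) *)

(** [C] is declared only as a field; [Cn] is the same type with its order, roots and conjugation. *)
Definition Cn : numClosedFieldType := (Rdefinitions.R)[i].

Lemma natrC_eq0 n : (n%:R == 0 :> C) = (n == 0%N).
Proof. exact: (@pnatr_eq0 Cn). Qed.

Lemma natrC_inj : injective (fun n : nat => n%:R : C).
Proof. by move=> m n /eqP; rewrite (eqr_nat Cn) => /eqP. Qed.

Lemma poly_eq0_of_horner (P : {poly C}) : (forall s, P.[s] = 0) -> P = 0.
Proof.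
move=> P0; apply/eqP/negPn/negP => Pn0.
pose rs : seq C := [seq n%:R | n <- iota 0 (size P)].
have : (size rs < size P)%N.
  apply: max_poly_roots => //; first by apply/allP => x _; apply/rootP.
  by rewrite map_inj_uniq ?iota_uniq //; exact: natrC_inj.
by rewrite size_map size_iota ltnn.
Qed.

Lemma poly_eq0_of_generic (p P : {poly C}) :
  p != 0 -> (forall s, p.[s] != 0 -> P.[s] = 0) -> P = 0.
Proof.
move=> p0 H; have /eqP : p * P = 0.
  apply: poly_eq0_of_horner => s; rewrite hornerM.
  by have [->|/H->] := eqVneq p.[s] 0; rewrite ?mul0r ?mulr0.
by rewrite mulf_eq0 (negPf p0) => /eqP.
Qed.

Lemma Croot (n : nat) (x : C) : (0 < n)%N -> exists y : C, y ^+ n = x.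
Proof. by move=> n0; exists (@nthroot Cn n x); exact: (@rootCK Cn). Qed.

(** [polyfun] describes functions, not polynomial data. Pulled back to a polynomial curve such a
    function becomes a one-variable polynomial, which is all that the density arguments use. *)
Lemma polyfun_poly (T : finType) (F : {ffun T -> C} -> C) : polyfun F ->
  forall x : T -> {poly C}, exists P : {poly C},
    forall s, F [ffun t => (x t).[s]] = P.[s].
Proof.
elim=> [c|t|G H _ IG _ IH|G H _ IG _ IH] x.
- by exists c%:P => s; rewrite hornerC.
- by exists (x t) => s; rewrite ffunE.
- have [P PE] := IG x; have [Q QE] := IH x.
  by exists (P + Q) => s; rewrite PE QE hornerD.
- have [P PE] := IG x; have [Q QE] := IH x.
  by exists (P * Q) => s; rewrite PE QE hornerM.
Qed.

Lemma polyfun_sum (T : finType) (I : Type) (r : seq I) (p : pred I)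
    (G : I -> {ffun T -> C} -> C) :
  (forall i, polyfun (G i)) -> polyfun (fun x => \sum_(i <- r | p i) G i x).
Proof.
move=> HG; elim: r => [|i r IH].
  rewrite (_ : (fun x => _) = fun=> 0); first exact: pf_const.
  by apply: funext => x; rewrite big_nil.
rewrite (_ : (fun x => _) = fun x =>
    (if p i then G i x else 0) + \sum_(i <- r | p i) G i x); last first.
  by apply: funext => x; rewrite big_cons; case: ifP => // _; rewrite add0r.
by apply: pf_add IH; case: (p i) => //; exact: pf_const.
Qed.

Lemma polyfun_prod (T : finType) (I : Type) (r : seq I)
    (G : I -> {ffun T -> C} -> C) :
  (forall i, polyfun (G i)) -> polyfun (fun x => \prod_(i <- r) G i x).
Proof.
move=> HG; elim: r => [|i r IH].
  rewrite (_ : (fun x => _) = fun=> 1); first exact: pf_const.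
  by apply: funext => x; rewrite big_nil.
rewrite (_ : (fun x => _) = fun x => G i x * \prod_(i <- r) G i x); last first.
  by apply: funext => x; rewrite big_cons.
exact: pf_mul.
Qed.

Definition pl d N (M : 'M[C]_(N, d)) : pt d N :=
  [ffun I : Idn d N => \det (\matrix_(a, b) M (val I a) b)].

Definition Ew d N (w : Idn d N) : 'M[C]_(N, d) := \matrix_(i, a) (i == val w a)%:R.

Definition in_shape d N (w : Idn d N) (M : 'M[C]_(N, d)) : Prop :=
  forall (i : 'I_N) (a : 'I_d), (val w a < i)%N -> M i a = 0.

Lemma wedge_pl d N (g : 'M[C]_N) (M : 'M[C]_(N, d)) : wedge g (pl M) = pl (g *m M).
Proof.
apply/ffunP => I; rewrite !ffunE.
pose A : 'M[C]_(d, N) := \matrix_(a, j) g (val I a) j.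
have -> : \matrix_(a, b) (g *m M) (val I a) b = A *m M.
  by apply/matrixP => a b; rewrite !mxE; apply: eq_bigr => j _; rewrite mxE.
rewrite det_mulmx_minors; apply: eq_bigr => J _; rewrite ffunE; congr (\det _ * _).
by apply/matrixP => a b; rewrite !mxE.
Qed.

Lemma minor_mul d N (g h : 'M[C]_N) (I K : Idn d N) :
  minor (g *m h) I K = \sum_(J : Idn d N) minor g I J * minor h J K.
Proof.
pose M : 'M[C]_(N, d) := \matrix_(i, a) h i (val K a).
have := congr1 (fun x : pt d N => x I) (wedge_pl g M); rewrite !ffunE => e.
rewrite /minor; transitivity (\det (\matrix_(a, b) (g *m M) (val I a) b)).
  congr (\det _); apply/matrixP => a b; rewrite !mxE.
  by apply: eq_bigr => j _; rewrite !mxE.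
rewrite -e; apply: eq_bigr => J _; rewrite ffunE; congr (_ * \det _).
by apply/matrixP => a b; rewrite !mxE.
Qed.

Lemma wedge_mul d N (g h : 'M[C]_N) (x : pt d N) :
  wedge (g *m h) x = wedge g (wedge h x).
Proof.
apply/ffunP => I; rewrite !ffunE.
rewrite (eq_bigr (fun J => \sum_K minor g I K * minor h K J * x J)); last first.
  by move=> J _; rewrite minor_mul big_distrl.
rewrite exchange_big /=; apply: eq_bigr => K _.
by rewrite ffunE big_distrr /=; apply: eq_bigr => J _; rewrite mulrA.
Qed.

Lemma det_col0 (R : comNzRingType) n (A : 'M[R]_n) b : (forall a, A a b = 0) -> \det A = 0.
Proof. by move=> A0; rewrite (expand_det_col _ b) big1 // => i _; rewrite A0 mul0r. Qed.

Lemma Idn_diff d N (I K : Idn d N) : I != K -> exists b, val K b \notin img I.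
Proof.
move=> nIK; apply/existsP; apply: contraNT nIK; rewrite negb_exists => /forallP H.
apply/eqP; apply: img_inj; apply/eqP; rewrite eq_sym eqEcard !card_img leqnn andbT.
by apply/subsetP => x /imsetP[b _ ->]; move: (H b); rewrite negbK.
Qed.

Lemma det_uptri (R : comNzRingType) n (A : 'M[R]_n) :
  (forall i j : 'I_n, (j < i)%N -> A i j = 0) -> \det A = \prod_i A i i.
Proof.
move=> H; rewrite -det_tr det_trig; last first.
  by apply/is_trig_mxP => i j ij; rewrite mxE H.
by apply: eq_bigr => i _; rewrite mxE.
Qed.

Lemma pl_Ew d N (w : Idn d N) : pl (Ew w) = ew w.
Proof.
apply/ffunP => I; rewrite !ffunE; have [->|nIw] := eqVneq I w.
  rewrite (_ : \matrix_(a, b) _ = 1%:M) ?det1 //.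
  by apply/matrixP => a b; rewrite !mxE (inj_eq (@Idn_inj _ _ w)).
have [b bI] := Idn_diff nIw; rewrite (@det_col0 _ _ _ b) // => a.
by rewrite !mxE; case: eqP => // e; rewrite -e mem_img in bI.
Qed.

Lemma wedge1 d N (x : pt d N) : wedge 1%:M x = x.
Proof.
apply/ffunP => I; rewrite ffunE (bigD1 I) //= big1 ?addr0.
  have := congr1 (fun y : pt d N => y I) (pl_Ew I); rewrite !ffunE eqxx => e.
  rewrite (_ : minor _ _ _ = 1) ?mul1r // -[RHS]e; congr (\det _).
  by apply/matrixP => a b; rewrite !mxE.
move=> J nJ; have := congr1 (fun y : pt d N => y I) (pl_Ew J).
rewrite !ffunE eq_sym (negPf nJ) => e.
rewrite (_ : minor _ _ _ = 0) ?mul0r // -[RHS]e; congr (\det _).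
by apply/matrixP => a b; rewrite !mxE.
Qed.

Lemma horner_pl d N (Mx : 'M[{poly C}]_(N, d)) s :
  pl (map_mx (fun p => p.[s]) Mx) =
  [ffun I : Idn d N => (\det (\matrix_(a, b) Mx (val I a) b)).[s]].
Proof.
apply/ffunP => I; rewrite !ffunE -[RHS]/(horner_eval s _) -det_map_mx.
by congr (\det _); apply/matrixP => a b; rewrite !mxE.
Qed.

Lemma polyfun_pl_line d N (F : pt d N -> C) (M E : 'M[C]_(N, d)) : polyfun F ->
  exists P : {poly C}, forall s, F (pl (M + s *: E)) = P.[s].
Proof.
move=> pF; pose Mx : 'M[{poly C}]_(N, d) := \matrix_(i, a) ((M i a)%:P + (E i a) *: 'X).
have [P PE] := polyfun_poly pF (fun I => \det (\matrix_(a, b) Mx (val I a) b)).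
exists P => s; rewrite -PE -horner_pl; congr (F (pl _)).
by apply/matrixP => i a; rewrite !mxE !hornerE /= mulrC.
Qed.

Lemma polyfun_pl_generic d N (F : pt d N -> C) (M E : 'M[C]_(N, d)) (p : {poly C}) :
  polyfun F -> p != 0 -> (forall s, p.[s] != 0 -> F (pl (M + s *: E)) = 0) ->
  F (pl M) = 0.
Proof.
move=> pF p0 H; have [P PE] := polyfun_pl_line M E pF.
have P0 : P = 0 by apply: poly_eq0_of_generic p0 _ => s /H; rewrite PE.
by have := PE 0; rewrite P0 horner0 scale0r addr0.
Qed.

Lemma prod_XaddC_neq0 (I : Type) (r : seq I) (p : pred I) (c : I -> C) :
  \prod_(a <- r | p a) ('X + (c a)%:P) != 0.
Proof.
apply/monic_neq0/monic_prod => a _.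
by rewrite -[c a]opprK polyCN monicXsubC.
Qed.

(** If all pivots [M (w a) a] are nonzero, [M] is [b *m Ew w] with [b] in the Borel subgroup; the
    general case follows by perturbing the pivots along [Ew w]. *)
Lemma in_shape_Xhat d N (w : Idn d N) (M : 'M[C]_(N, d)) :
  in_shape w M -> inXhat w (pl M).
Proof.
move=> sM F pF F0.
apply: (polyfun_pl_generic (E := Ew w) pF
          (prod_XaddC_neq0 (index_enum 'I_d) predT (fun a => M (val w a) a))) => s.
rewrite horner_prod => /prodf_neq0 nz; set M' := M + _.
(* [b] carries the columns of [M'] at the positions of [w] and unit vectors elsewhere, so it is
   upper triangular with the pivots and ones on the diagonal. *)
pose b : 'M[C]_N := \matrix_(i, j)
  if [pick a | val w a == j] is Some a then M' i a else (i == j)%:R.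
have -> : pl M' = wedge b (ew w).
  rewrite -pl_Ew wedge_pl; congr pl; apply/matrixP => i a.
  rewrite [RHS]mxE (bigD1 (val w a)) //= big1 ?addr0.
    rewrite [b _ _]mxE [Ew _ _ _]mxE eqxx mulr1; case: pickP => [a' /eqP/Idn_inj ->|/(_ a)]; last by rewrite eqxx.
    by rewrite !mxE.
  by move=> j nj; rewrite !mxE (negPf nj) mulr0.
have btri (i j : 'I_N) : (j < i)%N -> b i j = 0.
  move=> ji; rewrite !mxE; case: pickP => [a /eqP ja|_].
    rewrite !mxE sM ?ja // add0r; case: eqP => [ij|]; last by rewrite mulr0.
    by rewrite ij ltnn in ji.
  by case: eqP => // ij; rewrite ij ltnn in ji.
apply: F0; split=> //; rewrite unitmxE unitfE det_uptri //.
apply/prodf_neq0 => i _; rewrite !mxE; case: pickP => [a /eqP ia|_].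
  rewrite !mxE -ia eqxx mulr1 addrC; have := nz a isT.
  by rewrite !hornerE.
by rewrite eqxx oner_neq0.
Qed.

Lemma Xhat_vanish d N (w : Idn d N) F : polyfun F ->
  (forall M, in_shape w M -> F (pl M) = 0) -> forall x, inXhat w x -> F x = 0.
Proof.
move=> pF H x; apply=> // b [_ tb]; rewrite -pl_Ew wedge_pl; apply: H => i a lia.
rewrite mxE (bigD1 (val w a)) //= tb // mul0r big1 ?addr0 // => j nj.
by rewrite !mxE (negPf nj) mulr0.
Qed.

(** * Gaussian elimination in sets of matrices *)

Lemma rowop_mulmx m n (M : 'M[C]_(m, n)) i (c : 'I_m -> C) :
  \matrix_(k, b) (M k b + c k * M i b) =
  (\matrix_(k, l) ((k == l)%:R + c k * (l == i)%:R)) *m M.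
Proof.
apply/matrixP => k b; rewrite !mxE.
rewrite (eq_bigr (fun l => (k == l)%:R * M l b + c k * ((l == i)%:R * M l b))); last first.
  by move=> l _; rewrite mxE mulrDl mulrA.
rewrite big_split /= -big_distrr /=; congr (_ + _ * _).
  rewrite (bigD1 k) //= eqxx mul1r big1 ?addr0 // => l nl.
  by rewrite eq_sym (negPf nl) mul0r.
by rewrite (bigD1 i) //= eqxx mul1r big1 ?addr0 // => l nl; rewrite (negPf nl) mul0r.
Qed.

Lemma colop_mulmx m n (M : 'M[C]_(m, n)) a (c : 'I_n -> C) :
  \matrix_(k, b) (M k b + M k a * c b) =
  M *m (\matrix_(k, l) ((k == l)%:R + (k == a)%:R * c l)).
Proof.
apply/matrixP => k b; rewrite !mxE.
rewrite (eq_bigr (fun l => M k l * (l == b)%:R + (M k l * (l == a)%:R) * c b)); last first.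
  by move=> l _; rewrite mxE mulrDr mulrA.
rewrite big_split /= -big_distrl /=; congr (_ + _ * _).
  rewrite (bigD1 b) //= eqxx mulr1 big1 ?addr0 // => l nl.
  by rewrite (negPf nl) mulr0.
by rewrite (bigD1 a) //= eqxx mulr1 big1 ?addr0 // => l nl; rewrite (negPf nl) mulr0.
Qed.

Section Elimination.
Variables m n : nat.
Implicit Types (Z : 'M[C]_(m, n) -> Prop) (P : 'I_m -> 'I_n -> bool).

Definition row_closed Z (rR : rel 'I_m) : Prop :=
  forall i (c : 'I_m -> C) M, (forall k, c k != 0 -> rR k i) ->
    Z M -> Z (\matrix_(k, b) (M k b + c k * M i b)).

Definition col_closed Z (rC : rel 'I_n) : Prop :=
  forall a (c : 'I_n -> C) M, (forall b, c b != 0 -> rC b a) ->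
    Z M -> Z (\matrix_(k, b) (M k b + M k a * c b)).

Definition supported P (M : 'M[C]_(m, n)) : Prop := forall i a, ~~ P i a -> M i a = 0.

(** A substitute for Zariski closedness that matches zero sets of polynomials: [p] excludes finitely
    many parameters, and [S] limits the directions in which a point may be perturbed. *)
Definition line_closed Z (S : 'I_m -> 'I_n -> bool) : Prop :=
  forall M E (p : {poly C}), p != 0 -> supported S E ->
    (forall s, p.[s] != 0 -> Z (M + s *: E)) -> Z M.

(** On the slice used later, the rows outside [rows] are those of [w]; scaling them would spoil the
    normalised pivots [Ew w]. *)
Definition rowscale_closed Z (rows : pred 'I_m) : Prop :=
  forall (r : 'I_m -> C) M, (forall i, r i != 0) -> (forall i, ~~ rows i -> r i = 1) ->
    Z M -> Z (\matrix_(k, b) (r k * M k b)).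

Definition colscale_closed Z : Prop :=
  forall (c : 'I_n -> C) M, (forall a, c a != 0) ->
    Z M -> Z (\matrix_(k, b) (M k b * c b)).

Definition covers Z P : Prop := forall M, supported P M -> Z M.

Lemma covers_sub Z P P' : (forall i a, P i a -> P' i a) -> covers Z P' -> covers Z P.
Proof. by move=> sub c M sM; apply: c => i a nP; apply: sM; apply: contra nP; apply: sub. Qed.

(* One Gauss step: the pivot (i, a) is made nonzero by perturbing M, and then
   clears the entries of column a in the rows of A. *)
Lemma covers_clear_col Z rR S P P' i a (A : pred 'I_m) :
  row_closed Z rR -> line_closed Z S -> irreflexive rR -> S i a ->
  P i a -> (forall k, A k -> rR k i) ->
  (forall k b, A k -> b != a -> P i b -> P' k b) ->
  (forall k b, P k b -> ~~ (A k && (b == a)) -> P' k b) ->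
  covers Z P' -> covers Z P.
Proof.
move=> Zr Zl irr Sia Pia HA H1 H2 cov M sM.
apply: (Zl M (delta_mx i a) ('X + (M i a)%:P)).
- by rewrite monic_neq0 // -[M i a]opprK polyCN monicXsubC.
- move=> k b nS; rewrite mxE; case: eqP => [ek|//]; case: eqP => [eb|//].
  by rewrite ek eb Sia in nS.
move=> s; rewrite !hornerE => piv; set M' := M + _.
have M'ia : M' i a = s + M i a by rewrite !mxE !eqxx mulr1 addrC.
have sM' : supported P M'.
  move=> k b nP; rewrite !mxE sM // add0r.
  case: (eqVneq k i) => [ek|]; last by rewrite mulr0.
  case: (eqVneq b a) => [eb|]; last by rewrite mulr0.
  by rewrite ek eb Pia in nP.
have nAi : ~~ A i by apply/negP => /HA; rewrite irr.
pose c k := if A k then M' k a / M' i a else 0.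
have cA k : c k != 0 -> rR k i by rewrite /c; case: ifP => [/HA|_ /eqP].
have ci : c i = 0 by rewrite /c (negPf nAi).
pose M2 := \matrix_(k, b) (M' k b + - c k * M' i b).
(* Membership is known for the cleared matrix [M2], so the elimination is run backwards; row [i] is
   the same in both because [c i = 0]. *)
have -> : M' = \matrix_(k, b) (M2 k b + c k * M2 i b).
  by apply/matrixP => k b; rewrite [RHS]mxE [M2 k b]mxE [M2 i b]mxE ci oppr0 mul0r addr0 mulNr subrK.
apply: Zr => //; apply: cov => k b nP'.
rewrite [M2 _ _]mxE; have [Ak|nAk] := boolP (A k).
  have [->|nba] := eqVneq b a.
    by rewrite /c Ak mulNr divfK ?subrr // M'ia.
  rewrite (sM' k b); last by apply: contra nP' => Pkb; apply: H2 => //; rewrite (negPf nba) andbF.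
  by rewrite (sM' i b) ?mulr0 ?addr0 //; apply: contra nP'; apply: H1.
rewrite /c (negPf nAk) oppr0 mul0r addr0 sM' //.
by apply: contra nP' => Pkb; apply: H2 => //; rewrite (negPf nAk).
Qed.
End Elimination.

Lemma line_closed_tr m n (Z : 'M[C]_(m, n) -> Prop) S :
  line_closed Z S -> line_closed (fun M => Z M^T) (fun b k => S k b).
Proof.
move=> Zl M E p p0 sE H; apply: (Zl _ E^T p p0) => [k b nS|s /H]; first by rewrite mxE sE.
by rewrite linearD linearZ.
Qed.

(** The transpose of [covers_clear_col], applied to the set of transposes. *)
Lemma covers_clear_row m n (Z : 'M[C]_(m, n) -> Prop) rC S (P P' : 'I_m -> 'I_n -> bool)
    i a (A : pred 'I_n) :
  col_closed Z rC -> line_closed Z S -> irreflexive rC -> S i a ->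
  P i a -> (forall b, A b -> rC b a) ->
  (forall k b, A b -> k != i -> P k a -> P' k b) ->
  (forall k b, P k b -> ~~ (A b && (k == i)) -> P' k b) ->
  covers Z P' -> covers Z P.
Proof.
move=> Zc Zl irr Sia Pia HA H1 H2 cov.
pose ZT M := Z M^T.
have Zr : row_closed ZT rC.
  move=> b c M Hc /(Zc b c _ Hc); rewrite /ZT; congr Z.
  by apply/matrixP => k l; rewrite !mxE mulrC.
have : covers ZT (fun b k => P k b).
  apply: (covers_clear_col (i := a) (a := i) (A := A) Zr (line_closed_tr Zl) irr
           (P' := fun b k => P' k b)) => //.
  - by move=> k b; apply: H1.
  - by move=> k b; apply: H2.
  by move=> M sM; apply: cov => k b nP; rewrite mxE sM.
by move=> cT M sM; rewrite -[M]trmxK; apply: cT => b k nP; rewrite mxE sM.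
Qed.

(* mu encodes that the bipartite graph P of rows and columns is a forest: an edge
   is a leaf among the edges of smaller or equal mu. *)
Definition forest m n (P : 'I_m -> 'I_n -> bool) (mu : 'I_m -> 'I_n -> nat) : Prop :=
  forall i a, P i a ->
    (forall b, b != a -> P i b -> (mu i a < mu i b)%N) \/
    (forall k, k != i -> P k a -> (mu i a < mu k a)%N).

(** Induction on the number of edges. An edge of maximal [mu] is alone in its row or in its column,
    so after the other edges are normalised one scaling factor is still free to normalise it. Rows
    without edges keep factor 1, as a restricted row scaling requires. *)
Lemma forest_scaling m n (P : 'I_m -> 'I_n -> bool) mu (M : 'M[C]_(m, n)) :
  forest P mu -> (forall i a, P i a -> M i a != 0) ->
  exists r c, [/\ (forall i : 'I_m, r i != 0 :> C), (forall a : 'I_n, c a != 0 :> C),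
     (forall i, (forall a, ~~ P i a) -> r i = 1) &
     (forall i a, P i a -> r i * M i a * c a = 1)].
Proof.
move: {2}#|_| (leqnn #|[set e : 'I_m * 'I_n | P e.1 e.2]|) => N.
elim: N P => [|N IHN] P leN fP nzM.
  exists (fun=> 1), (fun=> 1); split=> // [i|a|i a Pia]; rewrite ?oner_neq0 //.
  by move: leN; rewrite leqn0 cards_eq0 => /eqP/setP/(_ (i, a)); rewrite !inE Pia.
have [[i0 a0] /= P0|P0] := pickP [pred e : 'I_m * 'I_n | P e.1 e.2]; last first.
  apply: (IHN P) => //; rewrite (_ : [set _ | _] = set0) ?cards0 //.
  by apply/setP => e; rewrite !inE; apply: P0.
have [[i a] /= Pia mx] := @arg_maxnP _ (i0, a0) [pred e : 'I_m * 'I_n | P e.1 e.2]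
   (fun e => mu e.1 e.2) P0.
pose P1 k b := P k b && ((k, b) != (i, a)).
have [|||r [c [r0 c0 r1 rc]]] := IHN P1.
- rewrite -ltnS; apply: leq_trans leN; apply: proper_card; apply/properP; split.
    by apply/subsetP => e; rewrite !inE => /andP[].
  by exists (i, a); rewrite !inE //= /P1 eqxx andbF.
- by move=> k b /andP[/fP[H|H] _]; [left|right] => l nl /andP[Pl _]; apply: H.
- by move=> k b /andP[/nzM].
have Mia := nzM _ _ Pia.
case: (fP i a Pia) => H.
  have uni b : P i b -> b = a.
    move=> Pib; apply/eqP/negPn/negP => nba; have := H b nba Pib.
    by rewrite ltnNge (mx (i, b)).
  exists (fun k => if k == i then (M i a * c a)^-1 else r k), c; split=> //.
  - by move=> k; case: ifP => // _; rewrite invr_eq0 mulf_neq0.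
  - move=> k nP; case: eqP => [ek|_]; first by have := nP a; rewrite ek Pia.
    by apply: r1 => b; rewrite /P1 (negPf (nP b)).
  - move=> k b Pkb; case: eqP => [ek|/eqP nk].
      by subst k; rewrite (uni b Pkb) -mulrA mulVf // mulf_neq0.
    by apply: rc; rewrite /P1 Pkb /= xpair_eqE (negPf nk).
have uni k : P k a -> k = i.
  move=> Pka; apply/eqP/negPn/negP => nki; have := H k nki Pka.
  by rewrite ltnNge (mx (k, a)).
exists r, (fun b => if b == a then (r i * M i a)^-1 else c b); split=> //.
- by move=> b; case: ifP => // _; rewrite invr_eq0 mulf_neq0.
- by move=> k nP; apply: r1 => b; rewrite /P1 (negPf (nP b)).
- move=> k b Pkb; case: eqP => [eb|/eqP nb].
    by subst b; rewrite (uni k Pkb) mulfV // mulf_neq0.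
  by apply: rc; rewrite /P1 Pkb /= xpair_eqE (negPf nb) andbF.
Qed.

Definition indic m n (P : 'I_m -> 'I_n -> bool) : 'M[C]_(m, n) := \matrix_(i, a) (P i a)%:R.

(** Perturbing along [indic P] makes every entry on [P] nonzero; the torus then carries the matrix
    to [indic P]. *)
Lemma covers_forest m n (Z : 'M[C]_(m, n) -> Prop) (rows : pred 'I_m)
    (S P : 'I_m -> 'I_n -> bool) mu :
  line_closed Z S -> rowscale_closed Z rows -> colscale_closed Z ->
  (forall i a, P i a -> S i a) -> (forall i a, P i a -> rows i) -> forest P mu -> Z (indic P) -> covers Z P.
Proof.
move=> Zl Zr Zc PS rowsP fP ZP M sM.
apply: (Zl M (indic P) (\prod_(e : 'I_m * 'I_n | P e.1 e.2) ('X + (M e.1 e.2)%:P))).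
- exact: prod_XaddC_neq0.
- by move=> i a nS; rewrite mxE (negPf (contra (@PS i a) nS)).
move=> s; rewrite horner_prod => /prodf_neq0 nz; set M' := M + _.
have [|r [c [r0 c0 r1 rc]]] := @forest_scaling m n P mu M' fP.
  move=> i a Pia; rewrite !mxE Pia mulr1 addrC; have := nz (i, a) Pia.
  by rewrite !hornerE.
have -> : M' = \matrix_(k, b) ((r k)^-1 * (\matrix_(k, b) (indic P k b * (c b)^-1)) k b).
  apply/matrixP => k b; rewrite [in RHS]mxE [in RHS]mxE [indic _ _ _]mxE.
  have [Pkb|nP] := boolP (P k b).
    rewrite mul1r -[LHS](mulKf (r0 k)); congr (_ * _).
    by rewrite -[LHS](mulfK (c0 b)) rc // mul1r.
  by rewrite mul0r mulr0 !mxE sM // (negPf nP) mulr0 addr0.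
apply: Zr.
- by move=> i; rewrite invr_eq0.
- move=> i ni; rewrite r1 ?invr1 // => a; apply: contra ni; exact: rowsP.
by apply: Zc => // a; rewrite invr_eq0.
Qed.

(** * Highest weight vectors *)

(** Inverse Vandermonde matrix at the nodes 1, ..., D. The node 0 is avoided because one-parameter
    subgroups are only defined at nonzero parameters. *)
Lemma poly_coef_interp D : exists l : 'I_D -> 'I_D -> C,
  forall P : {poly C}, (size P <= D)%N ->
    forall j : 'I_D, P`_j = \sum_i l i j * P.[i.+1%:R].
Proof.
pose x : 'rV[C]_D := \row_i i.+1%:R; pose V := Vandermonde D x.
have uV : V \in unitmx.
  rewrite unitmxE unitfE det_Vandermonde; apply/prodf_neq0 => i _.
  apply/prodf_neq0 => j ij; rewrite !mxE subr_eq0; apply/eqP => /natrC_inj [] e.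
  by rewrite e ltnn in ij.
exists (fun i j => invmx V i j) => P sP j.
pose c : 'rV[C]_D := \row_k P`_k.
have -> : P`_j = c 0 j by rewrite mxE.
rewrite -[c](mulmxK uV) mxE; apply: eq_bigr => i _; rewrite mulrC; congr (_ * _).
rewrite mxE (horner_coef_wide _ sP); apply: eq_bigr => k _.
by rewrite !mxE.
Qed.

Lemma poly_eq_of_nz (P Q : {poly C}) : (forall s, s != 0 -> P.[s] = Q.[s]) -> P = Q.
Proof.
move=> e; apply/eqP; rewrite -subr_eq0; apply/eqP.
apply: (poly_eq0_of_generic (p := 'X)); first by rewrite polyX_eq0.
by move=> s; rewrite hornerX hornerD hornerN => /e ->; rewrite subrr.
Qed.

Lemma sum_pow_inj D (a b : nat -> C) :
  (forall s, s != 0 -> \sum_(j < D) s ^+ j * a j = \sum_(j < D) s ^+ j * b j) ->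
  forall j, (j < D)%N -> a j = b j.
Proof.
move=> e j jD.
have hE (c : nat -> C) s : (\poly_(j < D) c j).[s] = \sum_(j < D) s ^+ j * c j.
  by rewrite horner_poly; apply: eq_bigr => k _; rewrite mulrC.
have /(congr1 (fun p : {poly C} => p`_j)) : \poly_(j < D) a j = \poly_(j < D) b j.
  by apply: poly_eq_of_nz => s s0; rewrite !hE e.
by rewrite !coef_poly jD.
Qed.

Definition inUL N (Ns : seq nat) (u : 'M[C]_N) : Prop :=
  forall i j : 'I_N, ~~ ((i < j)%N && (blk Ns i == blk Ns j)) -> u i j = (i == j)%:R.

Definition dg N (r : 'I_N -> C) : 'M[C]_N := \matrix_(i, j) (r i *+ (i == j)).

Lemma dg_mul N (r : 'I_N -> C) m (M : 'M[C]_(N, m)) :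
  dg r *m M = \matrix_(i, a) (r i * M i a).
Proof.
apply/matrixP => i a; rewrite !mxE (bigD1 i) //= big1 ?addr0; first by rewrite mxE eqxx.
by move=> j nj; rewrite mxE eq_sym (negPf nj) mul0r.
Qed.

Lemma mul_dg N (r : 'I_N -> C) m (M : 'M[C]_(m, N)) :
  M *m dg r = \matrix_(i, a) (M i a * r a).
Proof.
apply/matrixP => i a; rewrite !mxE (bigD1 a) //= big1 ?addr0; first by rewrite mxE eqxx.
by move=> j nj; rewrite mxE (negPf nj) mulr0.
Qed.

Lemma dg_unit N (r : 'I_N -> C) : (forall i, r i != 0) -> dg r \in unitmx.
Proof.
move=> r0; rewrite unitmxE unitfE det_uptri; last first.
  by move=> i j ji; rewrite mxE; case: eqP => // e; rewrite e ltnn in ji.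
by apply/prodf_neq0 => i _; rewrite mxE eqxx mulr1n.
Qed.

Lemma dg_Levi N Ns (r : 'I_N -> C) : (forall i, r i != 0) -> inLevi Ns (dg r).
Proof.
move=> r0; split; first exact: dg_unit.
by move=> i j nij; rewrite mxE; case: eqP => // e; rewrite e in nij.
Qed.

Lemma UL_Levi N Ns (u : 'M[C]_N) : inUL Ns u -> inLevi Ns u.
Proof.
move=> uU; split.
  rewrite unitmxE unitfE det_uptri.
    by apply/prodf_neq0 => i _; rewrite uU ?ltnn // eqxx oner_neq0.
  move=> i j ji; rewrite uU; last by rewrite ltnNge (ltnW ji).
  by case: eqP => // e; rewrite e ltnn in ji.
move=> i j nij; rewrite uU; last by apply/negP => /andP[_ /eqP].
by case: eqP => // e; rewrite e in nij.
Qed.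

Lemma dg1 N : dg (fun _ : 'I_N => 1) = 1%:M.
Proof. by apply/matrixP => i j; rewrite !mxE. Qed.

Lemma dgM N (r q : 'I_N -> C) : dg r *m dg q = dg (fun i => r i * q i).
Proof. by rewrite dg_mul; apply/matrixP => i j; rewrite !mxE mulrnAr. Qed.

Section HighestWeight.
Variables (N : nat) (Ns : seq nat) (Y : Type).
Variable act : 'M[C]_N -> (Y -> C) -> (Y -> C).
Variable W : (Y -> C) -> Prop.
Hypothesis actD : forall g f h, act g (fun y => f y + h y) = fun y => act g f y + act g h y.
Hypothesis actZ : forall g c f, act g (fun y => c * f y) = fun y => c * act g f y.
Hypothesis act_mul : forall g h f, act g (act h f) = act (h *m g) f.
Hypothesis act1 : forall f, act 1%:M f = f.
Hypothesis W0 : W (fun _ => 0).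
Hypothesis WD : forall f h, W f -> W h -> W (fun y => f y + h y).
Hypothesis WZ : forall c f, W f -> W (fun y => c * f y).
Hypothesis WL : forall g f, inLevi Ns g -> W f -> W (act g f).
(** This replaces local finiteness: one bound [D] serves all [f] in [W] and all points, and depends
    only on the degree of the family of group elements. *)
Hypothesis Wpoly : forall k, exists D, forall f, W f ->
  forall Mx : 'M[{poly C}]_N, (forall i j, size (Mx i j) <= k)%N ->
  forall y, exists2 P : {poly C}, (size P <= D)%N &
    forall s, inLevi Ns (map_mx (horner_eval s) Mx) ->
      act (map_mx (horner_eval s) Mx) f y = P.[s].

Lemma act_sum g D (c : nat -> C) (G : nat -> Y -> C) :
  act g (fun y => \sum_(j < D) c j * G j y) = fun y => \sum_(j < D) c j * act g (G j) y.
Proof.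
elim: D => [|D IH].
  have := actZ g 0 (fun _ => 0); rewrite (_ : (fun y => 0 * 0) = fun _ : Y => 0); last first.
    by apply: funext => y; rewrite mul0r.
  move=> e; rewrite (_ : (fun y => _) = fun _ : Y => 0).
    by rewrite e; apply: funext => y; rewrite mul0r big_ord0.
  by apply: funext => y; rewrite big_ord0.
rewrite (_ : (fun y => _) = fun y => \sum_(j < D) c j * G j y + c D * G D y); last first.
  by apply: funext => y; rewrite big_ord_recr.
by rewrite actD IH actZ; apply: funext => y; rewrite big_ord_recr.
Qed.

Lemma W_sum (I : Type) (r : seq I) (c : I -> C) (G : I -> Y -> C) :
  (forall i, W (G i)) -> W (fun y => \sum_(i <- r) c i * G i y).
Proof.
move=> WG; elim: r => [|i r IH].
  by rewrite (_ : (fun y => _) = fun _ : Y => 0) //; apply: funext => y; rewrite big_nil.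
rewrite (_ : (fun y => _) = fun y => c i * G i y + \sum_(i <- r) c i * G i y); last first.
  by apply: funext => y; rewrite big_cons.
by apply: WD => //; apply: WZ.
Qed.

(* The components stay in W because they are linear combinations, by
   interpolation, of the values of the family at finitely many parameters. *)
Lemma act_expand k : exists D, forall f, W f ->
  forall Mx : 'M[{poly C}]_N, (forall i j, size (Mx i j) <= k)%N ->
  (forall s, s != 0 -> inLevi Ns (map_mx (horner_eval s) Mx)) ->
  exists2 G : nat -> Y -> C, (forall j, W (G j)) &
    forall s, s != 0 ->
      act (map_mx (horner_eval s) Mx) f = fun y => \sum_(j < D) s ^+ j * G j y.
Proof.
have [D HD] := Wpoly k; exists D => f Wf Mx sMx LMx.
have /choice[P HP] : forall y, exists P : {poly C}, (size P <= D)%N /\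
    forall s, inLevi Ns (map_mx (horner_eval s) Mx) ->
      act (map_mx (horner_eval s) Mx) f y = P.[s].
  by move=> y; have [P] := HD f Wf Mx sMx y; exists P.
exists (fun j y => (P y)`_j) => [j|s s0].
  have [jD|Dj] := ltnP j D; last first.
    rewrite (_ : (fun y => _) = fun _ : Y => 0) //; apply: funext => y.
    by rewrite nth_default // (leq_trans _ Dj) //; have [] := HP y.
  have [l Hl] := poly_coef_interp D.
  rewrite (_ : (fun y => _) =
      fun y => \sum_i l i (Ordinal jD) * act (map_mx (horner_eval i.+1%:R) Mx) f y).
    by apply: W_sum => i; apply: WL => //; apply: LMx; rewrite natrC_eq0.
  apply: funext => y; have [sP eP] := HP y.
  by rewrite (Hl _ sP (Ordinal jD)); apply: eq_bigr => i _; rewrite eP //; apply: LMx; rewrite natrC_eq0.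
apply: funext => y; have [sP ->] := HP y; last exact: LMx.
by rewrite (horner_coef_wide _ sP); apply: eq_bigr => j _; rewrite mulrC.
Qed.

Definition dgX (e : 'I_N -> nat) : 'M[{poly C}]_N := \matrix_(i, j) ('X^(e i) *+ (i == j)).

Lemma dgXE e s : map_mx (horner_eval s) (dgX e) = dg (fun i => s ^+ e i).
Proof.
by apply/matrixP => i j; rewrite !mxE raddfMn /= /horner_eval hornerXn.
Qed.

(** The coefficients of [s ^+ j] are the weight components of [f] for the one-parameter subgroup
    given by [e]. That they are eigenvectors follows by comparing coefficients of [s] in the action
    of the product of the elements at [s] and [t]. *)
Lemma weight_split (e : 'I_N -> nat) : exists D, forall f, W f ->
  exists G : nat -> Y -> C, [/\ forall j, W (G j),
    forall s, s != 0 -> act (dg (fun i => s ^+ e i)) f = (fun y => \sum_(j < D) s ^+ j * G j y),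
    f = (fun y => \sum_(j < D) G j y) &
    forall j (t : C), (j < D)%N -> t != 0 ->
      act (dg (fun i => t ^+ e i)) (G j) = fun y => t ^+ j * G j y].
Proof.
have [D HD] := act_expand (\max_i (e i).+1); exists D => f Wf.
have [|s s0|G WG EG] := HD f Wf (dgX e).
- move=> i j; rewrite mxE; apply: leq_trans (leq_bigmax i).
  by case: (i == j); rewrite ?mulr1n ?mulr0n ?size_poly0 ?size_polyXn.
- by rewrite dgXE; apply: dg_Levi => i; rewrite expf_neq0.
have E1 s : s != 0 ->
    act (dg (fun i => s ^+ e i)) f = (fun y => \sum_(j < D) s ^+ j * G j y).
  by move=> s0; rewrite -EG // dgXE.
exists G; split=> //.
  rewrite -[LHS]act1 -dg1.
  have -> : dg (fun _ : 'I_N => 1) = dg (fun i => (1 : C) ^+ e i).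
    by congr dg; apply: funext => i; rewrite expr1n.
  by rewrite E1 ?oner_neq0 //; apply: funext => y; apply: eq_bigr => j _; rewrite expr1n mul1r.
move=> j t jD t0; apply: funext => y.
move: j jD; apply: (@sum_pow_inj D (fun j => act _ (G j) y) (fun j => t ^+ j * G j y)) => s s0.
have := congr1 (fun h => act (dg (fun i => t ^+ e i)) h y) (E1 s s0).
rewrite act_mul dgM act_sum => <-.
have -> : dg (fun i => s ^+ e i * t ^+ e i) = dg (fun i => (s * t) ^+ e i).
  by congr dg; apply: funext => i; rewrite exprMn.
by rewrite E1 ?mulf_neq0 //; apply: eq_bigr => j _; rewrite exprMn mulrA.
Qed.

Definition ULfixed (f : Y -> C) : Prop := forall u, inUL Ns u -> act u f = f.

(** Take a vector of maximal weight [j] for the one-parameter subgroup with exponents [e i = i]. A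
    unipotent [u] fixes its part of weight [j] and adds only larger weights, which do not occur. *)
Lemma exists_ULfixed : (exists2 f, W f & f <> (fun _ => 0)) ->
  exists f, [/\ W f, f <> (fun _ => 0) & ULfixed f].
Proof.
case=> f1 Wf1 nf1.
pose e (i : 'I_N) : nat := i.
have [D HD] := weight_split e.
pose wt j := exists f, [/\ W f, f <> (fun _ => 0) &
   forall t : C, t != 0 -> act (dg (fun i => t ^+ e i)) f = fun y => t ^+ j * f y].
(* Weights are bounded because every expansion along this subgroup has fewer than [D + 1] terms;
   this makes a maximal weight available. *)
have wtD j : wt j -> (j < D)%N.
  case=> f [Wf nf wf]; rewrite ltnNge; apply/negP => Dj.
  apply: nf; apply: funext => y; have [G [_ E _ _]] := HD f Wf.
  have := @sum_pow_inj j.+1 (fun i => if (i < D)%N then G i y else 0) (fun i => if i == j then f y else 0).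
  move=> /(_ _ j (ltnSn j)); rewrite eqxx ltnNge Dj /= => <- // s s0.
  rewrite [RHS]big_ord_recr /= eqxx [X in _ = X + _]big1 ?add0r; last first.
    by move=> i _; rewrite ltn_eqF ?mulr0 // ltn_ord.
  have := congr1 (fun h => h y) (wf s s0); rewrite E // => <-.
  rewrite (big_ord_widen j.+1 (fun i => s ^+ i * G i y)) ?(leqW Dj) //.
  by rewrite [RHS]big_mkcond; apply: eq_bigr => i _; case: ifP; rewrite ?mulr0.
have [j0 wj0] : exists j, wt j.
  have [G [WG _ E wG]] := HD f1 Wf1; apply: contrapT => nwt; apply: nf1; rewrite E.
  apply: funext => y; apply: big1 => j _; have [//|G0] := EM (G j y = 0).
  case: nwt; exists j; exists (G j); split=> //; first by move=> GE; rewrite GE in G0.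
  by move=> t t0; apply: wG.
have [j [wj jmax]] : exists j, wt j /\ forall i, wt i -> (i <= j)%N.
  have ex : exists j, `[< wt j >] by exists j0; apply/asboolP.
  have ub : forall j, `[< wt j >] -> (j <= D)%N by move=> i /asboolP /wtD /ltnW.
  case: (ex_maxnP ex ub) => j /asboolP wj mj; exists j; split=> // i wi.
  by apply: mj; apply/asboolP.
case: wj => f [Wf nf wf]; exists f; split=> // u uU.
have [H [WH EH hE wH]] := HD (act u f) (WL (UL_Levi uU) Wf).
have big0 i : (i < D)%N -> (j < i)%N -> H i = fun _ => 0.
  move=> iD ji; apply: contrapT => nH; have := jmax i; rewrite leqNgt ji.
  by case/(_ _)/negP; rewrite //; exists (H i); split=> // t; apply: wH.
(* conjugating u by the one-parameter subgroup contracts it to 1 *)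
pose us : 'M[{poly C}]_N := \matrix_(i, k) ((u i k)%:P * 'X^(k - i)).
have usE s : s != 0 -> u *m dg (fun i => s ^+ e i) =
    dg (fun i => s ^+ e i) *m map_mx (horner_eval s) us.
  move=> s0; rewrite mul_dg dg_mul; apply/matrixP => i k; rewrite !mxE /horner_eval hornerM hornerC hornerXn.
  have [ik|ki] := leqP i k; first by rewrite mulrCA -exprD subnKC.
  rewrite uU ?ltnNge ?(ltnW ki) // (_ : (i == k) = false) ?mul0r ?mulr0 //.
  by apply/eqP => ik; rewrite ik ltnn in ki.
have usL s : inLevi Ns (map_mx (horner_eval s) us).
  apply: UL_Levi => i k nik; rewrite !mxE /horner_eval hornerM hornerC hornerXn uU //.
  by case: eqP => [->|]; rewrite ?subnn ?mulr1 ?mul0r.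
have us0 : map_mx (horner_eval 0) us = 1%:M.
  apply/matrixP => i k; rewrite !mxE /horner_eval hornerM hornerC hornerXn.
  have [ik|ki|/val_inj->] := ltngtP i k.
  - rewrite expr0n subn_eq0 leqNgt ik mulr0 (_ : (i == k) = false) //.
    by apply/eqP => e'; rewrite e' ltnn in ik.
  - rewrite uU ?ltnNge ?(ltnW ki) // (_ : (i == k) = false) ?mul0r //.
    by apply/eqP => e'; rewrite e' ltnn in ki.
  - by rewrite subnn expr0 mulr1 uU ?ltnn // eqxx.
have [D' HD'] := Wpoly (\max_(p : 'I_N * 'I_N) size (us p.1 p.2)).
apply: funext => y.
have [|Q sQ EQ] := HD' f Wf us _ y.
  by move=> i k; apply: (leq_bigmax (i, k)).
(* Moving the torus element past [u] turns its action on [act u f] into [s ^+ j] times [act] of the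
   contracted element on [f]. Hence there are no components below [j], and the component at [j] is
   the value [Q(0) = f y]. *)
have key : \poly_(i < D) H i y = 'X^j * Q.
  apply: poly_eq_of_nz => s s0; rewrite horner_poly hornerM hornerXn -EQ; last exact: usL.
  rewrite (eq_bigr (fun i : 'I_D => s ^+ i * H i y)); last by move=> i _; rewrite mulrC.
  have := congr1 (fun h => h y) (EH s s0) => /= <-.
  rewrite act_mul usE // -act_mul wf //.
  by rewrite actZ.
have Q0 : Q`_0 = f y.
  by rewrite -horner_coef0 -(EQ 0 (usL 0)) us0 act1.
rewrite hE.
have jD : (j < D)%N by apply: wtD; exists f; split.
rewrite (bigD1 (Ordinal jD)) //= big1 ?addr0.
  have := congr1 (fun p : {poly C} => p`_j) key.
  by rewrite coef_poly jD coefXnM ltnn subnn Q0.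
move=> i ni; have [ij|ij|ij] := ltngtP i j.
- have := congr1 (fun p : {poly C} => p`_i) key.
  by rewrite coef_poly ltn_ord coefXnM ij.
- by rewrite big0.
- by case/eqP: ni; apply: val_inj.
Qed.

Definition Tweight (alpha : 'I_N -> nat) (f : Y -> C) : Prop :=
  forall r : 'I_N -> C, (forall i, r i != 0) ->
    act (dg r) f = fun y => (\prod_i r i ^+ alpha i) * f y.

Lemma UL_conj (u : 'M[C]_N) (r : 'I_N -> C) : (forall i, r i != 0) -> inUL Ns u ->
  exists2 u', inUL Ns u' & dg r *m u = u' *m dg r.
Proof.
move=> r0 uU; exists (\matrix_(i, j) (r i * u i j / r j)).
  move=> i j nij; rewrite mxE uU //; case: eqP => [->|_]; last by rewrite mulr0 mul0r.
  by rewrite mulr1 divff.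
by rewrite dg_mul mul_dg; apply/matrixP => i j; rewrite !mxE divfK.
Qed.

(** The torus is diagonalised one coordinate at a time. Passing to a weight component for coordinate
    [m] keeps the earlier weights, as the torus commutes, and keeps invariance under unipotents, as
    the torus normalises them. *)
Lemma exists_highest_weight : (exists2 f, W f & f <> (fun _ => 0)) ->
  exists f, [/\ W f, f <> (fun _ => 0), ULfixed f & exists alpha, Tweight alpha f].
Proof.
move=> /exists_ULfixed [f0 [Wf0 nf0 Uf0]].
suff /(_ N) [f [Wf nf Uf [al wf]]] : forall m, exists f,
    [/\ W f, f <> (fun _ => 0), ULfixed f &
    exists alpha : 'I_N -> nat, forall r : 'I_N -> C,
      (forall i, r i != 0) -> (forall i : 'I_N, (m <= i)%N -> r i = 1) ->
      act (dg r) f = fun y => (\prod_i r i ^+ alpha i) * f y].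
  exists f; split=> //; exists al => r r0; apply: wf => // i.
  by rewrite leqNgt ltn_ord.
elim=> [|m [f [Wf nf Uf [al wf]]]].
  exists f0; split=> //; exists (fun _ => 0%N) => r r0 r1.
  rewrite (_ : r = fun _ => 1); last by apply: funext => i; rewrite r1.
  by rewrite dg1 act1; apply: funext => y; rewrite big1 ?mul1r // => i _; rewrite expr1n.
have [mN|Nm] := ltnP m N; last first.
  exists f; split=> //; exists al => r r0 r1; apply: wf => // i mi.
  by have := ltn_ord i; rewrite ltnNge (leq_trans Nm).
pose e (i : 'I_N) : nat := (i == m :> nat).
have [D HD] := weight_split e.
have [G [WG EG fE wG]] := HD f Wf.
have [j [jD nG]] : exists j, (j < D)%N /\ G j <> fun _ => 0.
  apply: contrapT => nj; apply: nf; rewrite fE; apply: funext => y.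
  apply: big1 => j _; apply: contrapT => Gj; apply: nj; exists j; split=> // GE.
  by rewrite GE in Gj.
have e0 (s : C) (i : 'I_N) : s != 0 -> s ^+ e i != 0 by move=> s0; rewrite expf_neq0.
exists (G j); split=> //.
  move=> u uU; apply: funext => y; move: j jD {nG}.
  apply: (@sum_pow_inj D (fun j => act u (G j) y) (fun j => G j y)) => s s0.
  have := congr1 (fun h => act u h y) (EG s s0); rewrite act_sum => <-.
  have [u' u'U cu] := @UL_conj u (fun i => s ^+ e i) (fun i => e0 s i s0) uU.
  by rewrite act_mul cu -act_mul Uf // EG.
exists (fun i : 'I_N => if i == m :> nat then j else al i) => r r0 r1.
pose r' (i : 'I_N) := if i == m :> nat then 1 else r i.
pose t := r (Ordinal mN).
have rE : dg r = dg r' *m dg (fun i => t ^+ e i).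
  rewrite dgM; congr dg; apply: funext => i; rewrite /r' /e; case: eqP => [im|_].
    by rewrite mul1r expr1 /t; congr r; apply: val_inj.
  by rewrite expr0 mulr1.
have r'0 i : r' i != 0 by rewrite /r'; case: ifP => // _; rewrite oner_neq0.
have Gr' : act (dg r') (G j) = fun y => (\prod_i r' i ^+ al i) * G j y.
  apply: funext => y; move: j jD {nG}.
  apply: (@sum_pow_inj D (fun j => act (dg r') (G j) y) (fun j => _ * G j y)) => s s0.
  have := congr1 (fun h => act (dg r') h y) (EG s s0); rewrite act_sum => <-.
  rewrite act_mul dgM.
  have -> : dg (fun i => s ^+ e i * r' i) = dg r' *m dg (fun i => s ^+ e i).
    by rewrite dgM; congr dg; apply: funext => i; rewrite mulrC.
  rewrite -act_mul wf //; last first.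
    move=> i mi; rewrite /r'; case: eqP => // /eqP nim; apply: r1.
    by rewrite ltn_neqAle eq_sym nim.
  rewrite actZ EG // big_distrr /=; apply: eq_bigr => i _; ring.
rewrite rE -act_mul Gr' actZ wG ?r0 //; apply: funext => y.
rewrite mulrA; congr (_ * _).
rewrite (bigD1 (Ordinal mN)) //= [RHS](bigD1 (Ordinal mN)) //= /r' !eqxx expr1n mul1r mulrC.
congr (_ * _); apply: eq_bigr => i ni.
by have /negPf -> : i != m :> nat by apply: contra ni => /eqP im; apply/eqP/val_inj.
Qed.

End HighestWeight.

(** * Multiplicity freeness from a dense orbit *)

(** Degree is measured along curves, since a [polyfun] has no canonical polynomial expression. *)
Definition deg_le (T : finType) (n : nat) (F : {ffun T -> C} -> C) : Prop :=
  forall m (x : T -> {poly C}), (forall t, size (x t) <= m.+1)%N ->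
    exists2 P : {poly C}, (size P <= (n * m).+1)%N &
      forall s, F [ffun t => (x t).[s]] = P.[s].

Lemma polyfun_deg (T : finType) (F : {ffun T -> C} -> C) :
  polyfun F -> exists n, deg_le n F.
Proof.
elim=> [c|t|G H _ [n IG] _ [k IH]|G H _ [n IG] _ [k IH]].
- exists 0%N => m x _; exists c%:P => [|s]; last by rewrite hornerC.
  exact: leq_trans (size_polyC_leq1 c) _.
- by exists 1%N => m x sx; exists (x t) => [|s]; rewrite ?mul1n ?ffunE.
- exists (maxn n k) => m x sx.
  have [P sP PE] := IG m x sx; have [Q sQ QE] := IH m x sx.
  exists (P + Q) => [|s]; last by rewrite PE QE hornerD.
  apply: leq_trans (size_polyD _ _) _; rewrite geq_max.
  by rewrite (leq_trans sP) ?(leq_trans sQ) // ltnS leq_mul2r ?leq_maxl ?leq_maxr orbT.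
- exists (n + k)%N => m x sx.
  have [P sP PE] := IG m x sx; have [Q sQ QE] := IH m x sx.
  exists (P * Q) => [|s]; last by rewrite PE QE hornerM.
  apply: leq_trans (size_polyMleq _ _) _; rewrite mulnDl.
  by move: sP sQ; lia.
Qed.

Lemma deg_le_wedge d N n (g : 'M[C]_N) (F : pt d N -> C) :
  deg_le n F -> deg_le n (fun x => F (wedge g x)).
Proof.
move=> dF m x sx.
have [I|P sP PE] := dF m (fun I => \sum_J minor g I J *: x J).
  apply: leq_trans (size_sum _ _ _) _; apply/bigmax_leqP => J _.
  exact: leq_trans (size_scale_leq _ _) (sx J).
exists P => // s; rewrite -PE; congr F; apply/ffunP => I; rewrite !ffunE horner_sum.
by apply: eq_bigr => J _; rewrite ffunE hornerZ.
Qed.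

Lemma size_det_le d k (A : 'M[{poly C}]_d) :
  (forall i j, size (A i j) <= k)%N -> (size (\det A) <= (d * k).+1)%N.
Proof.
move=> sA; apply: leq_trans (size_sum _ _ _) _; apply/bigmax_leqP => s _.
rewrite size_Msign; apply: leq_trans (size_prod_leq _ _) _; rewrite leq_subLR.
apply: leq_ltn_trans (_ : (d * k < _)%N); last by rewrite addnS ltnS leq_addl.
rewrite -[X in (_ <= X * _)%N](card_ord d) -sum_nat_const.
by apply: leq_sum => i _; apply: sA.
Qed.

Definition upper_unip n (v : 'M[C]_n) : Prop :=
  forall a b : 'I_n, ~~ (a < b)%N -> v a b = (a == b)%:R.

Lemma upper_unip_det n (v : 'M[C]_n) : upper_unip v -> \det v = 1.
Proof.
move=> uv; rewrite det_uptri.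
  by rewrite big1 // => i _; rewrite uv ?ltnn // eqxx.
move=> i j ji; rewrite uv; last by rewrite ltnNge (ltnW ji).
by case: eqP => // e; rewrite e ltnn in ji.
Qed.

Lemma unip_inv n (v : 'M[C]_n) :
  upper_unip v -> upper_unip (invmx v) /\ v \in unitmx.
Proof.
move=> uv.
have vunit : v \in unitmx by rewrite unitmxE upper_unip_det // unitr1.
split=> //; have vu : invmx v *m v = 1%:M by rewrite mulVmx.
move=> i j; rewrite -leqNgt => ji.
move: {2}(val j).+1 (ltnSn (val j)) => m; elim: m j ji => // m IH j ji jm.
have := congr1 (fun A : 'M[C]_n => A i j) vu.
rewrite !mxE (bigD1 j) //= (uv j j) ?ltnn // eqxx mulr1 big1 ?addr0 // => k nk.
have [kj|jk] := ltnP k j.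
  rewrite IH ?(ltnW (leq_trans kj ji)) ?(leq_trans kj) //.
  rewrite (_ : (i == k) = false) ?mul0r //; apply/eqP => e.
  by rewrite e leqNgt kj in ji.
by rewrite uv ?ltnNge ?jk // (negPf nk) mulr0.
Qed.

Section SubmoduleFacts.
Variables (d N : nat) (w : Idn d N) (Ns : seq nat).
Hypothesis st : stable w Ns.

(** [actf] uses the inverse of [g]; here the entries of [g] occur polynomially, so weights are
    natural numbers. Submodules are stable under both, because the Levi is closed under inversion.
    Products are reversed. *)
Definition actR (g : 'M[C]_N) (f : pt d N -> C) : pt d N -> C := fun x => f (wedge g x).

Lemma actR_mul g h f : actR g (actR h f) = actR (h *m g) f.
Proof. by apply: funext => x; rewrite /actR wedge_mul. Qed.

Lemma actR1 f : actR 1%:M f = f.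
Proof. by apply: funext => x; rewrite /actR wedge1. Qed.

Lemma Levi_inv (g : 'M[C]_N) : inLevi Ns g -> inLevi Ns (invmx g).
Proof.
case=> ug gb; split; first by rewrite unitmx_inv.
(* the inverse commutes with the block projections because g does *)
move=> i j nij; pose e : 'M[C]_N := dg (fun k => (blk Ns k == blk Ns i)%:R).
have eg : e *m g = g *m e.
  rewrite dg_mul mul_dg; apply/matrixP => k l; rewrite !mxE.
  have [ekl|/eqP/gb->] := eqVneq (blk Ns k) (blk Ns l); last by rewrite mulr0 mul0r.
  by rewrite ekl mulrC.
have eV : invmx g *m e = e *m invmx g.
  rewrite -[LHS](mulmxK ug) -[invmx g *m e *m g]mulmxA eg.
  by rewrite [invmx g *m _]mulmxA mulVmx // mul1mx.
have := congr1 (fun A : 'M[C]_N => A i j) eV.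
rewrite mul_dg dg_mul !mxE eqxx mul1r => <-.
by case: eqP => [e1|]; rewrite ?mulr0 //; case: nij.
Qed.

Lemma stable_iff g x : inLevi Ns g -> inXhat w (wedge g x) <-> inXhat w x.
Proof.
move=> Lg; split; last exact: st.
move=> /(st (Levi_inv Lg)); rewrite -wedge_mul mulVmx ?wedge1 //; by case: Lg.
Qed.

Lemma submod_actR W g f : submod w Ns W -> inLevi Ns g -> W f -> W (actR g f).
Proof.
case=> _ _ _ _ WL Lg Wf; have := WL _ _ (Levi_inv Lg) Wf.
by rewrite /actf invmxK.
Qed.

Lemma actR_actf g : actR (invmx g) = @actf d N g.
Proof. by []. Qed.

Lemma submod_highest_weight W : submod w Ns W ->
  (exists2 f, W f & f <> @zerof d N) ->
  exists f, [/\ W f, f <> @zerof d N, ULfixed Ns actR f &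
                exists alpha, Tweight actR alpha f].
Proof.
move=> sW [f0 Wf0 nf0]; case: (sW) => Wreg W0 WD WZ WL.
have [F0 [pF0 [eF0 _]]] := Wreg _ Wf0.
have [n dF0] := polyfun_deg pF0.
(* [W] may contain functions of unbounded degree. The part of degree at most [n] is again stable,
   contains [f0], and satisfies the uniform bound that [exists_highest_weight] asks for. *)
pose V h := W h /\ exists F, deg_le n F /\ forall x, inXhat w x -> h x = F x.
have [|||||f h [Wf [F [dF EF]]] [Wh [H [dH EH]]]|c f [Wf [F [dF EF]]]|g f Lg [Wf [F [dF EF]]]|k||f [[Wf _] nf Uf Tf]] :=
    @exists_highest_weight N Ns (pt d N) actR V; last by exists f.
- by [].
- by [].
- exact: actR_mul.
- exact: actR1.
- split; first exact: W0.
  by exists (fun=> 0); split=> // m x _; exists 0 => [|s]; rewrite ?size_poly0 ?horner0.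
- split; first exact: WD.
  exists (fun x => F x + H x); split=> [m x sx|x Xx]; last by rewrite EF ?EH.
  have [P sP PE] := dF m x sx; have [Q sQ QE] := dH m x sx.
  exists (P + Q) => [|s]; last by rewrite PE QE hornerD.
  by apply: leq_trans (size_polyD _ _) _; rewrite geq_max sP sQ.
- split; first exact: WZ.
  exists (fun x => c * F x); split=> [m x sx|x Xx]; last by rewrite EF.
  have [P sP PE] := dF m x sx; exists (c *: P) => [|s]; last by rewrite PE hornerZ.
  exact: leq_trans (size_scale_leq _ _) sP.
- split; first exact: submod_actR.
  exists (fun x => F (wedge g x)); split; first exact: deg_le_wedge.
  by move=> x Xx; apply: EF; apply: st.
- exists (n * (d * k)).+1 => f [Wf [F [dF EF]]] Mx sMx y.
  have [Xy|nXy] := EM (inXhat w y); last first.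
    exists 0 => [|s Ls]; first by rewrite size_poly0.
    have [G [_ [_ f0']]] := Wreg _ Wf.
    by rewrite horner0 /actR f0' // => /(stable_iff _ Ls).
  have [I|P sP PE] := dF (d * k)%N
      (fun I => \sum_J (y J) *: \det (\matrix_(a, b) Mx (val I a) (val J b))).
    apply: leq_trans (size_sum _ _ _) _; apply/bigmax_leqP => J _.
    apply: leq_trans (size_scale_leq _ _) _; apply: size_det_le => a b.
    by rewrite mxE.
  exists P => // s Ls; rewrite /actR EF; last by apply: st.
  rewrite -PE; congr F; apply/ffunP => I; rewrite !ffunE horner_sum.
  apply: eq_bigr => J _; rewrite hornerZ mulrC; congr (_ * _).
  rewrite -[RHS]/(horner_eval s _) -det_map_mx; congr (\det _).
  by apply/matrixP => a b; rewrite !mxE.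
- by exists f0 => //; split=> //; exists F0.
Qed.

Lemma isReg_eq0 f : isReg w f -> (forall M, in_shape w M -> f (pl M) = 0) -> f = @zerof d N.
Proof.
move=> [F [pF [EF f0]]] H; apply: funext => x; rewrite /zerof.
have [Xx|/f0//] := EM (inXhat w x); rewrite EF //.
by apply: Xhat_vanish Xx => // M sM; rewrite -EF ?H //; apply: in_shape_Xhat.
Qed.

Definition wshape (i : 'I_N) (a : 'I_d) : bool := (i <= val w a)%N.

Definition UL_closed (Z : 'M[C]_(N, d) -> Prop) : Prop :=
  forall u M, inUL Ns u -> Z M -> Z (u *m M).

Definition unip_closed (Z : 'M[C]_(N, d) -> Prop) : Prop :=
  forall v M, upper_unip v -> Z M -> Z (M *m v).

Lemma pl_mulr (M : 'M[C]_(N, d)) (v : 'M[C]_d) :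
  pl (M *m v) = [ffun I => pl M I * \det v].
Proof.
apply/ffunP => I; rewrite !ffunE -det_mulmx; congr (\det _).
by apply/matrixP => a b; rewrite !mxE; apply: eq_bigr => j _; rewrite mxE.
Qed.

Lemma in_shape_UL u M : inUL Ns u -> in_shape w M -> in_shape w (u *m M).
Proof.
move=> uU sM i a ai; rewrite mxE big1 // => j _.
have [ij|ji] := leqP i j; first by rewrite sM ?mulr0 // (leq_trans ai).
rewrite uU ?ltnNge ?(ltnW ji) //; case: eqP => [e|]; last by rewrite mul0r.
by rewrite e ltnn in ji.
Qed.

Lemma in_shape_unip v M : upper_unip v -> in_shape w M -> in_shape w (M *m v).
Proof.
move=> uv sM i a ai; rewrite mxE big1 // => b _.
have [ab|ba] := ltnP a b.
  rewrite uv ?ltnNge ?(ltnW ab) //; case: eqP => [e|]; last by rewrite mulr0.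
  by rewrite e ltnn in ab.
by rewrite sM ?mul0r // (leq_ltn_trans _ ai) // Idn_le.
Qed.

Lemma UL_inv (u : 'M[C]_N) : inUL Ns u -> inUL Ns (invmx u).
Proof.
move=> uU; have [_ Lv] := Levi_inv (UL_Levi uU).
have [|iv _] := @unip_inv _ u.
  by move=> i j nij; rewrite uU // negb_and nij.
move=> i j; rewrite negb_and => /orP[/iv//|nb].
rewrite Lv; last exact/eqP.
by case: eqP => // e; rewrite e eqxx in nb.
Qed.

(* pl M0 has a dense orbit under the Borel subgroup of the Levi, phrased through
   the zero sets Z of semi-invariant polynomials, which have these closure properties. *)
Definition generates (M0 : 'M[C]_(N, d)) : Prop :=
  forall Z, line_closed Z wshape -> rowscale_closed Z predT -> colscale_closed Z ->
    UL_closed Z -> unip_closed Z -> Z M0 -> forall M, in_shape w M -> Z M.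

Lemma semiinvariant_eq0 M0 f alpha : (0 < d)%N -> generates M0 -> in_shape w M0 ->
  isReg w f -> ULfixed Ns actR f -> Tweight actR alpha f -> f (pl M0) = 0 ->
  f = @zerof d N.
Proof.
move=> d0 gen sM0 rf Uf Tf f0; apply: isReg_eq0 => // M sM.
have [F [pF [EF _]]] := rf.
suff : in_shape w M -> f (pl M) = 0 by apply.
apply: (gen (fun M => in_shape w M -> f (pl M) = 0)) => // {M sM}.
- move=> M E p p0 sE H sM; rewrite EF; last exact: in_shape_Xhat.
  apply: (polyfun_pl_generic (E := E) pF p0) => s ps.
  have sME : in_shape w (M + s *: E).
    by move=> i a ai; rewrite !mxE sM // sE ?mulr0 ?addr0 // /wshape -ltnNge.
  by rewrite -EF; [apply: H|apply: in_shape_Xhat].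
- move=> r M r0 _ H; rewrite -dg_mul => sM.
  have sM' : in_shape w M.
    by move=> i a ai; have /eqP := sM i a ai; rewrite dg_mul mxE mulf_eq0 (negPf (r0 i)) => /eqP.
  rewrite -wedge_pl; have := congr1 (fun h => h (pl M)) (Tf r r0).
  by rewrite /actR => ->; rewrite H // mulr0.
- move=> c M c0 H; rewrite -mul_dg => sM.
  have sM' : in_shape w M.
    by move=> i a ai; have /eqP := sM i a ai; rewrite mul_dg mxE mulf_eq0 (negPf (c0 a)) orbF => /eqP.
  (* Scaling columns multiplies all Pluecker coordinates by one determinant. The scalar matrix [e],
     a d-th root of it, lies in the torus of the Levi and has the same effect. *)
  have [e ed] := Croot (\det (dg c)) d0.
  have e0 : e != 0.
    apply: contraTneq (dg_unit c0); move=> e0; rewrite unitmxE unitfE -ed e0.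
    by rewrite expr0n -(prednK d0) /= eqxx.
  have -> : pl (M *m dg c) = wedge (dg (fun _ : 'I_N => e)) (pl M).
    rewrite wedge_pl; have -> : dg (fun _ : 'I_N => e) *m M = M *m e%:M.
      by rewrite dg_mul mul_mx_scalar; apply/matrixP => i a; rewrite !mxE.
    by rewrite !pl_mulr det_scalar ed.
  have := congr1 (fun h => h (pl M)) (Tf _ (fun=> e0)).
  by rewrite /actR => ->; rewrite H // mulr0.
- move=> u M uU H sM.
  have sM' : in_shape w M.
    have := in_shape_UL (UL_inv uU) sM; rewrite mulmxA mulVmx ?mul1mx //.
    by case: (UL_Levi uU).
  by rewrite -wedge_pl -[f (wedge _ _)]/(actR u f (pl M)) Uf // H.
- move=> v M uv H sM; have [uiv vunit] := unip_inv uv.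
  have sM' : in_shape w M by have := in_shape_unip uiv sM; rewrite mulmxK.
  rewrite pl_mulr upper_unip_det //.
  rewrite (_ : [ffun I => _] = pl M) ?H //.
  by apply/ffunP => I; rewrite ffunE mulr1.
Qed.

Lemma irred_eq W1 W2 f : irred_submod w Ns W1 -> irred_submod w Ns W2 ->
  W1 f -> W2 f -> f <> @zerof d N -> forall h, W1 h <-> W2 h.
Proof.
move=> [s1 _ m1] [s2 _ m2] W1f W2f nf.
have sI : submod w Ns (fun h => W1 h /\ W2 h).
  case: s1 s2 => [R1 Z1 D1 S1 L1] [R2 Z2 D2 S2 L2]; split.
  - by move=> h [/R1].
  - by [].
  - by move=> h k [h1 h2] [k1 k2]; split; [apply: D1|apply: D2].
  - by move=> c h [h1 h2]; split; [apply: S1|apply: S2].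
  - by move=> g h Lg [h1 h2]; split; [apply: L1|apply: L2].
case: (m1 _ sI) => [h []//|/(_ f (conj W1f W2f))//|H1].
case: (m2 _ sI) => [h []//|/(_ f (conj W1f W2f))//|H2].
by move=> h; split=> [/H1[]|/H2[]].
Qed.

Theorem mult_free_of_generates M0 : (0 < d)%N -> in_shape w M0 -> generates M0 ->
  mult_free w Ns.
Proof.
move=> d0 sM0 gen W1 W2 i1 i2 [phi [phiW phiD phiZ phiL [phiI _]]].
case: (i1) => s1 nz1 _; case: (i2) => s2 nz2 _.
have [f1 [W1f nf1 Uf1 [al Tf1]]] := submod_highest_weight s1 nz1.
case: (s1) => R1 Z1 D1 S1 L1; case: (s2) => R2 Z2 D2 S2 L2.
pose f2 := phi f1; have W2f : W2 f2 by apply: phiW.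
have phiR g f : inLevi Ns g -> W1 f -> phi (actR g f) = actR g (phi f).
  move=> Lg Wf; have := phiL _ f (Levi_inv Lg) Wf.
  by rewrite -actR_actf invmxK.
have Uf2 : ULfixed Ns actR f2.
  by move=> u uU; rewrite -phiR ?Uf1 //; apply: UL_Levi.
have Tf2 : Tweight actR al f2.
  by move=> r r0; rewrite -phiR ?Tf1 ?phiZ //; apply: dg_Levi.
pose c1 := f1 (pl M0); pose c2 := f2 (pl M0).
have c1n0 : c1 <> 0.
  by move=> c10; apply: nf1; apply: (semiinvariant_eq0 d0 gen sM0 (R1 _ W1f) Uf1 Tf1 c10).
pose f := fun x => c1 * f2 x + (- c2) * f1 x.
have rf : isReg w f.
  have [F1 [p1 [E1 z1]]] := R1 _ W1f; have [F2 [p2 [E2 z2]]] := R2 _ W2f.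
  exists (fun x => c1 * F2 x + (- c2) * F1 x); split.
    by apply: pf_add; apply: pf_mul => //; exact: pf_const.
  split=> x Xx; first by rewrite /f E1 ?E2.
  by rewrite /f z1 ?z2 // !mulr0 addr0.
have Uf : ULfixed Ns actR f.
  move=> u uU; apply: funext => x; rewrite /actR /f.
  by rewrite -[f2 (wedge _ _)]/(actR u f2 x) -[f1 (wedge _ _)]/(actR u f1 x) Uf1 // Uf2.
have Tf : Tweight actR al f.
  move=> r r0; apply: funext => x; rewrite /actR /f.
  rewrite -[f2 (wedge _ _)]/(actR (dg r) f2 x) -[f1 (wedge _ _)]/(actR (dg r) f1 x).
  by rewrite Tf1 // Tf2 //; ring.
have f0 : f (pl M0) = 0 by rewrite /f -/c1 -/c2 mulNr mulrC subrr.
have fz := semiinvariant_eq0 d0 gen sM0 rf Uf Tf f0.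
have f2E : f2 = fun x => (c2 / c1) * f1 x.
  apply: funext => x; have := congr1 (fun h => h x) fz; rewrite /f /zerof mulNr.
  move/eqP; rewrite subr_eq0 => /eqP e; apply: (mulfI (introN eqP c1n0)).
  by rewrite e mulrA [c1 * _]mulrC divfK //; apply/eqP.
apply: (irred_eq i1 i2 (f := f2)) => //; first by rewrite f2E; apply: S1.
move=> f20; apply: nf1; apply: phiI => //.
have e0 : (fun x : pt d N => 0 * f1 x) = @zerof d N by apply: funext => x; rewrite mul0r.
rewrite -/f2 f20 -e0 phiZ //.
by apply: funext => x; rewrite mul0r mul0r.
Qed.

End SubmoduleFacts.

(** * Stable index sequences *)

(** Blocks are numbered from 0: block [k] consists of the indices from [bst Ns k] up to, but
    excluding, [bst Ns k.+1]. *)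
Definition bst (Ns : seq nat) (k : nat) : nat := sumn (take k Ns).

Lemma bstS Ns k : bst Ns k.+1 = (bst Ns k + nth 0 Ns k)%N.
Proof.
rewrite /bst; have [kN|Nk] := ltnP k (size Ns).
  by rewrite (take_nth 0%N kN) sumn_rcons.
by rewrite nth_default // addn0 !take_oversize // (leq_trans Nk).
Qed.

Lemma bst_mono Ns : {homo bst Ns : j k / (j <= k)%N}.
Proof.
apply: homo_leq => //; first exact: leq_trans.
by move=> k; rewrite bstS leq_addr.
Qed.

Lemma bst_size Ns k : (size Ns <= k)%N -> bst Ns k = sumn Ns.
Proof. by move=> h; rewrite /bst take_oversize. Qed.

Lemma blkE Ns i k : (k < size Ns)%N -> (bst Ns k <= i < bst Ns k.+1)%N -> blk Ns i = k.
Proof.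
move=> kN /andP[ki ik]; rewrite /blk.
rewrite (eq_count (a2 := fun j => (j <= k)%N)); last first.
  move=> j /=; apply/idP/idP => [ji|jk]; last exact: leq_trans (bst_mono Ns jk) ki.
  by rewrite leqNgt; apply/negP => /(bst_mono Ns) kj; have := leq_trans kj ji; rewrite leqNgt ik.
have -> : (size Ns).-1 = (k + ((size Ns).-1 - k))%N by lia.
rewrite iotaD count_cat; rewrite [X in (X + _)%N](_ : _ = k); last first.
  rewrite (eq_in_count (a2 := predT)) ?count_predT ?size_iota // => j.
  by rewrite mem_iota add1n ltnS => /andP[].
rewrite [X in (_ + X)%N](_ : _ = 0%N) ?addn0 //; apply/eqP.
rewrite -leqn0 leqNgt -has_count; apply/hasPn => j; rewrite mem_iota => /andP[kj _].
by rewrite -ltnNge -add1n.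
Qed.

Lemma blk_exists Ns i : (i < sumn Ns)%N ->
  exists k, [/\ (k < size Ns)%N, (bst Ns k <= i)%N & (i < bst Ns k.+1)%N].
Proof.
rewrite -(bst_size (leqnn (size Ns))); elim: (size Ns) => [|m IH]; first by rewrite /bst take0.
have [/IH [k [km ki ik]] _|mi im] := ltnP i (bst Ns m).
  by exists k; split=> //; rewrite ltnW.
by exists m.
Qed.

Lemma blkP Ns i : (i < sumn Ns)%N ->
  [/\ (blk Ns i < size Ns)%N, (bst Ns (blk Ns i) <= i)%N & (i < bst Ns (blk Ns i).+1)%N].
Proof.
by move=> /blk_exists [k [kN ki ik]]; rewrite (blkE kN) ?ki.
Qed.

Lemma blk_mono Ns i j : (i <= j)%N -> (blk Ns i <= blk Ns j)%N.
Proof. by move=> ij; apply: sub_count => k /= /leq_trans; apply. Qed.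

Lemma card_interval N a b : (b <= N)%N -> #|[set j : 'I_N | (a <= j < b)%N]| = (b - a)%N.
Proof.
move=> bN; rewrite -sum1dep_card -[RHS]muln1 -sum_nat_const_nat.
rewrite (big_nat_widen _ _ N) // big_geq_mkord.
by apply: eq_bigl => j /=; rewrite andbC.
Qed.

Section Top.
Variables (d N : nat) (w : Idn d N) (Ns : seq nat).
Hypothesis lev : levi_ok N Ns.
Hypothesis st : stable w Ns.

(** Suppose [j] is missing and let [w'] be [w] with [i] raised to [j]. The coordinate [w'] vanishes
    on the Borel orbit of [ew w], but the elementary matrix adding row [i] to row [j] lies in the
    Levi and moves [ew w] to a point where it equals 1. *)
Lemma stable_succ (i j : 'I_N) : i \in img w -> j = i.+1 :> nat ->
  blk Ns i = blk Ns j -> j \in img w.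
Proof.
case/imsetP => a _ -> jE bij; apply/negPn/negP => njw.
have njE b : val w b != j by apply: contraNneq njw => <-; exact: mem_img.
pose f (b : 'I_d) := if b == a then j else val w b.
have fI (b c : 'I_d) : (b < c)%N -> (f b < f c)%N.
  rewrite /f => bc; case: eqP => [ba|_]; case: eqP => [ca|_].
  - by rewrite ba ca ltnn in bc.
  - rewrite ba in bc; have := Idn_incr w bc; rewrite jE => h.
    by rewrite ltn_neqAle h andbT -jE eq_sym; apply: njE.
  - by rewrite ca in bc; rewrite jE ltnS ltnW // Idn_incr.
  - exact: Idn_incr.
pose w' := mkIdn fI.
have w'E b : val w' b = f b by rewrite mkIdnE.
pose g : 'M[C]_N := \matrix_(k, l) ((k == l)%:R + ((k == j) && (l == val w a))%:R).
have Lg : inLevi Ns g.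
  split.
    rewrite unitmxE unitfE -det_tr det_uptri.
      apply/prodf_neq0 => k _; rewrite !mxE eqxx.
      have [->|_] := eqVneq k j; last by rewrite addr0 oner_neq0.
      by rewrite [j == _]eq_sym (negPf (njE a)) addr0 oner_neq0.
    move=> k l lk; rewrite !mxE.
    rewrite (_ : (l == k) = false) ?add0r; last by apply/eqP => e; rewrite e ltnn in lk.
    case: eqP => [lj|//]; case: eqP => [kw|//].
    by rewrite lj kw jE ltnNge leqnSn in lk.
  move=> k l nkl; rewrite !mxE.
  rewrite (_ : (k == l) = false) ?add0r; last by apply/eqP => e; rewrite e in nkl.
  by case: eqP => [kj|//]; case: eqP => [lw|//]; rewrite kj lw bij in nkl.
have Xe : inXhat w (ew w).
  by rewrite -pl_Ew; apply: in_shape_Xhat => i' a' h; rewrite mxE; case: eqP => // e; rewrite e ltnn in h.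
have := st Lg Xe; move=> /(_ (fun x => x w') (pf_coord w')) H.
have : wedge g (ew w) w' = 0.
  apply: H => b [_ tb]; rewrite -pl_Ew wedge_pl ffunE det_uptri.
    rewrite (bigD1 a) //= !mxE (bigD1 (val w a)) //= w'E /f eqxx tb ?mul0r ?jE //.
    rewrite big1 ?addr0 ?mul0r // => l nl; by rewrite !mxE (negPf nl) mulr0.
  move=> c e ec; rewrite !mxE big1 // => l _; rewrite mxE.
  case: eqP => [->|_]; last by rewrite mulr0.
  rewrite tb ?mul0r // w'E /f; case: eqP => [ca|_]; last exact: Idn_incr.
  by rewrite ca in ec; rewrite jE ltnS ltnW // Idn_incr.
rewrite -pl_Ew wedge_pl ffunE (_ : \matrix_(_, _) _ = 1%:M) ?det1; last first.
  apply/matrixP => c e; rewrite !mxE (bigD1 (val w e)) //= big1 ?addr0; last first.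
    by move=> l nl; rewrite !mxE (negPf nl) mulr0.
  rewrite !mxE eqxx mulr1 w'E /f (inj_eq (@Idn_inj _ _ w)).
  have [->|nca] := eqVneq c a.
    by rewrite [j == _]eq_sym (negPf (njE e)) eqxx add0r [a == e]eq_sym.
  by rewrite (inj_eq (@Idn_inj _ _ w)) (negPf (njE c)) /= addr0.
by move/eqP; rewrite oner_eq0.
Qed.

Lemma stable_top (i j : 'I_N) : i \in img w -> (i <= j)%N -> blk Ns i = blk Ns j -> j \in img w.
Proof.
move=> iw; move: {2}(val j) (erefl (val j)) => m; elim: m j => [|m IH] j jm ij bij.
  by rewrite (_ : j = i) //; apply/val_inj; move: ij => /=; rewrite jm leqn0 => /eqP ->.
move: ij; rewrite leq_eqVlt => /orP[/eqP e|ij]; first by rewrite (_ : j = i) //; apply: val_inj.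
have mN : (m < N)%N by have := ltn_ord j; rewrite -jm => /ltnW.
have im : (i <= m)%N by rewrite jm ltnS in ij.
have bim : blk Ns i = blk Ns m.
  by apply/eqP; rewrite eqn_leq blk_mono //= bij blk_mono // jm.
apply: (stable_succ (i := Ordinal mN)) => //=; last by rewrite -bim.
exact: IH.
Qed.

(** Counts with blocks numbered from 0: [hh k] is the number written h with index k+1 in the
    theorem. *)
Definition hh k := hk w Ns k.+1.

Lemma hhE k : hh k = #|[set i in img w | blk Ns i == k]|.
Proof.
rewrite /hh /hk -(card_imset _ (@Idn_inj _ _ w)); apply: eq_card => i.
rewrite !inE; apply/imsetP/andP => [[a]|[/imsetP[a _ ->] b]].
  by rewrite inE eqSS => b ->; rewrite mem_img.
by exists a; rewrite // inE eqSS.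
Qed.

Lemma sumNs_N : sumn Ns = N. Proof. by case: lev. Qed.

Lemma blk_iff (i : 'I_N) k : (k < size Ns)%N ->
  (blk Ns i == k) = (bst Ns k <= i < bst Ns k.+1)%N.
Proof.
move=> kN; apply/eqP/idP => [<-|]; last exact: blkE.
by have [] := @blkP Ns i; rewrite ?sumNs_N // => _ -> ->.
Qed.

Lemma bst_leN k : (bst Ns k <= N)%N.
Proof.
rewrite -sumNs_N; have [h|h] := leqP (size Ns) k; first by rewrite bst_size.
by rewrite -(bst_size (leqnn _)) bst_mono // ltnW.
Qed.

Lemma hh_le k : (hh k <= nth 0 Ns k)%N.
Proof.
have [kN|Nk] := ltnP k (size Ns).
  rewrite hhE; apply: leq_trans (_ : #|[set j : 'I_N | (bst Ns k <= j < bst Ns k.+1)%N]| <= _)%N.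
    by apply: subset_leq_card; apply/subsetP => i; rewrite !inE blk_iff // => /andP[].
  by rewrite card_interval ?bst_leN // bstS addKn.
rewrite hhE nth_default // leqn0 cards_eq0; apply/eqP/setP => i; rewrite !inE.
apply/negbTE/negP => /andP[_ /eqP e]; have [] := @blkP Ns i; rewrite ?sumNs_N //.
by rewrite e ltnNge Nk.
Qed.

(** The first index of block [k] belonging to [w], for stable [w]; the earlier indices of the block
    are its slack rows. *)
Definition threshold k := (bst Ns k.+1 - hh k)%N.

Lemma thr_bst k : (bst Ns k <= threshold k)%N.
Proof. by have := hh_le k; rewrite /threshold bstS; lia. Qed.

(** By [stable_top] the part of [w] in a block is a final segment, and counting determines where it
    begins. *)
Lemma mem_imgE (i : 'I_N) : (i \in img w) = (threshold (blk Ns i) <= i)%N.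
Proof.
have [kN ki ik] : [/\ (blk Ns i < size Ns)%N, (bst Ns (blk Ns i) <= i)%N & (i < bst Ns (blk Ns i).+1)%N].
  by apply: blkP; rewrite sumNs_N.
set k := blk Ns i in kN ki ik *; rewrite /threshold leq_subLR.
apply/idP/idP => [iw|].
  suff : (bst Ns k.+1 - i <= hh k)%N by lia.
  rewrite -(@card_interval N i) ?bst_leN // hhE; apply: subset_leq_card.
  apply/subsetP => j; rewrite !inE => /andP[ij jk].
  have bj : blk Ns j == k by rewrite blk_iff // jk (leq_trans ki ij).
  by rewrite bj andbT (stable_top iw ij) // (eqP bj).
apply: contraLR => niw; rewrite -ltnNge.
suff : (hh k <= bst Ns k.+1 - i.+1)%N by lia.
rewrite -(@card_interval N i.+1) ?bst_leN // hhE; apply: subset_leq_card.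
apply/subsetP => j; rewrite !inE => /andP[jw bj].
have /andP[_ ->] : (bst Ns k <= j < bst Ns k.+1)%N by rewrite -blk_iff.
rewrite andbT ltnNge; apply: contra niw => ji; apply: (stable_top jw ji).
by rewrite (eqP bj).
Qed.

Lemma sum_hh : (\sum_(0 <= k < size Ns) hh k = d)%N.
Proof.
rewrite -[RHS](card_img w) -sum1_card.
rewrite (partition_big (fun i : 'I_N => inord (blk Ns i) : 'I_(size Ns).-1.+1) predT) //=.
have [bN|b0] := posnP (size Ns).
  rewrite bN big_geq //; symmetry; apply: big1 => k _; rewrite big_pred0 // => i.
  by have [] := @blkP Ns i; rewrite ?sumNs_N // bN.
rewrite -(prednK b0) big_mkord; apply: eq_bigr => k _.
rewrite hhE -sum1dep_card; apply: eq_bigl => i.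
rewrite -val_eqE /= inordK //.
by have [] := @blkP Ns i; rewrite ?sumNs_N // (prednK b0).
Qed.

End Top.

(** * Dense orbits *)

Section Reduction.
Variables (d N : nat) (w : Idn d N) (Ns : seq nat).
Hypothesis lev : levi_ok N Ns.
Hypothesis stw : stable w Ns.

Notation B := (blk Ns).
Notation Bc a := (blk Ns (val w a)).
Notation inw i := (i \in img w).
Notation thr := (threshold w Ns).

Lemma slack_rowP i : ~~ inw i -> (bst Ns (B i) <= i < thr (B i))%N.
Proof.
rewrite (mem_imgE lev stw) -ltnNge => ->; rewrite andbT.
by have [] := @blkP Ns i; rewrite ?(sumNs_N lev).
Qed.

Lemma img_colP a : (thr (Bc a) <= val w a < bst Ns (Bc a).+1)%N.
Proof.
rewrite -(mem_imgE lev stw) mem_img /=.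
by have [] := @blkP Ns (val w a); rewrite ?(sumNs_N lev).
Qed.

Definition block_edge (i : 'I_N) (a : 'I_d) : bool := ~~ inw i && (B i < Bc a)%N.

Definition edge_mask (Y : 'M[C]_(N, d)) : 'M[C]_(N, d) :=
  \matrix_(i, a) if block_edge i a then Y i a else 0.

(** [rowop k i] permits adding a multiple of row [i] to row [k], and [colop b a] adding a multiple
    of column [a] to column [b]. *)
Definition rowop (k i : 'I_N) : bool := [&& (k < i)%N, B k == B i, ~~ inw i & ~~ inw k].
Definition colop (b a : 'I_d) : bool := (a < b)%N && (Bc b == Bc a).

(** The closure properties left on the slice [Ew w + Y]: Borel operations inside each slack row
    block and each column block, both tori, and perturbation of [Y] in any direction. *)
Definition admissible (Z : 'M[C]_(N, d) -> Prop) : Prop :=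
  [/\ line_closed Z (fun _ _ => true), row_closed Z rowop, col_closed Z colop,
      rowscale_closed Z (fun i => ~~ inw i) & colscale_closed Z].

Section Slice.
Variable Z : 'M[C]_(N, d) -> Prop.
Hypotheses (Zl : line_closed Z (wshape w)) (Zr : rowscale_closed Z predT)
  (Zc : colscale_closed Z) (ZU : UL_closed Ns Z) (ZV : unip_closed Z).

Lemma UL_row_closed : row_closed Z (fun k i => (k < i)%N && (B k == B i)).
Proof.
move=> i c M Hc ZM; rewrite rowop_mulmx.
apply: ZU ZM => k l nkl; rewrite mxE; case: (eqVneq l i) => [li|]; last by rewrite mulr0 addr0.
have -> : c k = 0 by apply: contraNeq nkl => /Hc; rewrite li.
by rewrite mul0r addr0.
Qed.

Lemma unip_col_closed : col_closed Z (fun b a => (a < b)%N).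
Proof.
move=> a c M Hc ZM; rewrite colop_mulmx.
apply: ZV ZM => k l nkl; rewrite mxE; case: (eqVneq k a) => [ka|]; last by rewrite mul0r addr0.
have -> : c l = 0 by apply: contraNeq nkl => /Hc; rewrite ka.
by rewrite mulr0 addr0.
Qed.

Definition slice (Y : 'M[C]_(N, d)) : Prop := Z (Ew w + edge_mask Y).

Lemma Ew0 (i : 'I_N) a : ~~ inw i -> Ew w i a = 0.
Proof. by move=> ni; rewrite mxE; case: eqP => // e; rewrite e mem_img in ni. Qed.

Lemma Ewd a b : Ew w (val w a) b = (a == b)%:R.
Proof. by rewrite mxE (inj_eq (@Idn_inj _ _ w)). Qed.

Lemma slice_admissible : admissible slice.
Proof.
split.
- move=> M E p p0 _ H; apply: (Zl (E := edge_mask E) p0).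
    move=> i a; rewrite mxE /block_edge /wshape -ltnNge => h; case: ifP => // /andP[_ lt].
    by have := @blk_mono Ns _ _ (ltnW h); rewrite leqNgt lt.
  move=> s /H; rewrite /slice; congr Z; apply/matrixP => i a; rewrite !mxE.
  by case: ifP => _; rewrite ?mulr0 ?addr0 ?addrA.
- move=> i c M Hc ZM.
  have H0 k : c k != 0 -> (k < i)%N && (B k == B i) by case/Hc/and4P=> -> ->.
  have := UL_row_closed H0 ZM; rewrite /slice; congr Z; apply/matrixP => k b; rewrite !mxE.
  have [ck|/Hc/and4P[_ /eqP ek ni nk]] := eqVneq (c k) 0.
    by rewrite ck !mul0r !addr0.
  have := Ew0 b ni; rewrite mxE => ->; rewrite add0r /block_edge ni nk /= ek.
  by case: ifP => _; rewrite ?mulr0 ?addr0 ?addrA.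
- move=> a c M Hc ZM.
  have H0 b : c b != 0 -> (a < b)%N by case/Hc/andP.
  have Z1 := unip_col_closed H0 ZM.
  (* the column operation disturbs Ew only in row w a, which a row operation repairs *)
  pose u : 'M[C]_N := \matrix_(k, l) ((k == l)%:R -
     (k == val w a)%:R * \sum_b (l == val w b)%:R * c b).
  have uU : inUL Ns u.
    move=> k l nkl; rewrite mxE; case: (eqVneq k (val w a)) => [kw|]; last by rewrite mul0r subr0.
    rewrite big1 ?mulr0 ?subr0 // => b _; case: eqP => [lw|]; last by rewrite mul0r.
    rewrite mul1r; apply: contraNeq nkl => /Hc/andP[ab /eqP e].
    by rewrite kw lw Idn_incr //= e.
  have := ZU uU Z1; rewrite /slice; congr Z; apply/matrixP => k b.
  rewrite mxE (bigD1 k) //= [u k k]mxE eqxx.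
  have nwk : (k == val w a)%:R * (\sum_b0 (k == val w b0)%:R * c b0) = 0.
    have [ka|] := eqVneq k (val w a); last by rewrite mul0r.
    rewrite big1 ?mulr0 // => b' _; rewrite ka (inj_eq (@Idn_inj _ _ w)).
    have [<-|] := eqVneq a b'; last by rewrite mul0r.
    by rewrite mul1r; apply/eqP/negPn/negP => /H0; rewrite ltnn.
  rewrite nwk subr0 mul1r.
  have [iwk|nk] := boolP (inw k); last first.
    rewrite big1 ?addr0; last first.
      move=> l nl; rewrite [u k l]mxE eq_sym (negPf nl) sub0r.
      have -> : (k == val w a) = false by apply/eqP => e; rewrite e mem_img in nk.
      by rewrite mul0r oppr0 mul0r.
    rewrite [LHS]mxE [in RHS]mxE ![(Ew w + edge_mask _) _ _]mxE !Ew0 // !add0r !mxE /block_edge nk /=.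
    case: ifP => h1; case: ifP => h2; rewrite ?mul0r ?addr0 ?add0r //.
    - have [->|/Hc/andP[_ /eqP e]] := eqVneq (c b) 0; first by rewrite mulr0 addr0.
      by rewrite e h2 in h1.
    - have [->|/Hc/andP[_ /eqP e]] := eqVneq (c b) 0; first by rewrite mulr0.
      by rewrite e h2 in h1.
  have maskw (Y : 'M[C]_(N, d)) l e : inw l -> edge_mask Y l e = 0 by move=> lw; rewrite mxE /block_edge lw.
  have MM l e : inw l -> (\matrix_(k, b) ((Ew w + edge_mask M) k b + (Ew w + edge_mask M) k a * c b)) l e
     = Ew w l e + Ew w l a * c e.
    by move=> lw; rewrite mxE ![(Ew w + edge_mask M) _ _]mxE !maskw // !addr0.
  rewrite MM // [RHS]mxE maskw // addr0.
  have [kw|nkw] := eqVneq k (val w a); last first.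
    rewrite big1 ?addr0.
      case/imsetP: iwk nkw => a' _ ->; rewrite (inj_eq (@Idn_inj _ _ w)) => na.
      by rewrite !Ewd (negPf na) mul0r addr0.
    move=> l nl; rewrite [u k l]mxE eq_sym (negPf nl) sub0r (negPf nkw).
    by rewrite mul0r oppr0 mul0r.
  rewrite kw Ewd Ewd eqxx mul1r.
  have [cb|cb] := eqVneq (c b) 0.
    rewrite big1 ?cb ?addr0 // => l nl.
    rewrite [u _ l]mxE [_ == l]eq_sym (negPf nl) sub0r eqxx mul1r.
    have [/imsetP[b' _ lb]|nlw] := boolP (inw l); last first.
      rewrite big1 ?oppr0 ?mul0r // => b' _.
      by case: eqP => [e|]; rewrite ?mul0r //; rewrite e mem_img in nlw.
    rewrite MM ?lb ?mem_img // !Ewd.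
    have na : b' != a by apply: contraNneq nl => e; rewrite lb e.
    rewrite (negPf na) mul0r addr0.
    rewrite (bigD1 b') //= eqxx mul1r big1 ?addr0; last first.
      by move=> b'' nb; rewrite (inj_eq (@Idn_inj _ _ w)) eq_sym (negPf nb) mul0r.
    by have [->|] := eqVneq b' b; rewrite ?cb ?oppr0 ?mul0r ?mulr0.
  rewrite (bigD1 (val w b)) /=; last first.
    by rewrite (inj_eq (@Idn_inj _ _ w)); apply: contraTneq (H0 _ cb) => ->; rewrite ltnn.
  have nab : a != b by apply: contraTneq (H0 _ cb) => ->; rewrite ltnn.
  rewrite MM ?mem_img // !Ewd eqxx [b == a]eq_sym (negPf nab) mul0r addr0 mulr1.
  rewrite [u _ _]mxE (inj_eq (@Idn_inj _ _ w)) (negPf nab) sub0r eqxx mul1r.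
  rewrite (bigD1 b) //= eqxx mul1r big1 ?addr0; last first.
    by move=> b'' nb; rewrite (inj_eq (@Idn_inj _ _ w)) eq_sym (negPf nb) mul0r.
  rewrite big1 ?addr0 ?add0r ?subrr // => l /andP[nl nlb].
  have [/imsetP[b' _ lb]|nlw] := boolP (inw l).
    rewrite MM ?lb ?mem_img // !Ewd.
    have na : b' != a by apply: contraNneq nl => e; rewrite lb e.
    have nb : b' != b by apply: contraNneq nlb => e; rewrite lb e.
    by rewrite (negPf na) (negPf nb) mul0r addr0 mulr0.
  rewrite [u _ l]mxE [_ == l]eq_sym (negPf nl) sub0r eqxx mul1r.
  rewrite big1 ?oppr0 ?mul0r // => b' _.
  by case: eqP => [e|]; rewrite ?mul0r //; rewrite e mem_img in nlw.
- move=> r M r0 r1 ZM; have := @Zr r _ r0 (fun i h => False_ind _ (elimN idP h isT)) ZM.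
  rewrite /slice; congr Z; apply/matrixP => k b; rewrite !mxE.
  case: ifP => h; first by rewrite mulrDr; congr (_ + _);
    case: eqP => [e|]; rewrite ?mulr0 //; move: h; rewrite /block_edge e mem_img.
  rewrite !addr0; case: eqP => [e|]; last by rewrite mulr0.
  by rewrite r1 ?mul1r // e mem_img.
- move=> c M c0 ZM; have Z1 := Zc c0 ZM.
  (* Scaling columns also scales the pivots in [Ew w]; the inverse factors on the rows of [w]
     restore them, while [Y] lives on the other rows. *)
  pose r (k : 'I_N) := if [pick a | val w a == k] is Some a then (c a)^-1 else 1.
  have rw a : r (val w a) = (c a)^-1.
    by rewrite /r; case: pickP => [b /eqP/Idn_inj ->|/(_ a)] //; rewrite eqxx.
  have r0 k : r k != 0.
    by rewrite /r; case: pickP => [b _|_]; rewrite ?invr_eq0 ?c0 ?oner_neq0.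
  have := Zr r0 (fun i h => False_ind _ (elimN idP h isT)) Z1.
  rewrite /slice; congr Z; apply/matrixP => k b.
  rewrite mxE [X in r k * X]mxE [(Ew w + edge_mask M) k b]mxE [RHS]mxE.
  have [/imsetP[a _ ->]|nk] := boolP (inw k).
    rewrite [edge_mask M _ _]mxE [edge_mask _ (val w a) b]mxE /block_edge mem_img /= !addr0 rw Ewd.
    by have [->|] := eqVneq a b; rewrite ?mul1r ?mulVf ?mul0r ?mulr0.
  rewrite !Ew0 // !add0r !mxE (_ : r k = 1) ?mul1r.
    by case: ifP => _; rewrite ?mul0r.
  by rewrite /r; case: pickP => [b' /eqP e|//]; rewrite -e mem_img in nk.
Qed.

End Slice.
End Reduction.

(** * Elimination on the slice down to forest patterns *)

Section Patterns.
Variables (d N : nat) (w : Idn d N) (Ns : seq nat).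
Hypothesis lev : levi_ok N Ns.
Hypothesis stw : stable w Ns.

Notation B := (blk Ns).
Notation Bc a := (blk Ns (val w a)).
Notation inw i := (i \in img w).
Notation thr := (threshold w Ns).
Notation edge := (block_edge w Ns).
Notation admissible := (admissible w Ns).

(** Column operations empty the pivot rows, then row operations inside the Levi empty each pivot
    column within its own block. What survives is the pivots and the entries of [block_edge], and
    rescaling rows normalises the pivots. *)
Lemma covers_wshape Z : line_closed Z (wshape w) -> rowscale_closed Z predT ->
  UL_closed Ns Z -> unip_closed Z -> (forall Y, slice w Ns Z Y) -> covers Z (wshape w).
Proof.
move=> Zl Zr ZU ZV ZY.
have Zro := UL_row_closed ZU; have Zco := unip_col_closed ZV.
(* First round: in each row [w c] with [c < r] only the pivot is left. *)
pose P r (i : 'I_N) (a : 'I_d) :=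
  wshape w i a && [forall c : 'I_d, (c < r)%N && (i == val w c) ==> (c == a)].
(* Second round: each column [a < r] is also empty in its own block apart from the pivot. Pivot rows
   contain nothing else by now, so these row operations cause no fill-in. *)
pose Q r i a := P d i a && ((a < r)%N && (i != val w a) ==> (B i != Bc a)).
have step1 r : (r < d)%N -> covers Z (P r.+1) -> covers Z (P r).
  move=> rd; pose a := Ordinal rd.
  apply: (covers_clear_row (i := val w a) (a := a) (A := fun b => (a < b)%N) Zco Zl) => //.
  - by move=> b /=; rewrite ltnn.
  - by rewrite /wshape.
  - rewrite /P /wshape leqnn; apply/forallP => c; apply/implyP => /andP[cr].
    by rewrite (inj_eq (@Idn_inj _ _ w)) eq_sym.
  - move=> k b ab nk /andP[ka /forallP H]; rewrite /P /wshape.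
    rewrite (leq_trans ka) ?Idn_le ?(ltnW ab) //=.
    apply/forallP => c; apply/implyP => /andP[]; rewrite ltnS leq_eqVlt.
    case/orP => [/eqP cr /eqP kc|cr kc].
      by case/eqP: nk; rewrite kc; congr (val w _); apply: val_inj.
    have := H c; rewrite cr kc /= => /eqP ca.
    by rewrite ca ltnn in cr.
  - move=> k b /andP[kb /forallP H] nAk; rewrite /P kb /=.
    apply/forallP => c; apply/implyP => /andP[]; rewrite ltnS leq_eqVlt.
    case/orP => [/eqP cr /eqP kc|cr kc]; last by have := H c; rewrite cr kc.
    have ca : c = a by apply: val_inj.
    move: nAk; rewrite kc ca eqxx andbT -leqNgt => ba.
    move: kb; rewrite kc /wshape Idn_le ca => ab.
    by apply/eqP/val_inj/eqP; rewrite eqn_leq ab ba.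
have step2 r : (r < d)%N -> covers Z (Q r.+1) -> covers Z (Q r).
  move=> rd; pose a := Ordinal rd.
  have Qw e c : P d (val w e) c -> e = c.
    by move=> /andP[_ /forallP /(_ e)]; rewrite ltn_ord eqxx => /eqP.
  apply: (covers_clear_col (i := val w a) (a := a)
    (A := fun k => (k < val w a)%N && (B k == Bc a)) Zro Zl) => //.
  - by move=> b /=; rewrite ltnn.
  - by rewrite /wshape.
  - rewrite /Q eqxx andbF /= andbT /P /wshape leqnn.
    by apply/forallP => c; apply/implyP => /andP[_]; rewrite (inj_eq (@Idn_inj _ _ w)) eq_sym.
  - by move=> k b _ nb /andP[/Qw e _]; rewrite e eqxx in nb.
  - move=> k b /andP[kb H] nA; rewrite /Q kb /=; apply/implyP => /andP[].
    rewrite ltnS leq_eqVlt => /orP[/eqP br|br] nk; last by rewrite br nk in H.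
    have ba : b = a by apply: val_inj.
    have kw : (k < val w b)%N.
      have kb' : (k <= val w b)%N by case/andP: kb.
      rewrite ltn_neqAle kb' andbT.
      by apply: contra nk => /eqP/val_inj->.
    by move: nA; rewrite ba eqxx andbT -ba kw.
apply: (@covers_sub _ _ _ _ (P 0%N)).
  by move=> i a ia; rewrite /P ia; apply/forallP => c.
suff H : covers Z (P d).
  have : forall m, (m <= d)%N -> covers Z (P (d - m)%N).
    elim=> [|m IH] md; first by rewrite subn0.
    apply: step1; first by lia.
    by rewrite -subSn // subSS; apply: IH; exact: ltnW.
  by move=> /(_ d (leqnn d)); rewrite subnn.
apply: (@covers_sub _ _ _ _ (Q 0%N)).
  by move=> i a ia; rewrite /Q ia.
suff H : covers Z (Q d).
  have : forall m, (m <= d)%N -> covers Z (Q (d - m)%N).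
    elim=> [|m IH] md; first by rewrite subn0.
    apply: step2; first by lia.
    by rewrite -subSn // subSS; apply: IH; exact: ltnW.
  by move=> /(_ d (leqnn d)); rewrite subnn.
move=> M sM.
have nedge i a : ~~ edge i a -> i != val w a -> M i a = 0.
  move=> nf ne; apply: sM; apply: contra nf => /andP[/andP[ia /forallP H]].
  rewrite ltn_ord ne /= => nB; rewrite /block_edge; apply/andP; split.
    apply/negP => /imsetP[c _ ic]; have := H c; rewrite ltn_ord ic eqxx /= => /eqP ca.
    by rewrite ic ca eqxx in ne.
  by rewrite ltn_neqAle nB blk_mono.
apply: (Zl M (Ew w) (\prod_(a : 'I_d) ('X + (M (val w a) a)%:P))).
- exact: prod_XaddC_neq0.
- move=> i a nS; rewrite mxE; case: eqP => // e; by rewrite e /wshape leqnn in nS.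
move=> s; rewrite horner_prod => /prodf_neq0 nz; set M' := M + _.
(* The factors are the nonzero pivots of [M']: they turn the normalised pivots back into those of
   [M'] and leave the rows outside [w] alone. *)
pose r (k : 'I_N) := if [pick a | val w a == k] is Some a then M' k a else 1.
have r0 k : r k != 0.
  rewrite /r; case: pickP => [a /eqP e|_]; last exact: oner_neq0.
  rewrite !mxE -e eqxx mulr1 addrC; have := nz a isT; by rewrite !hornerE.
have := Zr r _ r0 (fun i h => False_ind _ (elimN idP h isT)) (ZY M').
congr Z; apply/matrixP => k b.
rewrite mxE [(Ew w + _) _ _]mxE [edge_mask _ _ _ _ _]mxE [RHS]mxE.
have [/imsetP[a _ ->]|nk] := boolP (inw k).
  rewrite /block_edge mem_img /= addr0 Ewd.
  rewrite (_ : r (val w a) = M' (val w a) a); last first.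
    by rewrite /r; case: pickP => [c /eqP/Idn_inj ->|/(_ a)] //; rewrite eqxx.
  rewrite [M' _ _]mxE [(s *: Ew w) _ _]mxE [(s *: Ew w) _ _]mxE !Ewd eqxx mulr1.
  have [->|nab] := eqVneq a b; first by rewrite ?eqxx !mulr1.
  rewrite !mulr0 addr0 nedge ?(inj_eq (@Idn_inj _ _ w)) //.
  by rewrite /block_edge mem_img.
rewrite (_ : r k = 1) ?mul1r; last first.
  by rewrite /r; case: pickP => [c /eqP e|//]; rewrite -e mem_img in nk.
rewrite Ew0 // add0r [M' _ _]mxE [(s *: Ew w) _ _]mxE Ew0 // mulr0 addr0.
case: ifPn => // nf; rewrite nedge //.
by apply: contraNneq nk => ->; rewrite mem_img.
Qed.

(** Says that [indic Pf] is a base point of a dense orbit on the matrices [Y]. *)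
Definition reduces_to (Pf : 'I_N -> 'I_d -> bool) : Prop :=
  forall Z, admissible Z -> Z (indic Pf) -> covers Z edge.

Lemma reduces_generates Pf : reduces_to Pf ->
  generates w Ns (Ew w + edge_mask w Ns (indic Pf)) /\
  in_shape w (Ew w + edge_mask w Ns (indic Pf)).
Proof.
move=> red; split.
  move=> Z Zl Zr Zc ZU ZV Z0 M sM.
  have ad := slice_admissible Zl Zr Zc ZU ZV.
  have cov := red _ ad Z0.
  have : covers Z (wshape w).
    apply: covers_wshape => // Y.
    have : slice w Ns Z (edge_mask w Ns Y).
      by apply: cov => i a nf; rewrite mxE (negPf nf).
    rewrite /slice; congr (Z (_ + _)); apply/matrixP => i a; rewrite !mxE.
    by case: (block_edge w Ns i a).
  by apply => i a nS; apply: sM; rewrite ltnNge.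
move=> i a ai; rewrite !mxE.
case: eqP => [e|_]; first by rewrite e ltnn in ai.
rewrite add0r; case: ifP => // /andP[_]; by rewrite ltnNge blk_mono // ltnW.
Qed.

(** [rho] counts slack rows from the last one upwards and [kap] counts columns from the first one
    onwards, so that permitted operations add a line to lines with a larger value. The natural
    pivots are the entries with [rho i = kap a]. *)
Definition rho (i : 'I_N) : nat := (thr (B i) - 1 - i)%N.
Definition kap (a : 'I_d) : nat := (val w a - thr (Bc a))%N.

Lemma rho_inj i j : ~~ inw i -> ~~ inw j -> B i = B j -> rho i = rho j -> i = j.
Proof.
move=> ni nj eB e; apply: val_inj => /=.
have := slack_rowP lev stw ni; have := slack_rowP lev stw nj; move: e; rewrite /rho eB; lia.
Qed.

Lemma rho_lt i j : ~~ inw i -> ~~ inw j -> B i = B j -> (rho i < rho j)%N -> (j < i)%N.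
Proof.
move=> ni nj eB e.
have := slack_rowP lev stw ni; have := slack_rowP lev stw nj; move: e; rewrite /rho eB; lia.
Qed.

Lemma kap_inj a b : Bc a = Bc b -> kap a = kap b -> a = b.
Proof.
move=> eB e; apply: (@Idn_inj _ _ w); apply: ord_inj.
have := img_colP lev stw a; have := img_colP lev stw b; move: e; rewrite /kap eB; lia.
Qed.

Lemma kap_lt a b : Bc a = Bc b -> (kap a < kap b)%N -> (a < b)%N.
Proof.
move=> eB e; rewrite ltnNge -(Idn_le w) -ltnNge.
have := img_colP lev stw a; have := img_colP lev stw b; move: e; rewrite /kap eB; lia.
Qed.

Lemma rho_onto k r : ~~ inw k -> (r < rho k)%N ->
  exists i, [/\ ~~ inw i, B i = B k & rho i = r].
Proof.
move=> nk; have [kN kb ke] : [/\ (B k < size Ns)%N, (bst Ns (B k) <= k)%N & (k < bst Ns (B k).+1)%N].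
  by apply: blkP; rewrite (sumNs_N lev).
have := slack_rowP lev stw nk; rewrite /rho => h1 h2.
have tb : (thr (B k) <= bst Ns (B k).+1)%N by rewrite /threshold leq_subr.
have iN : (thr (B k) - 1 - r < N)%N by have := bst_leN lev (B k).+1; lia.
have eB : B (thr (B k) - 1 - r)%N = B k by apply: blkE => //; apply/andP; split; lia.
exists (Ordinal iN); split=> //=; last by rewrite eB; lia.
by rewrite (mem_imgE lev stw) /= eB; lia.
Qed.

Lemma kap_onto b r : (r < kap b)%N -> exists a, Bc a = Bc b /\ kap a = r.
Proof.
have [bN _ _] : [/\ (Bc b < size Ns)%N, (bst Ns (Bc b) <= val w b)%N & (val w b < bst Ns (Bc b).+1)%N].
  by apply: blkP; rewrite (sumNs_N lev).
have := img_colP lev stw b; rewrite /kap => h1 h2.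
have tb := thr_bst w lev (Bc b).
have iN : (thr (Bc b) + r < N)%N by have := ltn_ord (val w b); lia.
have eB : B (thr (Bc b) + r)%N = Bc b by apply: blkE => //; apply/andP; split; lia.
have : inw (Ordinal iN) by rewrite (mem_imgE lev stw) /= eB leq_addr.
case/imsetP => a _ ea; exists a; rewrite -ea /=; split=> //.
by rewrite eB addKn.
Qed.

Section Clear.
Variable Z : 'M[C]_(N, d) -> Prop.
Hypothesis adm : admissible Z.
Variables k0 l0 : nat.
Implicit Type P : 'I_N -> 'I_d -> bool.
Definition inblk (i : 'I_N) (a : 'I_d) : bool := (B i == k0) && (Bc a == l0).

(** The pivot with [rho = kap = r] clears its row to the right, for r = 0, 1, .... Rows treated
    before have a zero in the pivot column and are not disturbed; the second hypothesis keeps the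
    remaining fill-in inside [P]. *)
Lemma clear_right P :
  (forall (i : 'I_N) (a : 'I_d), P i a -> ~~ inw i) ->
  (forall (i : 'I_N) (b b' : 'I_d), Bc b = l0 -> Bc b' = l0 -> (kap b < kap b')%N -> P i b ->
     (B i = k0 -> (kap b < rho i)%N) -> P i b') ->
  (forall (i : 'I_N) (a : 'I_d), ~~ inw i -> inblk i a -> rho i = kap a -> P i a) ->
  covers Z (fun i a => P i a && (inblk i a ==> (kap a <= rho i)%N)) -> covers Z P.
Proof.
move=> Pn Hmono Hpiv; have [Zl Zr Zc _ _] := adm.
pose Q r i a := P i a && (inblk i a && (rho i < r)%N ==> (kap a <= rho i)%N).
have step r : covers Z (Q r.+1) -> covers Z (Q r).
  have [[i [a [ni ia ri ra]]]|no] := EM (exists i a,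
      [/\ ~~ inw i, inblk i a, rho i = r & kap a = r]); last first.
    apply: covers_sub => k b /andP[Pkb H]; rewrite /Q Pkb /=.
    apply/implyP => /andP[kb]; rewrite ltnS leq_eqVlt => /orP[/eqP kr|kr]; last first.
      by rewrite kb kr in H.
    rewrite leqNgt; apply/negP => rk; apply: no.
    (* An entry with [kap] above [r] in a row with [rho = r] forces a column with [kap = r], hence a
       pivot. *)
    have [a [ea ka]] : exists a, Bc a = Bc b /\ kap a = r by apply: kap_onto; rewrite -kr.
    by exists k, a; split; rewrite ?(Pn _ _ Pkb) // /inblk ea.
  have /andP[/eqP Bi /eqP Ba] := ia.
  apply: (covers_clear_row (i := i) (a := a)
    (A := fun b => (Bc b == l0) && (kap a < kap b)%N) Zc Zl) => //.
  - by move=> b; rewrite /colop ltnn.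
  - by rewrite /Q Hpiv ?ri ?ra //= leqnn implybT.
  - by move=> b /andP[/eqP Bb ab]; rewrite /colop Ba Bb eqxx andbT; apply: kap_lt => //; rewrite Ba.
  - move=> k b /andP[/eqP Bb ab] nk /andP[Pka H].
    have big : B k = k0 -> (kap a < rho k)%N.
      move=> Bk; have : (r <= rho k)%N.
        rewrite leqNgt; apply/negP => kr; move: H; rewrite /inblk Bk Ba !eqxx kr /= ra.
        by rewrite leqNgt kr.
      rewrite leq_eqVlt ra => /orP[/eqP e|//].
      case/eqP: nk; apply: rho_inj => //; [exact: Pn Pka|by rewrite Bk|by rewrite ri].
    rewrite /Q (Hmono k a b) //=; apply/implyP => /andP[/andP[/eqP Bk _]].
    by rewrite ltnS leqNgt -ra big.
  - move=> k b /andP[Pkb H] nA; rewrite /Q Pkb /=; apply/implyP => /andP[kb].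
    rewrite ltnS leq_eqVlt => /orP[/eqP kr|kr]; last by rewrite kb kr in H.
    have /andP[/eqP Bk /eqP Bb] := kb.
    have ki : k = i by apply: rho_inj; rewrite ?Bk ?kr ?ri //; exact: Pn Pkb.
    by move: nA; rewrite Bb eqxx ki eqxx andbT /= -leqNgt ra ri.
move=> cov; have : covers Z (Q N).
  apply: covers_sub cov => i a /andP[-> H] /=; apply/implyP => ia; move: H; rewrite ia /=.
  have -> // : (rho i < N)%N.
  by have := ltn_ord i; have := bst_leN lev (B i).+1; rewrite /rho /threshold; lia.
suff H m : covers Z (Q m) -> covers Z P by exact: H.
elim: m => [|m IH] cm; last exact: IH (step _ cm).
by apply: covers_sub cm => i a Pia; rewrite /Q Pia ltn0 andbF.
Qed.

(** Mirror image of [clear_right]: row operations clear the entries with [rho] above [kap]. *)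
Lemma clear_down P :
  (forall (i : 'I_N) (a : 'I_d), P i a -> ~~ inw i) ->
  (forall (i i' : 'I_N) (b : 'I_d), B i = k0 -> B i' = k0 -> ~~ inw i' -> (rho i < rho i')%N -> P i b ->
     (Bc b = l0 -> (rho i < kap b)%N) -> P i' b) ->
  (forall (i : 'I_N) (a : 'I_d), ~~ inw i -> inblk i a -> rho i = kap a -> P i a) ->
  covers Z (fun i a => P i a && (inblk i a ==> (rho i <= kap a)%N)) -> covers Z P.
Proof.
move=> Pn Hmono Hpiv; have [Zl Zr Zc _ _] := adm.
pose Q r i a := P i a && (inblk i a && (kap a < r)%N ==> (rho i <= kap a)%N).
have step r : covers Z (Q r.+1) -> covers Z (Q r).
  have [[i [a [ni ia ri ra]]]|no] := EM (exists i a,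
      [/\ ~~ inw i, inblk i a, rho i = r & kap a = r]); last first.
    apply: covers_sub => k b /andP[Pkb H]; rewrite /Q Pkb /=.
    apply/implyP => /andP[kb]; rewrite ltnS leq_eqVlt => /orP[/eqP kr|kr]; last first.
      by rewrite kb kr in H.
    rewrite leqNgt; apply/negP => rk; apply: no.
    have [i [ni ei ki]] : exists i, [/\ ~~ inw i, B i = B k & rho i = r].
      by apply: rho_onto; rewrite -?kr //; exact: Pn Pkb.
    by exists i, b; split; rewrite // /inblk ei.
  have /andP[/eqP Bi /eqP Ba] := ia.
  apply: (covers_clear_col (i := i) (a := a)
    (A := fun k => [&& B k == k0, ~~ inw k & (rho i < rho k)%N]) Zr Zl) => //.
  - by move=> b; rewrite /rowop ltnn.
  - by rewrite /Q Hpiv ?ri ?ra //= leqnn implybT.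
  - move=> k /and3P[/eqP Bk nk ik]; rewrite /rowop Bi Bk eqxx ni nk /= andbT.
    by apply: rho_lt => //; rewrite Bi.
  - move=> k b /and3P[/eqP Bk nk ik] nb /andP[Pib H].
    have big : Bc b = l0 -> (rho i < kap b)%N.
      move=> Bb; have : (r <= kap b)%N.
        rewrite leqNgt; apply/negP => kr; move: H; rewrite /inblk Bi Bb !eqxx kr /= ri.
        by rewrite leqNgt kr.
      rewrite leq_eqVlt ri => /orP[/eqP e|//].
      case/eqP: nb; apply: kap_inj => //; [by rewrite Bb|by rewrite ra].
    rewrite /Q (Hmono i k b) //=; apply/implyP => /andP[/andP[_ /eqP Bb]].
    by rewrite ltnS leqNgt -ri big.
  - move=> k b /andP[Pkb H] nA; rewrite /Q Pkb /=; apply/implyP => /andP[kb].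
    rewrite ltnS leq_eqVlt => /orP[/eqP kr|kr]; last by rewrite kb kr in H.
    have /andP[/eqP Bk /eqP Bb] := kb.
    have ba : b = a by apply: kap_inj; rewrite ?Bb ?kr ?ra.
    by move: nA; rewrite Bk eqxx (Pn _ _ Pkb) ba eqxx andbT /= -leqNgt ra ri.
move=> cov; have : covers Z (Q N).
  apply: covers_sub cov => i a /andP[-> H] /=; apply/implyP => ia; move: H; rewrite ia /=.
  have -> // : (kap a < N)%N.
  by have := ltn_ord (val w a); rewrite /kap; lia.
suff H m : covers Z (Q m) -> covers Z P by exact: H.
elim: m => [|m IH] cm; last exact: IH (step _ cm).
by apply: covers_sub cm => i a Pia; rewrite /Q Pia ltn0 andbF.
Qed.

(** Uses up both Borel subgroups of one block pair. Outside it, constancy of [P] along the affected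
    rows and columns absorbs the fill-in. *)
Lemma diagonalize P :
  (forall (i : 'I_N) (a : 'I_d), P i a -> ~~ inw i) ->
  (forall (i : 'I_N) (b b' : 'I_d), Bc b = l0 -> Bc b' = l0 -> B i <> k0 -> P i b -> P i b') ->
  (forall (i i' : 'I_N) (b : 'I_d), B i = k0 -> B i' = k0 -> ~~ inw i' -> Bc b <> l0 -> P i b -> P i' b) ->
  (forall (i : 'I_N) (a : 'I_d), ~~ inw i -> inblk i a -> P i a) ->
  covers Z (fun i a => P i a && (inblk i a ==> (rho i == kap a))) -> covers Z P.
Proof.
move=> Pn Hc Hr Hf cov; apply: clear_right => //.
- move=> i b b' Bb Bb' _ Pib _; have [Bi|nBi] := eqVneq (B i) k0.
    by apply: Hf; rewrite ?(Pn _ _ Pib) // /inblk Bi Bb' !eqxx.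
  by apply: (Hc i b) => //; apply/eqP.
- by move=> i a ni ia _; apply: Hf.
apply: clear_down.
- by move=> i a /andP[/Pn].
- move=> i i' b Bi Bi' ni' lt /andP[Pib H] lt'.
  have [Bb|nBb] := eqVneq (Bc b) l0.
    by move: H; rewrite /inblk Bi Bb !eqxx /= leqNgt lt'.
  by rewrite /inblk (negPf nBb) andbF /= andbT; apply: (Hr i) => //; apply/eqP.
- by move=> i a ni ia e; rewrite Hf //= e leqnn implybT.
apply: covers_sub cov => i a /andP[/andP[-> H1] H2] /=; apply/implyP => ia.
by move: H1 H2; rewrite ia /= eqn_leq => -> ->.
Qed.

End Clear.

Lemma edgeP i a : edge i a -> ~~ inw i.
Proof. by case/andP. Qed.

Lemma reduces_forest (Pf : 'I_N -> 'I_d -> bool) mu : (forall (i : 'I_N) (a : 'I_d), Pf i a -> edge i a) -> forest Pf mu ->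
  (forall Z, admissible Z -> covers Z Pf -> covers Z edge) -> reduces_to Pf.
Proof.
move=> Pfree fP H Z ad ZP; apply: H => //; have [Zl _ _ Zr Zc] := ad.
by apply: (covers_forest (rows := fun i => ~~ inw i) Zl Zr Zc _ _ fP ZP) => // i a /Pfree /edgeP.
Qed.

(** Once the block pair is diagonal, every edge outside block [k1] is alone in its row. Deleting
    these leaves the edges of a single row, which are alone in their columns. *)
Lemma pattern_row k0 l0 k1 : k1 <> k0 ->
  (forall (i : 'I_N) (a : 'I_d), edge i a -> inblk k0 l0 i a \/ B i = k1) ->
  (thr k1 <= (bst Ns k1).+1)%N -> exists Pf, reduces_to Pf.
Proof.
move=> nk HP s1; pose Pf i a := edge i a && (inblk k0 l0 i a ==> (rho i == kap a)).
have uni i j : ~~ inw i -> ~~ inw j -> B i = k1 -> B j = k1 -> i = j.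
  move=> ni nj Bi Bj; apply: val_inj => /=.
  by have := slack_rowP lev stw ni; have := slack_rowP lev stw nj; rewrite Bi Bj; lia.
have [kl|lk] := ltnP k0 l0; last first.
  exists edge; apply: (@reduces_forest _ (fun _ _ => 0%N)) => // i a fia.
  right=> k nki fka; case/eqP: nki; apply: uni; try exact: edgeP fka; try exact: edgeP fia.
    case: (HP k a fka) => // /andP[/eqP Bk /eqP Ba].
    by have /andP[_] := fka; rewrite Bk Ba ltnNge lk.
  case: (HP i a fia) => // /andP[/eqP Bk /eqP Ba].
  by have /andP[_] := fia; rewrite Bk Ba ltnNge lk.
exists Pf; apply: (@reduces_forest _ (fun i a => (B i != k1 : nat))).
- by move=> i a /andP[].
- move=> i a /andP[fia H]; have [Bi|nBi] := eqVneq (B i) k1.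
    right=> k nki /andP[fka _]; rewrite (_ : B k != k1) //.
    apply/eqP => Bk; case/eqP: nki; apply: uni => //; [exact: edgeP fka|exact: edgeP fia].
  left=> b nb /andP[fib Hb]; case/eqP: nb.
  case: (HP i a fia) => [ia|/eqP]; last by rewrite (negPf nBi).
  case: (HP i b fib) => [ib|/eqP]; last by rewrite (negPf nBi).
  move: H Hb; rewrite ia ib /= => /eqP e /eqP e'.
  move: ia ib => /andP[_ /eqP Ba] /andP[_ /eqP Bb].
  by apply: kap_inj; rewrite ?Ba ?Bb // -e e'.
move=> Z ad; apply: diagonalize => //.
- by move=> i a /edgeP.
- move=> i b b' Bb Bb' _ /andP[ni]; by rewrite Bb /block_edge ni Bb'.
- move=> i i' b Bi _ _ nb fib; case: (HP i b fib) => [/andP[_ /eqP]//|].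
  by rewrite Bi => e; case: nk.
- by move=> i a ni /andP[/eqP Bi /eqP Ba]; rewrite /block_edge ni Bi Ba.
Qed.

(** Mirror image of [pattern_row], with a column block of at most one column. *)
Lemma pattern_col k0 l0 l1 : l1 <> l0 ->
  (forall (i : 'I_N) (a : 'I_d), edge i a -> inblk k0 l0 i a \/ Bc a = l1) ->
  (bst Ns l1.+1 <= (thr l1).+1)%N -> exists Pf, reduces_to Pf.
Proof.
move=> nl HP s1; pose Pf i a := edge i a && (inblk k0 l0 i a ==> (rho i == kap a)).
have uni a b : Bc a = l1 -> Bc b = l1 -> a = b.
  move=> Ba Bb; apply: kap_inj; first by rewrite Ba.
  by have := img_colP lev stw a; have := img_colP lev stw b; rewrite /kap Ba Bb; lia.
have [kl|lk] := ltnP k0 l0; last first.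
  exists edge; apply: (@reduces_forest _ (fun _ _ => 0%N)) => // i a fia.
  left=> b nb fib; case/eqP: nb; apply: uni.
    case: (HP i b fib) => // /andP[/eqP Bk /eqP Ba].
    by have /andP[_] := fib; rewrite Bk Ba ltnNge lk.
  case: (HP i a fia) => // /andP[/eqP Bk /eqP Ba].
  by have /andP[_] := fia; rewrite Bk Ba ltnNge lk.
exists Pf; apply: (@reduces_forest _ (fun i a => (Bc a != l1 : nat))).
- by move=> i a /andP[].
- move=> i a /andP[fia H]; have [Ba|nBa] := eqVneq (Bc a) l1.
    left=> b nb /andP[fib _]; rewrite (_ : Bc b != l1) //.
    by apply/eqP => Bb; case/eqP: nb; apply: uni.
  right=> k nki /andP[fka Hk]; case/eqP: nki.
  case: (HP i a fia) => [ia|/eqP]; last by rewrite (negPf nBa).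
  case: (HP k a fka) => [ka|/eqP]; last by rewrite (negPf nBa).
  move: H Hk; rewrite ia ka /= => /eqP e /eqP e'.
  move: ia ka => /andP[/eqP Bi _] /andP[/eqP Bk _].
  by apply: rho_inj; rewrite ?Bi ?Bk ?e //; [exact: edgeP fka|exact: edgeP fia].
move=> Z ad; apply: diagonalize => //.
- by move=> i a /edgeP.
- move=> i b b' Bb Bb' nBi fib; case: (HP i b fib) => [/andP[/eqP]//|].
  by rewrite Bb => e; case: nl.
- by move=> i i' b Bi Bi' ni' _ /andP[_]; rewrite Bi /block_edge ni' Bi'.
- by move=> i a ni /andP[/eqP Bi /eqP Ba]; rewrite /block_edge ni Bi Ba.
Qed.

(** The edges already lie on one row and one column, a forest without any elimination. *)
Lemma pattern_rowcol k1 l1 :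
  (forall (i : 'I_N) (a : 'I_d), edge i a -> B i = k1 \/ Bc a = l1) ->
  (thr k1 <= (bst Ns k1).+1)%N -> (bst Ns l1.+1 <= (thr l1).+1)%N ->
  exists Pf, reduces_to Pf.
Proof.
move=> HP s1 s2.
have unir i j : ~~ inw i -> ~~ inw j -> B i = k1 -> B j = k1 -> i = j.
  move=> ni nj Bi Bj; apply: val_inj => /=.
  by have := slack_rowP lev stw ni; have := slack_rowP lev stw nj; rewrite Bi Bj; lia.
have unic a b : Bc a = l1 -> Bc b = l1 -> a = b.
  move=> Ba Bb; apply: kap_inj; first by rewrite Ba.
  by have := img_colP lev stw a; have := img_colP lev stw b; rewrite /kap Ba Bb; lia.
exists edge; apply: (@reduces_forest _ (fun i a => (B i != k1 : nat))) => // i a fia.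
have [Bi|nBi] := eqVneq (B i) k1.
  right=> k nki fka; rewrite (_ : B k != k1) //.
  apply/eqP => Bk; case/eqP: nki; apply: unir => //; [exact: edgeP fka|exact: edgeP fia].
left=> b nb fib; case/eqP: nb; apply: unic.
  by case: (HP i b fib) => // /eqP; rewrite (negPf nBi).
by case: (HP i a fia) => // /eqP; rewrite (negPf nBi).
Qed.

(** After the first column block is diagonal, only column operations in the second one are used, as
    row operations would spoil the diagonal. They leave the staircase [kap a <= rho i], which for at
    most two rows is a path; a third row could create a cycle of length four. *)
Lemma pattern_two_rows k0 l0 l1 : l0 <> l1 -> (k0 < l0)%N -> (k0 < l1)%N ->
  (forall (i : 'I_N) (a : 'I_d), edge i a -> B i = k0 /\ (Bc a = l0 \/ Bc a = l1)) ->
  (thr k0 <= (bst Ns k0).+2)%N -> exists Pf, reduces_to Pf.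
Proof.
move=> nl kl0 kl1 HP s2.
pose P1 i a := edge i a && (inblk k0 l0 i a ==> (rho i == kap a)).
pose Pf i a := P1 i a && (inblk k0 l1 i a ==> (kap a <= rho i)%N).
have rho1 i : ~~ inw i -> B i = k0 -> (rho i <= 1)%N.
  by move=> ni Bi; have := slack_rowP lev stw ni; rewrite /rho Bi; lia.
exists Pf; apply: (@reduces_forest _
   (fun i a => if (Bc a == l1) && (kap a == 0%N) then rho i else 2%N)).
- by move=> i a /andP[/andP[]].
- move=> i a /andP[/andP[fia H1] H2]; have [Bi Ba] := HP i a fia.
  have ri := rho1 i (edgeP fia) Bi.
  have injr k b : edge k b -> rho k = rho i -> k = i.
    move=> fkb e; apply: rho_inj => //; [exact: edgeP fkb|exact: edgeP fia|].
    by have [-> _] := HP k b fkb.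
  case: Ba => Ba.
    right=> k nki /andP[/andP[fka H1k] _]; case/eqP: nki; apply: (injr _ _ fka).
    have [Bk _] := HP k a fka.
    by move: H1 H1k; rewrite /inblk Bi Bk Ba !eqxx /= => /eqP -> /eqP ->.
  have H2' : (kap a <= rho i)%N by move: H2; rewrite /inblk Bi Ba !eqxx.
  rewrite Ba eqxx /=; have [k0'|kn0] := eqVneq (kap a) 0%N; last first.
    right=> k nki /andP[/andP[fka _] Hk]; have [Bk _] := HP k a fka.
    have rk := rho1 k (edgeP fka) Bk.
    case/eqP: nki; apply: (injr _ _ fka); move: Hk; rewrite /inblk Bk Ba !eqxx /=; lia.
  have [r0|rn0] := eqVneq (rho i) 0%N.
    right=> k nki /andP[/andP[fka _] Hk]; rewrite r0 lt0n.
    by apply: contraNneq nki => e; apply/eqP; apply: (injr _ _ fka); rewrite e.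
  left=> b nb /andP[/andP[fib _] _]; have [_ Bb] := HP i b fib.
  case: ifP => [/andP[/eqP Bb' /eqP kb]|_]; last by rewrite ltnS.
  by case/eqP: nb; apply: kap_inj; rewrite ?Bb' ?kb.
move=> Z ad cov.
apply: (@diagonalize Z ad k0 l0).
- by move=> i a /edgeP.
- move=> i b b' Bb Bb' _ /andP[ni]; by rewrite Bb /block_edge ni Bb'.
- by move=> i i' b Bi Bi' ni' _ /andP[_]; rewrite Bi /block_edge ni' Bi'.
- by move=> i a ni /andP[/eqP Bi /eqP Ba]; rewrite /block_edge ni Bi Ba.
have nl' : (l1 == l0) = false by apply/eqP => e; case: nl.
apply: (@clear_right Z ad k0 l1) => //.
- by move=> i a /andP[/edgeP].
- move=> i b b' Bb Bb' _ /andP[fib _] _; have /andP[ni lt] := fib; rewrite /block_edge ni Bb' -Bb lt /=.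
  by rewrite /inblk Bb' nl' andbF.
- move=> i a ni /andP[/eqP Bi /eqP Ba] _; rewrite /block_edge ni Bi Ba kl1 /= /inblk Ba.
  by rewrite nl' andbF.
Qed.

(** Mirror image of [pattern_two_rows]: two slack blocks share a block of at most two columns. *)
Lemma pattern_two_cols k0 k1 l0 : k0 <> k1 -> (k0 < l0)%N -> (k1 < l0)%N ->
  (forall (i : 'I_N) (a : 'I_d), edge i a -> (B i = k0 \/ B i = k1) /\ Bc a = l0) ->
  (bst Ns l0.+1 <= (thr l0).+2)%N -> exists Pf, reduces_to Pf.
Proof.
move=> nk kl0 kl1 HP s2.
pose P1 i a := edge i a && (inblk k0 l0 i a ==> (rho i == kap a)).
pose Pf i a := P1 i a && (inblk k1 l0 i a ==> (rho i <= kap a)%N).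
have kap1 a : Bc a = l0 -> (kap a <= 1)%N.
  by move=> Ba; have := img_colP lev stw a; rewrite /kap Ba; lia.
exists Pf; apply: (@reduces_forest _
   (fun i a => if (B i == k1) && (rho i == 0%N) then kap a else 2%N)).
- by move=> i a /andP[/andP[]].
- move=> i a /andP[/andP[fia H1] H2]; have [Bi Ba] := HP i a fia.
  have ka := kap1 a Ba.
  have injc k b : edge k b -> kap b = kap a -> b = a.
    by move=> fkb e; apply: kap_inj => //; have [_ ->] := HP k b fkb.
  case: Bi => Bi.
    left=> b nb /andP[/andP[fib H1b] _]; case/eqP: nb; apply: (injc _ _ fib).
    have [_ Bb] := HP i b fib.
    by move: H1 H1b; rewrite /inblk Bi Bb Ba !eqxx /= => /eqP <- /eqP <-.
  have H2' : (rho i <= kap a)%N by move: H2; rewrite /inblk Bi Ba !eqxx.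
  rewrite Bi eqxx /=; have [k0'|kn0] := eqVneq (rho i) 0%N; last first.
    left=> b nb /andP[/andP[fib _] Hb]; have [_ Bb] := HP i b fib.
    have kb := kap1 b Bb.
    case/eqP: nb; apply: (injc _ _ fib); move: Hb; rewrite /inblk Bi Bb !eqxx /=; lia.
  have [r0|rn0] := eqVneq (kap a) 0%N.
    left=> b nb /andP[/andP[fib _] Hb]; rewrite r0 lt0n.
    by apply: contraNneq nb => e; apply/eqP; apply: (injc _ _ fib); rewrite e.
  right=> k nki /andP[/andP[fka _] _]; have [Bk _] := HP k a fka.
  case: ifP => [/andP[/eqP Bk' /eqP rk]|_]; last by rewrite ltnS.
  case/eqP: nki; apply: rho_inj; rewrite ?Bk' ?rk //; [exact: edgeP fka|exact: edgeP fia].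
move=> Z ad cov.
apply: (@diagonalize Z ad k0 l0).
- by move=> i a /edgeP.
- move=> i b b' Bb Bb' _ /andP[ni]; by rewrite Bb /block_edge ni Bb'.
- by move=> i i' b Bi Bi' ni' _ /andP[_]; rewrite Bi /block_edge ni' Bi'.
- by move=> i a ni /andP[/eqP Bi /eqP Ba]; rewrite /block_edge ni Bi Ba.
have nk' : (k1 == k0) = false by apply/eqP => e; case: nk.
apply: (@clear_down Z ad k1 l0) => //.
- by move=> i a /andP[/edgeP].
- move=> i i' b Bi Bi' ni' _ /andP[/andP[_ lt] _] _.
  by rewrite /block_edge ni' Bi' -Bi lt /= /inblk Bi' nk'.
- move=> i a ni /andP[/eqP Bi /eqP Ba] _; rewrite /block_edge ni Bi Ba kl1 /= /inblk Bi.
  by rewrite nk'.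
Qed.

End Patterns.

(** * Modules generated by highest weight vectors *)

Definition cj (z : C) : C := @Num.conj Cn z.

Lemma cjD x y : cj (x + y) = cj x + cj y. Proof. exact: (rmorphD (@Num.conj Cn)). Qed.
Lemma cjM x y : cj (x * y) = cj x * cj y. Proof. exact: (rmorphM (@Num.conj Cn)). Qed.
Lemma cjN x : cj (- x) = - cj x. Proof. exact: (rmorphN (@Num.conj Cn)). Qed.
Lemma cj0 : cj 0 = 0. Proof. exact: (rmorph0 (@Num.conj Cn)). Qed.
Lemma cj1 : cj 1 = 1. Proof. exact: (rmorph1 (@Num.conj Cn)). Qed.
Lemma cjK : involutive cj. Proof. exact: (@conjCK Cn). Qed.
Lemma cj_sum (I : Type) (r : seq I) (P : pred I) F :
  cj (\sum_(i <- r | P i) F i) = \sum_(i <- r | P i) cj (F i).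
Proof. exact: (rmorph_sum (@Num.conj Cn)). Qed.
Lemma cj_prod (I : Type) (r : seq I) (P : pred I) F :
  cj (\prod_(i <- r | P i) F i) = \prod_(i <- r | P i) cj (F i).
Proof. exact: (rmorph_prod (@Num.conj Cn)). Qed.

Definition adj N (g : 'M[C]_N) : 'M[C]_N := \matrix_(i, j) cj (g j i).

Lemma minor_adj d N (g : 'M[C]_N) (I J : Idn d N) : minor (adj g) I J = cj (minor g J I).
Proof.
have -> : cj (minor g J I) = \det (map_mx (@Num.conj Cn)
    (\matrix_(a < d, b < d) g (val J a) (val I b) : 'M[Cn]_d)).
  exact: (esym (det_map_mx (@Num.conj Cn) _)).
by rewrite -det_tr; congr (\det _); apply/matrixP => a b; rewrite !mxE.
Qed.

Lemma Levi_mul N Ns (g h : 'M[C]_N) : inLevi Ns g -> inLevi Ns h -> inLevi Ns (g *m h).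
Proof.
move=> [ug bg] [uh bh]; split; first by rewrite unitmx_mul ug uh.
move=> i j nij; rewrite mxE big1 // => k _.
have [e|/eqP/bg->] := eqVneq (blk Ns i) (blk Ns k); last by rewrite mul0r.
by rewrite bh ?mulr0 // -e.
Qed.

Lemma Levi1 N Ns : inLevi Ns (1%:M : 'M[C]_N).
Proof. by rewrite -dg1; apply: dg_Levi => i; rewrite oner_neq0. Qed.

Lemma Levi_adj N Ns (g : 'M[C]_N) : inLevi Ns g -> inLevi Ns (adj g).
Proof.
case=> ug bg; split.
  have aV : adj (invmx g) *m adj g = 1%:M.
    apply/matrixP => i j; rewrite mxE.
    have := congr1 (fun A : 'M[C]_N => cj (A j i)) (mulmxV ug).
    rewrite !mxE cj_sum => e; transitivity (cj (j == i)%:R); last first.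
      by rewrite eq_sym; case: eqP => _; rewrite ?cj0 ?cj1.
    by rewrite -e; apply: eq_bigr => k _; rewrite !mxE cjM mulrC.
  by have [] := mulmx1_unit aV.
by move=> i j nij; rewrite mxE bg ?cj0 // => e; apply: nij.
Qed.

Section BigCell.
Variables (N : nat) (Ns : seq nat) (Z : 'M[C]_N -> Prop).
Hypothesis Zl : line_closed Z (fun _ _ => true).
Hypothesis ZU : forall u x, inUL Ns u -> Z x -> Z (u *m x).
Hypothesis ZV : forall v x, inUL Ns v^T -> Z x -> Z (x *m v).
Hypothesis ZT : forall r x, (forall i, r i != 0) -> Z x -> Z (dg r *m x).
Hypothesis Z1 : Z 1%:M.

(* The big cell U T U^- is dense in the Levi. *)
Lemma big_cell (x : 'M[C]_N) : (forall i j : 'I_N, blk Ns i <> blk Ns j -> x i j = 0) -> Z x.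
Proof.
have Zr : row_closed Z (fun k i => (k < i)%N && (blk Ns k == blk Ns i)).
  move=> i c M Hc ZM; rewrite rowop_mulmx.
  apply: ZU ZM => k l nkl; rewrite mxE; case: (eqVneq l i) => [li|]; last by rewrite mulr0 addr0.
  have -> : c k = 0 by apply: contraNeq nkl => /Hc; rewrite li.
  by rewrite mul0r addr0.
have Zc : col_closed Z (fun b a => (b < a)%N && (blk Ns b == blk Ns a)).
  move=> a c M Hc ZM; rewrite colop_mulmx.
  apply: ZV ZM => l k nkl; rewrite !mxE eq_sym.
  case: (eqVneq k a) => [ka|]; last by rewrite mul0r addr0.
  have -> : c l = 0 by apply: contraNeq nkl => /Hc; rewrite ka.
  by rewrite mulr0 addr0.
(* Block diagonal matrices whose rows and columns of index at least [r] are already diagonal. The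
   step pivots at [(r, r)] and clears the column above and the row to the left; [r = 0] is the torus
   and [r = N] is the claim. *)
pose P r (i j : 'I_N) := (blk Ns i == blk Ns j) && ((r <= maxn i j)%N ==> (i == j)).
have step r : covers Z (P r) -> covers Z (P r.+1).
  have [rN|Nr] := ltnP r N; last first.
    apply: covers_sub => i j /andP[b H]; rewrite /P b /=; apply/implyP => rm.
    by have := ltn_ord i; have := ltn_ord j; lia.
  pose m := Ordinal rN => cov.
  pose Q (i j : 'I_N) := P r.+1 i j && ((j == m) ==> (i == j)).
  apply: (covers_clear_col (P' := Q) (i := m) (a := m) (S := fun _ _ => true)
    (A := fun k => (k < m)%N && (blk Ns k == blk Ns m)) Zr Zl) => //.
  - by move=> i /=; rewrite ltnn.
  - by rewrite /P !eqxx implybT.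
  - move=> k b /andP[km bk] nbm /andP[bb H]; rewrite /Q /P (negPf nbm) /= andbT.
    rewrite (eqP bk) bb /=; apply/implyP => /= h.
    have nb : (val b != r)%N by apply: contra nbm => /eqP e; apply/eqP/val_inj.
    have rb : (r < b)%N by move: h km => /=; lia.
    move: H; rewrite /= (_ : (r < maxn r b)%N) /=; last by rewrite leq_max rb orbT.
    by rewrite eq_sym (negPf nbm).
  - move=> k b /andP[bkb H] nA; rewrite /Q {1}/P bkb H /=; apply/implyP => /eqP bm.
    have bkm : blk Ns k == blk Ns m by rewrite -bm.
    move: nA; rewrite bm eqxx andbT bkm andbT -leqNgt => mk.
    apply: contraTT H => nkm; rewrite bm negb_imply nkm andbT /= leq_max.
    by rewrite ltn_neqAle mk andbT; rewrite -(inj_eq val_inj) eq_sym /= in nkm; rewrite nkm.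
  apply: (covers_clear_row (P' := P r) (i := m) (a := m) (S := fun _ _ => true)
    (A := fun k => (k < m)%N && (blk Ns k == blk Ns m)) Zc Zl) => //.
  - by move=> i /=; rewrite ltnn.
  - by rewrite /Q /P !eqxx !implybT.
  - by move=> k b _ nk /andP[_]; rewrite eqxx /= (negPf nk).
  move=> k b /andP[/andP[bkb H] Hm] nA; rewrite /P bkb /=; apply/implyP => rm.
  have [bm|nbm] := eqVneq b m; first by move: Hm; rewrite bm eqxx.
  have [km|nkm] := eqVneq k m; last first.
    apply: (implyP H); rewrite -!(inj_eq val_inj) /= in nbm nkm.
    by move: rm nbm nkm; clear; lia.
  have bbm : blk Ns b == blk Ns m by rewrite eq_sym -km.
  move: nA; rewrite km eqxx andbT bbm andbT -leqNgt => mb.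
  have := implyP H; rewrite km; apply.
  rewrite -(inj_eq val_inj) /= in nbm.
  by move: nbm mb => /=; clear; lia.
have c0 : covers Z (P 0%N).
  move=> M sM.
  have Mij i j : i != j -> M i j = 0 by move=> nij; apply: sM; rewrite /P (negPf nij) andbF.
  apply: (Zl (E := 1%:M) (prod_XaddC_neq0 (index_enum 'I_N) predT (fun i => M i i))) => // s.
  rewrite horner_prod => /prodf_neq0 nz.
  have := ZT (r := fun i => M i i + s) (x := 1%:M) _ Z1; rewrite mulmx1.
  rewrite (_ : M + _ = dg (fun i => M i i + s)).
    by apply=> i; have := nz i isT; rewrite !hornerE addrC.
  apply/matrixP => i j; rewrite !mxE; case: (eqVneq i j) => [->|nij]; first by rewrite mulr1.
  have -> : M i j = 0 by exact: Mij. by rewrite add0r; exact: (mulr0 s).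
have cm m : covers Z (P m) by elim: m => // m IH; apply: step.
move=> x0; apply: (cm N) => i j; rewrite /P negb_and => /orP[/eqP/x0//|].
rewrite negb_imply => /andP[h _]; have := ltn_ord i; have := ltn_ord j; lia.
Qed.

End BigCell.

(** * Tensors with a Hermitian form and the modules they generate *)

Section Tensors.
Variables (d N r : nat) (Ns : seq nat).

Local Notation tix := {ffun 'I_r -> Idn d N}.

(** A tensor holds the coefficients of a form of degree [r] in the Pluecker coordinates, without
    symmetrisation; [actT g] is the substitution of [g] into that form, hence again an action that
    reverses products. *)
Definition actT (g : 'M[C]_N) (c : tix -> C) : tix -> C :=
  fun K => \sum_(J : tix) c J * \prod_i minor g (J i) (K i).

Definition ip (a b : tix -> C) : C := \sum_J a J * cj (b J).

Lemma actTD g a b : actT g (fun K => a K + b K) = fun K => actT g a K + actT g b K.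
Proof.
apply: funext => K; rewrite /actT -big_split /=; apply: eq_bigr => J _; by rewrite mulrDl.
Qed.

Lemma actTZ g c a : actT g (fun K => c * a K) = fun K => c * actT g a K.
Proof.
apply: funext => K; rewrite /actT big_distrr /=; apply: eq_bigr => J _; by rewrite mulrA.
Qed.

Lemma actT_mul g h a : actT g (actT h a) = actT (h *m g) a.
Proof.
apply: funext => K; rewrite /actT.
transitivity (\sum_(J : tix) \sum_(L : tix)
   a L * (\prod_i minor h (L i) (J i) * \prod_i minor g (J i) (K i))).
  by apply: eq_bigr => J _; rewrite big_distrl /=; apply: eq_bigr => L _; rewrite mulrA.
rewrite exchange_big /=; apply: eq_bigr => L _; rewrite -big_distrr /=; congr (_ * _).
under [RHS]eq_bigr do rewrite minor_mul.
rewrite (bigA_distr_bigA (fun i J => minor h (L i) J * minor g J (K i))) /=.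
by apply: eq_bigr => J _; rewrite big_split.
Qed.

Lemma minor1 (I J : Idn d N) : minor 1%:M I J = (I == J)%:R.
Proof.
have := congr1 (fun x : pt d N => x I) (pl_Ew J); rewrite !ffunE => <-.
by congr (\det _); apply/matrixP => a b; rewrite !mxE.
Qed.

Lemma prod_delta (I J : tix) : \prod_i (I i == J i)%:R = (I == J)%:R :> C.
Proof.
have [->|nIJ] := eqVneq I J; first by rewrite big1 // => i _; rewrite eqxx.
have [i ni] : exists i, I i != J i.
  apply/existsP; rewrite -negb_forall; apply: contra nIJ => /forallP H.
  by apply/eqP/ffunP => i; apply/eqP.
by rewrite (bigD1 i) //= (negPf ni) mul0r.
Qed.

Lemma actT1 a : actT 1%:M a = a.
Proof.
have dl (J K : tix) : \prod_i minor 1%:M (J i) (K i) = (J == K)%:R :> C.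
  by rewrite -prod_delta; apply: eq_bigr => i _; rewrite minor1.
apply: funext => K; rewrite /actT (bigD1 K) //= [X in _ + X]big1 ?addr0 => [|J nJ].
  by rewrite dl eqxx mulr1.
by rewrite dl (negPf nJ) mulr0.
Qed.

Lemma ip_adj g a b : ip (actT g a) b = ip a (actT (adj g) b).
Proof.
rewrite /ip /actT.
transitivity (\sum_(K : tix) \sum_(J : tix)
    a J * (\prod_i minor g (J i) (K i)) * cj (b K)).
  by apply: eq_bigr => K _; rewrite big_distrl.
rewrite exchange_big /=; apply: eq_bigr => J _.
rewrite cj_sum big_distrr /=; apply: eq_bigr => K _.
rewrite cjM cj_prod -mulrA; congr (_ * _); rewrite mulrC; congr (_ * _).
by apply: eq_bigr => i _; rewrite minor_adj cjK.
Qed.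

Lemma ipDl a b c : ip (fun K => a K + b K) c = ip a c + ip b c.
Proof. by rewrite /ip -big_split /=; apply: eq_bigr => K _; rewrite mulrDl. Qed.

Lemma ipZl k a c : ip (fun K => k * a K) c = k * ip a c.
Proof. by rewrite /ip big_distrr /=; apply: eq_bigr => K _; rewrite mulrA. Qed.

Lemma ipC a b : ip a b = cj (ip b a).
Proof. by rewrite /ip cj_sum; apply: eq_bigr => K _; rewrite cjM cjK mulrC. Qed.

Lemma ip_eq0 a : ip a a = 0 -> a = fun _ => 0.
Proof.
move=> e; apply: funext => K.
have H (J : tix) : true -> 0 <= (a J : Cn) * (a J)^* by move=> _; apply: mul_conjC_ge0.
have := psumr_eq0P H e => /(_ K isT) /eqP.
by rewrite (mul_conjC_eq0 (a K : Cn)) => /eqP.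
Qed.

Lemma ip_poly (M E : 'M[C]_N) a b :
  exists P : {poly C}, forall s, ip (actT (M + s *: E) a) b = P.[s].
Proof.
pose mp (I J : Idn d N) := \det (\matrix_(x, y)
  ((M (val I x) (val J y))%:P + (E (val I x) (val J y)) *: 'X)).
exists (\sum_(K : tix) (\sum_(J : tix) a J *: \prod_i mp (J i) (K i)) * (cj (b K))%:P) => s.
rewrite horner_sum; apply: eq_bigr => K _; rewrite hornerM hornerC; congr (_ * _).
rewrite horner_sum; apply: eq_bigr => J _; rewrite hornerZ horner_prod; congr (_ * _).
apply: eq_bigr => i _; rewrite -[RHS]/(horner_eval s _) -det_map_mx; congr (\det _).
by apply/matrixP => x y; rewrite !mxE /= /horner_eval !hornerE mulrC.
Qed.

Definition Tfixed := ULfixed Ns actT.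

Lemma adj_UL (v : 'M[C]_N) : inUL Ns v^T -> inUL Ns (adj v).
Proof.
move=> h i j nij; have := h i j nij; rewrite !mxE => ->.
by case: eqP => _; rewrite ?cj0 ?cj1.
Qed.

(* Both sides are semi-invariant in x under the big cell, with the same weight. *)
Lemma coef_eq a b a' b' alpha x :
  Tfixed a -> Tweight actT alpha a -> Tfixed b ->
  Tfixed a' -> Tweight actT alpha a' -> Tfixed b' ->
  ip a b = ip a' b' -> inLevi Ns x -> ip (actT x a) b = ip (actT x a') b'.
Proof.
move=> fa wa fb fa' wa' fb' e [_ bx].
apply: (big_cell (Ns := Ns) (Z := fun x => ip (actT x a) b = ip (actT x a') b')) => //.
- move=> M E p p0 _ H.
  have [P HP] := ip_poly M E a b; have [Q HQ] := ip_poly M E a' b'.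
  have PQ : P - Q = 0.
    by apply: (poly_eq0_of_generic p0) => s /H; rewrite hornerD hornerN -HP -HQ => ->; rewrite subrr.
  have := HP 0; have := HQ 0; rewrite scale0r addr0 => -> ->.
  by apply/eqP; rewrite -subr_eq0 -hornerN -hornerD PQ horner0.
- by move=> u y uU H; rewrite -!actT_mul fa // fa'.
- by move=> v y vV H; have aU := adj_UL vV; rewrite -!actT_mul !(ip_adj v) fb ?fb'.
- move=> t y t0 H; rewrite -!actT_mul wa // wa' //.
  by rewrite !actTZ !ipZl H.
- by rewrite !actT1.
Qed.

(** The combination is kept as a formal list, so that one list can be applied to two different
    generators. *)
Definition spanT (a : tix -> C) (s : seq (C * 'M[C]_N)) : tix -> C :=
  fun K => \sum_(p <- s) p.1 * actT p.2 a K.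

Definition inLs (s : seq (C * 'M[C]_N)) : Prop := forall p, p \in s -> inLevi Ns p.2.

Definition lspan (a y : tix -> C) : Prop := exists2 s, inLs s & y = spanT a s.

Lemma spanT_cat a s t : spanT a (s ++ t) = fun K => spanT a s K + spanT a t K.
Proof. by apply: funext => K; rewrite /spanT big_cat. Qed.

Lemma spanT_scale a c s : spanT a [seq (c * p.1, p.2) | p <- s] = fun K => c * spanT a s K.
Proof.
apply: funext => K; rewrite /spanT big_map big_distrr /=.
by apply: eq_bigr => p _; rewrite mulrA.
Qed.

Lemma actT0 g : actT g (fun _ => 0) = fun _ => 0.
Proof. by apply: funext => K; rewrite /actT big1 // => J _; rewrite mul0r. Qed.

Lemma spanT_act a g s : spanT a [seq (p.1, p.2 *m g) | p <- s] = actT g (spanT a s).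
Proof.
elim: s => [|p s IH].
  rewrite /= (_ : spanT a [::] = fun _ => 0) ?actT0 //.
  by apply: funext => K; rewrite /spanT big_nil.
have sc q t : spanT a (q :: t) = fun K => q.1 * actT q.2 a K + spanT a t K.
  by apply: funext => K; rewrite /spanT big_cons.
by rewrite /= !sc actTD actTZ actT_mul /= IH.
Qed.

Lemma inLs_cat s t : inLs s -> inLs t -> inLs (s ++ t).
Proof. by move=> Hs Ht p; rewrite mem_cat => /orP[/Hs|/Ht]. Qed.

Lemma inLs_scale c s : inLs s -> inLs [seq (c * p.1, p.2) | p <- s].
Proof. by move=> Hs p /mapP[q /Hs Lq ->]. Qed.

Lemma inLs_act g s : inLevi Ns g -> inLs s -> inLs [seq (p.1, p.2 *m g) | p <- s].
Proof. by move=> Lg Hs p /mapP[q /Hs Lq ->]; apply: Levi_mul. Qed.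

Lemma span_self a : lspan a a.
Proof.
exists [:: (1, 1%:M)]; first by move=> p; rewrite inE => /eqP ->; exact: Levi1.
by apply: funext => K; rewrite /spanT big_seq1 mul1r actT1.
Qed.

Lemma span_ortho a b alpha : Tfixed a -> Tweight actT alpha a -> Tfixed b -> ip a b = 0 ->
  forall y, lspan a y -> ip y b = 0.
Proof.
move=> fa wa fb e y [s Ls ->]; elim: s Ls => [|p s IH] Ls.
  by rewrite /ip big1 // => K _; rewrite /spanT big_nil mul0r.
have -> : spanT a (p :: s) = fun K => p.1 * actT p.2 a K + spanT a s K.
  by apply: funext => K; rewrite /spanT big_cons.
rewrite ipDl ipZl IH ?addr0; last by move=> q qs; apply: Ls; rewrite inE qs orbT.
have f0 : Tfixed (fun _ => 0) by move=> u _; rewrite actT0.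
(* Comparison with the zero functional: the coefficients against [b] and against 0 agree at the
   identity, hence on the whole Levi. *)
rewrite (@coef_eq a b a (fun _ => 0) alpha) //; last first.
- by apply: Ls; rewrite inE eqxx.
- by rewrite e /ip big1 // => K _; rewrite cj0 mulr0.
by rewrite /ip big1 ?mulr0 // => K _; rewrite cj0 mulr0.
Qed.

(** Subtract from [y] its projection to [a]. The difference is unipotent-fixed and orthogonal to
    [a], so by [span_ortho] it is orthogonal to the whole span, in which it lies itself. *)
Lemma fixed_in_span a y alpha : Tfixed a -> Tweight actT alpha a -> ip a a <> 0 ->
  lspan a y -> Tfixed y -> exists l, y = fun K => l * a K.
Proof.
move=> fa wa na say fy; pose l := cj (ip a y / ip a a).
pose z := fun K => y K + (- l) * a K.
have fz : Tfixed z.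
  by move=> u uU; rewrite /z (actTD u y) (actTZ u (- l) a) fa // fy.
have az : ip a z = 0.
  rewrite ipC /z ipDl ipZl cjD cjM -(ipC a y) -(ipC a a).
  rewrite /l cjN cjK.
  by rewrite mulNr divfK ?subrr //; apply/eqP.
have sz : lspan a z.
  have [s Ls Es] := say; have [t Lt Et] := span_self a.
  exists (s ++ [seq (- l * p.1, p.2) | p <- t]); first by apply: inLs_cat => //; apply: inLs_scale.
  by rewrite spanT_cat spanT_scale -Es -Et.
have z0 := ip_eq0 (span_ortho fa wa fz az sz).
exists l; apply: funext => K; have := congr1 (fun f => f K) z0; rewrite /z /= mulNr.
by move/eqP; rewrite subr_eq0 => /eqP.
Qed.

(** Moving adjoints to one side turns every Gram entry into a coefficient of the form
    [ip (actT x c) c] with [x] in the Levi, and [coef_eq] makes these agree for [a] and [b]. *)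
Lemma spanT_isometry a b alpha s : Tfixed a -> Tweight actT alpha a ->
  Tfixed b -> Tweight actT alpha b -> ip a a = ip b b -> inLs s ->
  ip (spanT a s) (spanT a s) = ip (spanT b s) (spanT b s).
Proof.
move=> fa wa fb wb e Ls.
have ex c : ip (spanT c s) (spanT c s) =
    \sum_(p <- s) \sum_(q <- s) p.1 * cj q.1 * ip (actT (p.2 *m adj q.2) c) c.
  have -> : ip (spanT c s) (spanT c s) = \sum_(K : tix) \sum_(p <- s) \sum_(q <- s)
      (p.1 * actT p.2 c K) * cj (q.1 * actT q.2 c K).
    apply: eq_bigr => K _; rewrite /spanT cj_sum big_distrl /=.
    by apply: eq_bigr => p _; rewrite big_distrr /=.
  rewrite exchange_big /=; apply: eq_bigr => p _; rewrite exchange_big /=; apply: eq_bigr => q _.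
  have -> : ip (actT (p.2 *m adj q.2) c) c = ip (actT p.2 c) (actT q.2 c).
    by rewrite -actT_mul ip_adj; congr (ip _ (actT _ _)); apply/matrixP => i j; rewrite !mxE cjK.
  by rewrite /ip big_distrr /=; apply: eq_bigr => K _ /=; rewrite cjM; ring.
rewrite !ex big_seq [RHS]big_seq; apply: eq_bigr => p ps.
rewrite big_seq [RHS]big_seq; apply: eq_bigr => q qs; congr (_ * _).
by apply: (coef_eq fa wa fa fb wb fb e); apply: Levi_mul; [exact: Ls|apply: Levi_adj; exact: Ls].
Qed.

(** A nonzero submodule of the span contains a nonzero unipotent-fixed vector, which can only be a
    multiple of [a]. *)
Lemma span_irred a alpha (V : (tix -> C) -> Prop) :
  Tfixed a -> Tweight actT alpha a -> ip a a <> 0 ->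
  V (fun _ => 0) -> (forall f h, V f -> V h -> V (fun y => f y + h y)) ->
  (forall c f, V f -> V (fun y => c * f y)) ->
  (forall g f, inLevi Ns g -> V f -> V (actT g f)) ->
  (forall f, V f -> lspan a f) -> (exists2 f, V f & f <> fun _ => 0) -> V a.
Proof.
move=> fa wa na V0 VD VZ VL Vs nV.
have [|f [Vf nf ff]] := exists_ULfixed actTD actTZ actT_mul actT1 V0 VD VZ VL _ nV.
  move=> k; exists (r * (d * k)).+1 => f _ Mx sMx K.
  pose mp (I J : Idn d N) := \det (\matrix_(x, y) Mx (val I x) (val J y)).
  have smp I J : (size (mp I J) <= (d * k).+1)%N.
    by apply: size_det_le => x y; rewrite mxE.
  exists (\sum_(J : tix) f J *: \prod_i mp (J i) (K i)) => [|s _].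
    apply: leq_trans (size_sum _ _ _) _; apply/bigmax_leqP => J _.
    apply: leq_trans (size_scale_leq _ _) _; apply: leq_trans (size_prod_leq _ _) _.
    rewrite leq_subLR card_ord addnS ltnS -mulnS -[X in (_ <= X * _)%N](card_ord r).
    by rewrite -sum_nat_const; apply: leq_sum => i _; apply: smp.
  rewrite horner_sum; apply: eq_bigr => J _; rewrite hornerZ horner_prod; congr (_ * _).
  apply: eq_bigr => i _; rewrite -[RHS]/(horner_eval s _) -det_map_mx; congr (\det _).
  by apply/matrixP => x y; rewrite !mxE.
have [l fE] := fixed_in_span fa wa na (Vs _ Vf) ff.
have l0 : l != 0.
  by apply/eqP => l0; apply: nf; rewrite fE l0; apply: funext => K; rewrite mul0r.
rewrite (_ : a = fun K => l^-1 * f K); first exact: VZ.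
by apply: funext => K; rewrite fE mulKf.
Qed.

End Tensors.

(** * Restriction of tensors to the cone over X(w) *)

Section Restriction.
Variables (d N r : nat) (w : Idn d N) (Ns : seq nat).
Hypothesis st : stable w Ns.
Local Notation tix := {ffun 'I_r -> Idn d N}.
Implicit Types (a b y : tix -> C).

Definition ev y : pt d N -> C := fun x =>
  if pselect (inXhat w x) then \sum_(J : tix) y J * \prod_i x (J i) else 0.

Lemma evX y x : inXhat w x -> ev y x = \sum_(J : tix) y J * \prod_i x (J i).
Proof. by rewrite /ev; case: pselect. Qed.

Lemma evN y x : ~ inXhat w x -> ev y x = 0.
Proof. by rewrite /ev; case: pselect. Qed.

Lemma evD a b : ev (fun K => a K + b K) = fun x => ev a x + ev b x.
Proof.
apply: funext => x; rewrite /ev; case: pselect => hx; last by rewrite addr0.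
by rewrite -big_split /=; apply: eq_bigr => J _; rewrite mulrDl.
Qed.

Lemma evZ c a : ev (fun K => c * a K) = fun x => c * ev a x.
Proof.
apply: funext => x; rewrite /ev; case: pselect => hx; last by rewrite mulr0.
by rewrite big_distrr /=; apply: eq_bigr => J _; rewrite mulrA.
Qed.

Lemma ev0 : ev (fun _ => 0) = @zerof d N.
Proof.
by apply: funext => x; rewrite /ev; case: pselect => // hx; rewrite big1 // => J _; rewrite mul0r.
Qed.

Lemma ev_act g y : inLevi Ns g -> ev (actT g y) = actR g (ev y).
Proof.
move=> Lg; apply: funext => x; rewrite /actR.
have [Xx|nX] := EM (inXhat w x); last first.
  by rewrite !evN // => /(stable_iff st x Lg).
rewrite !evX //; last exact: st.
rewrite /actT; transitivity (\sum_(K : tix) \sum_(J : tix)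
   y J * (\prod_i minor g (J i) (K i) * \prod_i x (K i))).
  by apply: eq_bigr => K _; rewrite big_distrl /=; apply: eq_bigr => J _; rewrite mulrA.
rewrite exchange_big /=; apply: eq_bigr => J _; rewrite -big_distrr /=; congr (_ * _).
rewrite (eq_bigr (fun i => \sum_K minor g (J i) K * x K)) => [|i _]; last by rewrite ffunE.
rewrite (bigA_distr_bigA (fun i K => minor g (J i) K * x K)) /=.
by apply: eq_bigr => K _; rewrite big_split.
Qed.

Lemma ev_reg y : isReg w (ev y).
Proof.
exists (fun x => \sum_(J : tix) y J * \prod_i x (J i)); split.
  apply: polyfun_sum => J; apply: pf_mul; first exact: pf_const.
  by apply: polyfun_prod => i; apply: pf_coord.
by split=> x Xx; [rewrite evX|rewrite evN].
Qed.

Lemma actf_ev g y : inLevi Ns g -> actf g (ev y) = ev (actT (invmx g) y).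
Proof. by move=> Lg; rewrite ev_act //; apply: Levi_inv. Qed.

Variable alpha : 'I_N -> nat.

(** Norm 1 lets two generators be compared by an isometry; the last condition says that the form
    does not vanish on X(w). *)
Definition highest a : Prop :=
  [/\ Tfixed Ns a, Tweight (@actT d N r) alpha a, ip a a = 1 & ev a <> @zerof d N].

Definition evspan a (f : pt d N -> C) : Prop := exists2 y, lspan Ns a y & f = ev y.

Lemma spanD a y z : lspan Ns a y -> lspan Ns a z -> lspan Ns a (fun K => y K + z K).
Proof.
move=> [s Ls ->] [t Lt ->]; exists (s ++ t); first exact: inLs_cat.
by rewrite spanT_cat.
Qed.

Lemma spanZ a c y : lspan Ns a y -> lspan Ns a (fun K => c * y K).
Proof.
move=> [s Ls ->]; exists [seq (c * p.1, p.2) | p <- s]; first exact: inLs_scale.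
by rewrite spanT_scale.
Qed.

Lemma spanL a g y : inLevi Ns g -> lspan Ns a y -> lspan Ns a (actT g y).
Proof.
move=> Lg [s Ls ->]; exists [seq (p.1, p.2 *m g) | p <- s]; first exact: inLs_act.
by rewrite spanT_act.
Qed.

Lemma span0 a : lspan Ns a (fun _ => 0).
Proof. by exists [::] => //; apply: funext => K; rewrite /spanT big_nil. Qed.

Lemma evspan_submod a : submod w Ns (evspan a).
Proof.
split.
- by move=> f [y _ ->]; apply: ev_reg.
- by exists (fun _ => 0); rewrite ?ev0 //; apply: span0.
- move=> f g [y sy ->] [z sz ->]; exists (fun K => y K + z K); rewrite ?evD //; exact: spanD.
- move=> c f [y sy ->]; exists (fun K => c * y K); rewrite ?evZ //; exact: spanZ.
- move=> g f Lg [y sy ->]; exists (actT (invmx g) y); rewrite ?actf_ev //.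
  by apply: spanL => //; apply: Levi_inv.
Qed.

Lemma neq01 : (1 : C) <> 0. Proof. by move/eqP; rewrite oner_eq0. Qed.

Lemma evspan_irred a : highest a -> irred_submod w Ns (evspan a).
Proof.
move=> [fa wa na ea]; split; first exact: evspan_submod.
  by exists (ev a) => //; exists a => //; apply: span_self.
move=> W' [R' Z' D' S' L'] sub.
pose V y := lspan Ns a y /\ W' (ev y).
have [nV|noV] := EM (exists2 y, V y & y <> fun _ => 0); last first.
  left=> f Wf; have [y sy fE] := sub _ Wf; rewrite fE.
  rewrite (_ : y = fun _ => 0) ?ev0 //; apply: contrapT => ny; apply: noV.
  by exists y => //; split=> //; rewrite -fE.
have [_ Wa] : V a.
  apply: (@span_irred _ _ _ _ a alpha V fa wa) => //.
  - by rewrite na; apply: neq01.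
  - by split; [apply: span0|rewrite ev0].
  - by move=> f h [sf Wf] [sh Wh]; split; [apply: spanD|rewrite evD; apply: D'].
  - by move=> c f [sf Wf]; split; [apply: spanZ|rewrite evZ; apply: S'].
  - move=> g f Lg [sf Wf]; split; first exact: spanL.
    by rewrite -[g]invmxK -actf_ev; [apply: L'|]; rewrite // ; apply: Levi_inv.
  - by move=> f [].
right=> f [y [s Ls ->] ->] {f}.
elim: s Ls => [|p s IH] Ls.
  rewrite (_ : spanT a [::] = fun _ => 0) ?ev0 //.
  by apply: funext => K; rewrite /spanT big_nil.
have -> : spanT a (p :: s) = fun K => p.1 * actT p.2 a K + spanT a s K.
  by apply: funext => K; rewrite /spanT big_cons.
rewrite evD evZ; apply: D'; last by apply: IH => q qs; apply: Ls; rewrite inE qs orbT.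
apply: S'; have Lp : inLevi Ns p.2 by apply: Ls; rewrite inE eqxx.
by rewrite -[p.2]invmxK -actf_ev; [apply: L'|]; rewrite // ; apply: Levi_inv.
Qed.

(** The tensors in the span that restrict to 0 form a submodule; if it were nonzero it would contain
    [a], whose restriction is nonzero. *)
Lemma ev_inj a y : highest a -> lspan Ns a y -> ev y = @zerof d N -> y = fun _ => 0.
Proof.
move=> [fa wa na ea] sy ey; apply: contrapT => ny.
pose V z := lspan Ns a z /\ ev z = @zerof d N.
have [_ //] : V a.
apply: (@span_irred _ _ _ _ a alpha V fa wa) => //.
- by rewrite na; apply: neq01.
- by split; [apply: span0|rewrite ev0].
- move=> f h [sf ef] [sh eh]; split; [exact: spanD|rewrite evD ef eh].
  by apply: funext => x; rewrite /zerof addr0.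
- move=> c f [sf ef]; split; [exact: spanZ|rewrite evZ ef].
  by apply: funext => x; rewrite /zerof mulr0.
- by move=> g f Lg [sf ef]; split; [exact: spanL|rewrite ev_act // ef].
- by move=> f [].
- by exists y.
Qed.

(** The isomorphism as a relation: one formal combination of translates, evaluated at both
    generators. *)
Definition correspond a b (f g : pt d N -> C) : Prop :=
  exists s, [/\ inLs Ns s, f = ev (spanT a s) & g = ev (spanT b s)].

Lemma spanTB a s t :
  spanT a (s ++ [seq (-1 * p.1, p.2) | p <- t]) = fun K => spanT a s K - spanT a t K.
Proof. by rewrite spanT_cat spanT_scale; apply: funext => K; rewrite mulN1r. Qed.

(* The linear relations between the translates of a and of b coincide, because
   both families have the same Gram matrix. *)
Lemma correspond_fun a b f g g' : highest a -> highest b ->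
  correspond a b f g -> correspond a b f g' -> g = g'.
Proof.
move=> ha hb [s [Ls fs gs]] [t [Lt ft gt]].
pose u := s ++ [seq (-1 * p.1, p.2) | p <- t].
have Lu : inLs Ns u by apply: inLs_cat => //; apply: inLs_scale.
have au : spanT a u = fun _ => 0.
  apply: (ev_inj ha); first by exists u.
  rewrite spanTB evD; apply: funext => x; rewrite -fs.
  have -> : ev (fun K => - spanT a t K) = fun x => -1 * ev (spanT a t) x.
    by rewrite -evZ; congr ev; apply: funext => K; rewrite mulN1r.
  by rewrite -ft mulN1r subrr.
have bu : spanT b u = fun _ => 0.
  case: ha hb => fa wa na _ [fb wb nb _]; apply: ip_eq0.
  rewrite -(spanT_isometry fa wa fb wb _ Lu) ?na ?nb // au.
  by rewrite /ip big1 // => K _; rewrite mul0r.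
rewrite gs gt; congr ev; apply: funext => K; have := congr1 (fun h => h K) bu.
by rewrite spanTB => /eqP; rewrite subr_eq0 => /eqP.
Qed.

Lemma correspond_sym a b f g : correspond a b f g -> correspond b a g f.
Proof. by move=> [s [Ls fs gs]]; exists s. Qed.

Lemma evspan_iso a b : highest a -> highest b -> iso_submod Ns (evspan a) (evspan b).
Proof.
move=> ha hb.
have tot f : evspan a f -> exists g, correspond a b f g.
  by move=> [y [s Ls ->] ->]; exists (ev (spanT b s)), s.
pose phi f := if pselect (exists g, correspond a b f g) is left h then projT1 (cid h) else f.
have phiP f : evspan a f -> correspond a b f (phi f).
  by move=> /tot H; rewrite /phi; case: pselect => // h; case: cid.
have phiE f g : correspond a b f g -> phi f = g.
  move=> c; apply: (correspond_fun ha hb _ c); apply: phiP.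
  by case: c => s [Ls -> _]; exists (spanT a s) => //; exists s.
exists phi; split.
- move=> f /phiP [s [Ls _ ->]]; exists (spanT b s) => //; by exists s.
- move=> f g /phiP [s [Ls fs Es]] /phiP [t [Lt gt Et]]; rewrite Es Et; apply: phiE.
  exists (s ++ t); split; first exact: inLs_cat.
    by rewrite spanT_cat evD fs gt.
  by rewrite spanT_cat evD.
- move=> c f /phiP [s [Ls fs Es]]; rewrite Es; apply: phiE.
  exists [seq (c * p.1, p.2) | p <- s]; split; first exact: inLs_scale.
    by rewrite spanT_scale evZ fs.
  by rewrite spanT_scale evZ.
- move=> g f Lg /phiP [s [Ls fs Es]]; rewrite Es; apply: phiE.
  have Lg' := Levi_inv Lg.
  exists [seq (p.1, p.2 *m invmx g) | p <- s]; split; first exact: inLs_act.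
    by rewrite spanT_act -actf_ev // fs.
  by rewrite spanT_act -actf_ev.
split.
  move=> f g /phiP cf /phiP cg e; rewrite e in cf.
  exact: (correspond_fun hb ha (correspond_sym cf) (correspond_sym cg)).
move=> h [y [s Ls ->] ->]; exists (ev (spanT a s)); last by apply: phiE; exists s.
by exists (spanT a s) => //; exists s.
Qed.

Theorem not_mult_free_of_highest a b : highest a -> highest b ->
  (forall l, ev b <> fun x => l * ev a x) -> ~ mult_free w Ns.
Proof.
move=> ha hb npr mf.
have := mf _ _ (evspan_irred ha) (evspan_irred hb) (evspan_iso ha hb) (ev b).
case=> _ []; first by exists b => //; apply: span_self.
move=> y sy ye.
(* Only the restriction of [y] is known to be fixed; injectivity of [ev] on the span of [a] lifts
   this to the tensor. *)
have fy : Tfixed Ns y.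
  move=> u uU; have Lu := UL_Levi uU.
  have : (fun K => actT u y K + -1 * y K) = fun _ => 0.
    apply: (ev_inj ha); first by apply: spanD; [exact: spanL|exact: spanZ].
    rewrite evD evZ ev_act // -ye -ev_act //; case: hb => -> // _ _ _.
    by apply: funext => x; rewrite mulN1r subrr.
  move=> e; apply: funext => K; have := congr1 (fun h => h K) e; rewrite /= mulN1r.
  by move/eqP; rewrite subr_eq0 => /eqP.
case: (ha) => fa wa na _.
have [|l yE] := fixed_in_span fa wa _ sy fy; first by rewrite na; apply: neq01.
by apply: (npr l); rewrite ye yE evZ.
Qed.

End Restriction.

(** * Monomials in Pluecker coordinates as highest weight vectors *)

Section PluckerProducts.
Variables (d N r : nat) (w : Idn d N) (Ns : seq nat).
Hypothesis st : stable w Ns.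
Local Notation tix := {ffun 'I_r -> Idn d N}.

Definition block_top (I : Idn d N) : Prop :=
  forall i j : 'I_N, i \in img I -> (i <= j)%N -> blk Ns i = blk Ns j -> j \in img I.

(** Pick an element of [K] outside [I]. A nonzero off-diagonal entry of [u] in its column would put
    it above an element of [I] in the same block, hence inside [I]; so that column of the minor
    vanishes. *)
Lemma minor_block_top u (I K : Idn d N) : block_top I -> inUL Ns u ->
  minor u I K = (I == K)%:R.
Proof.
move=> tI uU; have [<-|nIK] := eqVneq I K.
  rewrite /minor det_uptri.
    by rewrite big1 // => a _; rewrite mxE uU ?ltnn // eqxx.
  move=> a b ba; rewrite mxE uU; last by rewrite ltnNge Idn_le (ltnW ba).
  by rewrite (inj_eq (@Idn_inj _ _ I)); case: eqP => // e; rewrite e ltnn in ba.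
have [b bI] := Idn_diff nIK; rewrite /minor (@det_col0 _ _ _ b) // => a.
rewrite mxE uU; first by case: eqP => // e; rewrite -e mem_img in bI.
apply: contra bI => /andP[ab /eqP e]; exact: tI (mem_img I a) (ltnW ab) e.
Qed.

Lemma minor_dg (t : 'I_N -> C) (I K : Idn d N) :
  minor (dg t) I K = (I == K)%:R * \prod_(i in img I) t i.
Proof.
have [<-|nIK] := eqVneq I K.
  rewrite mul1r /minor det_uptri.
    rewrite big_imset /=; last by move=> a b _ _; apply: Idn_inj.
    by apply: eq_big => [a|a _]; rewrite // !mxE eqxx.
  move=> a b ba; rewrite !mxE (inj_eq (@Idn_inj _ _ I)).
  by case: eqP => // e; rewrite e ltnn in ba.
have [b bI] := Idn_diff nIK; rewrite /minor (@det_col0 _ _ _ b) ?mul0r // => a.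
by rewrite !mxE; case: eqP => // e; rewrite -e mem_img in bI.
Qed.

Definition delta (I : tix) : tix -> C := fun J => (J == I)%:R.

Lemma actT_delta g I : actT g (delta I) = fun K => \prod_i minor g (I i) (K i).
Proof.
apply: funext => K; rewrite /actT (bigD1 I) //= [X in _ + X]big1 ?addr0.
  by rewrite /delta eqxx mul1r.
by move=> J nJ; rewrite /delta (negPf nJ) mul0r.
Qed.

Lemma ev_delta I x : inXhat w x -> ev w (delta I) x = \prod_i x (I i).
Proof.
move=> Xx; rewrite evX // (bigD1 I) //= [X in _ + X]big1 ?addr0.
  by rewrite /delta eqxx mul1r.
by move=> J nJ; rewrite /delta (negPf nJ) mul0r.
Qed.

Definition mult (I : tix) (j : 'I_N) : nat := \sum_i (j \in img (I i)).

Lemma delta_highest (I : tix) (x : pt d N) : (forall i, block_top (I i)) -> inXhat w x ->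
  \prod_i x (I i) <> 0 -> highest w Ns (mult I) (delta I).
Proof.
move=> tI Xx nx; split.
- move=> u uU; rewrite actT_delta; apply: funext => K.
  rewrite (eq_bigr (fun i => (I i == K i)%:R)) => [|i _]; last exact: minor_block_top.
  by rewrite prod_delta eq_sym.
- move=> t t0; rewrite actT_delta; apply: funext => K.
  under eq_bigr do rewrite minor_dg.
  rewrite big_split /= prod_delta eq_sym mulrC; congr (_ * _).
  rewrite (eq_bigr (fun i => \prod_j t j ^+ (j \in img (I i)))) => [|i _]; last first.
    by rewrite big_mkcond; apply: eq_bigr => j _; case: (j \in _); rewrite ?expr1 ?expr0.
  by rewrite exchange_big; apply: eq_bigr => j _; rewrite -prodrXr.
- rewrite /ip (bigD1 I) //= big1 ?addr0 => [|J nJ]; first by rewrite /delta eqxx cj1 mul1r.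
  by rewrite /delta (negPf nJ) mul0r.
- by move=> e; apply: nx; rewrite -ev_delta // e.
Qed.

(** Non-proportionality is tested by a 2 x 2 determinant of values at two points; equal [mult] means
    equal torus weight. *)
Theorem not_mult_free_of_products (I I' : tix) (x x' : pt d N) :
  (forall i, block_top (I i)) -> (forall i, block_top (I' i)) ->
  mult I =1 mult I' -> inXhat w x -> inXhat w x' ->
  (\prod_i x (I i)) * (\prod_i x' (I' i)) <> (\prod_i x' (I i)) * (\prod_i x (I' i)) ->
  \prod_i x (I i) <> 0 -> \prod_i x' (I' i) <> 0 -> ~ mult_free w Ns.
Proof.
move=> tI tI' eM Xx Xx' ne nx nx'.
have ha := delta_highest tI Xx nx.
have hb : highest w Ns (mult I) (delta I').
  by rewrite (funext eM); apply: delta_highest tI' Xx' nx'.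
apply: (not_mult_free_of_highest st ha hb) => l e; apply: ne.
rewrite -!ev_delta // !e; ring.
Qed.

End PluckerProducts.

(** * Non-proportional highest weight vectors *)

Lemma det2 (R : comNzRingType) (A : 'M[R]_2) :
  \det A = A 0 0 * A 1 1 - A 0 1 * A 1 0.
Proof.
rewrite (expand_det_row _ 0) !big_ord_recl big_ord0 /cofactor !det_mx11 !mxE /=.
rewrite (_ : lift 0 0 = 1 :> 'I_2); last exact: val_inj.
rewrite (_ : lift 1 0 = 0 :> 'I_2); last exact: val_inj.
by rewrite /= expr0 expr1; ring.
Qed.

Lemma det3 (R : comNzRingType) (A : 'M[R]_3) :
  \det A = A 0 0 * (A 1 1 * A 2%:R 2%:R - A 1 2%:R * A 2%:R 1)
    - A 0 1 * (A 1 0 * A 2%:R 2%:R - A 1 2%:R * A 2%:R 0)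
    + A 0 2%:R * (A 1 0 * A 2%:R 1 - A 1 1 * A 2%:R 0).
Proof.
rewrite (expand_det_row _ 0) !big_ord_recl big_ord0 /cofactor !det2 !mxE /=.
have e10 : lift 0 0 = 1 :> 'I_3 by exact: val_inj.
have e20 : lift 0 1 = 2%:R :> 'I_3 by exact: val_inj.
have e3 : lift 0 (lift 0 0) = 2%:R :> 'I_3 by exact: val_inj.
have l10 : lift 1 0 = 0 :> 'I_3 by exact: val_inj.
have l11 : lift 1 1 = 2%:R :> 'I_3 by exact: val_inj.
have l20 : lift 2%:R 0 = 0 :> 'I_3 by exact: val_inj.
have l21 : lift 2%:R 1 = 1 :> 'I_3 by exact: val_inj.
by rewrite !(e3, e10, e20, l10, l11, l20, l21) /= !expr0 ?expr1 /bump /= ?expr2; ring.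
Qed.

(** * Index sets given by block counts *)

Section TopSets.
Variables (N : nat) (Ns : seq nat).
Hypothesis lev : levi_ok N Ns.

Definition topset (m : nat -> nat) : {set 'I_N} :=
  [set i : 'I_N | (bst Ns (blk Ns i).+1 <= i + m (blk Ns i))%N].

Lemma card_topset m k : (forall j, (j < size Ns)%N -> (m j <= nth 0 Ns j)%N) ->
  (k <= size Ns)%N ->
  #|[set i in topset m | (i < bst Ns k)%N]| = (\sum_(0 <= j < k) m j)%N.
Proof.
move=> mn; elim: k => [|k IH] kN.
  rewrite big_geq //; apply/eqP; rewrite cards_eq0; apply/eqP/setP => i.
  by rewrite !inE /bst take0 /= ltn0 andbF.
rewrite big_nat_recr //= -IH ?(ltnW kN) //.
rewrite -(cardsID [set i : 'I_N | (i < bst Ns k)%N]); congr (_ + _)%N.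
  apply: eq_card => i; rewrite !inE -andbA; congr (_ && _); apply: andb_idl => h.
  exact: leq_trans h (bst_mono _ (leqnSn k)).
have mk := mn k kN; have e1 : (bst Ns k.+1 - (bst Ns k.+1 - m k) = m k)%N.
  by have := bstS Ns k; lia.
rewrite -[RHS]e1 -(@card_interval N) ?bst_leN //; apply: eq_card => i; rewrite !inE.
apply/idP/idP => [/and3P[ik tb kb]|/andP[h1 h2]].
  rewrite -leqNgt in ik; have /eqP bi : blk Ns i == k by rewrite (blk_iff lev) // ik.
  by rewrite bi in tb; rewrite kb; lia.
have ki : (bst Ns k <= i)%N by have := bstS Ns k; lia.
have /eqP bi : blk Ns i == k by rewrite (blk_iff lev) // ki.
by rewrite -leqNgt ki h2 bi; lia.
Qed.

Lemma topset_Idn m e : (forall j, (j < size Ns)%N -> (m j <= nth 0 Ns j)%N) ->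
  (\sum_(0 <= j < size Ns) m j)%N = e -> exists I : Idn e N, img I = topset m.
Proof.
move=> mn me; apply: Idn_of_set; rewrite -me -card_topset //.
by apply: eq_card => i; rewrite [in RHS]inE bst_size // (sumNs_N lev) ltn_ord andbT.
Qed.

Lemma topset_block_top d (I : Idn d N) m : img I = topset m -> block_top Ns I.
Proof. by move=> iI i j; rewrite iI !inE => h ij b; rewrite -b; apply: leq_trans h _; rewrite leq_add2r. Qed.

(** Suppose [I] exceeds [w] at [a] and count up to the end of the block of [w a]. There [w] has
    [a + 1] elements up to [w a] and contains every later index, whereas [I] has at most [a]
    elements up to [w a]. This contradicts the prefix sums. *)
Lemma topset_le d (I w : Idn d N) m h : img I = topset m -> img w = topset h ->
  (forall j, (j < size Ns)%N -> (m j <= nth 0 Ns j)%N) ->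
  (forall j, (j < size Ns)%N -> (h j <= nth 0 Ns j)%N) ->
  (forall k, (k <= size Ns)%N -> (\sum_(0 <= j < k) h j <= \sum_(0 <= j < k) m j)%N) ->
  forall a, (val I a <= val w a)%N.
Proof.
move=> iI iw mn hn mh a; rewrite leqNgt; apply/negP => lt.
have [bN bi ib] : [/\ (blk Ns (val w a) < size Ns)%N, (bst Ns (blk Ns (val w a)) <= val w a)%N
    & (val w a < bst Ns (blk Ns (val w a)).+1)%N] by apply: blkP; rewrite (sumNs_N lev).
set k := blk Ns (val w a) in bN bi ib.
have := mh k.+1 bN; rewrite -!card_topset // -iI -iw.
have split_card (K : Idn d N) : #|[set i in img K | (i < bst Ns k.+1)%N]| =
    (#|[set c : 'I_d | (val K c <= val w a)%N]| +
     #|[set i in img K | (val w a < i < bst Ns k.+1)%N]|)%N.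
  rewrite -(cardsID [set i : 'I_N | (i <= val w a)%N]); congr (_ + _)%N.
    rewrite -(card_imset _ (@Idn_inj _ _ K)); apply: eq_card => i; rewrite !inE.
    apply/idP/imsetP => [/andP[/andP[/imsetP[c _ ->] _] h1]|[c]].
      by exists c => //; rewrite inE.
    by rewrite inE => h1 ->; rewrite mem_img h1 (leq_ltn_trans h1 ib).
  by apply: eq_card => i; rewrite !inE -ltnNge andbCA.
rewrite !split_card.
have -> : #|[set i in img w | (val w a < i < bst Ns k.+1)%N]| = (bst Ns k.+1 - (val w a).+1)%N.
  rewrite -(@card_interval N) ?bst_leN //; apply: eq_card => i; rewrite !inE.
  rewrite andb_idl // => /andP[h1 h2]; rewrite iw inE.
  have /eqP bi' : blk Ns i == k by rewrite (blk_iff lev) // h2 (leq_trans bi (ltnW h1)).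
  have := mem_img w a; rewrite iw inE -/k bi'; lia.
have : (#|[set i in img I | (val w a < i < bst Ns k.+1)%N]| <= bst Ns k.+1 - (val w a).+1)%N.
  rewrite -(@card_interval N) ?bst_leN //; apply: subset_leq_card.
  by apply/subsetP => i; rewrite !inE => /andP[].
have -> : #|[set c : 'I_d | (val w c <= val w a)%N]| = a.+1.
  rewrite -[RHS]subn0 -(@card_interval d) //; apply: eq_card => c.
  by rewrite !inE Idn_le.
have : (#|[set c : 'I_d | (val I c <= val w a)%N]| <= a)%N.
  rewrite -[X in (_ <= X)%N]subn0 -(@card_interval d) ?(ltnW (ltn_ord a)) //.
  apply: subset_leq_card; apply/subsetP => c; rewrite !inE /= => h1.
  by rewrite ltnNge -(Idn_le I) -ltnNge (leq_ltn_trans h1 lt).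
lia.
Qed.

End TopSets.

(** * Test points with prescribed small minors *)

Section Evaluation.
Variables (d N K e : nat) (I J : Idn d N) (bas : Idn e N).
Variables (x q : 'I_K -> 'I_N).

(** Columns are labelled by [J]: a label in the base gives a unit vector, and the label [q t] gives
    the column [v _ t]. Thus a K-dimensional configuration is embedded in a d-dimensional one. *)
Definition testmx (v : 'I_N -> 'I_K -> C) : 'M[C]_(N, d) :=
  \matrix_(i, a) if val J a \in img bas then (i == val J a)%:R
                 else \sum_t (val J a == q t)%:R * v i t.

Lemma testmx_shape (w : Idn d N) (v : 'I_N -> 'I_K -> C) :
  (forall a, (val J a <= val w a)%N) ->
  (forall (i : 'I_N) t, (q t < i)%N -> v i t = 0) -> in_shape w (testmx v).
Proof.
move=> Jw vt i a ai; have Ji := leq_ltn_trans (Jw a) ai; rewrite mxE.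
case: ifP => _; first by case: eqP => // e0; rewrite e0 ltnn in Ji.
apply: big1 => t _; case: eqP => [e0|]; last by rewrite mul0r.
by rewrite vt ?mulr0 // -e0.
Qed.

End Evaluation.

(* The base rows and columns form an identity block, so only the K x K minor
   on the extra rows and columns survives, up to the sign of the sorting. *)
Lemma testmx_minor d N K e (I J : Idn d N) (bas : Idn e N) (x q : 'I_K -> 'I_N) :
  d = (K + e)%N -> injective x -> injective q ->
  (forall t, x t \notin img bas) -> (forall t, q t \notin img bas) ->
  (forall t, x t \in img I) -> img bas \subset img I ->
  (forall t, q t \in img J) -> img bas \subset img J ->
  exists2 eps : C, eps != 0 &
  forall v : 'I_N -> 'I_K -> C, (forall i t, i \in img bas -> v i t = 0) ->
    pl (testmx J bas q v) I = eps * \det (\matrix_(t, s) v (x t) s).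
Proof.
move=> dE xI qI xb qb Ix Ib Jq Jb; subst d.
have fac (L : Idn (K + e) N) (y : 'I_K -> 'I_N) : injective y ->
    (forall t, y t \notin img bas) -> (forall t, y t \in img L) -> img bas \subset img L ->
    exists s : 'S_(K + e), (forall t, val L (s (lshift e t)) = y t) /\
      (forall b, val L (s (rshift K b)) = val bas b).
  move=> yI yb Ly Lb.
  pose f (a : 'I_(K + e)) := match split a with inl t => y t | inr b => val bas b end.
  have [|a|s fs] := @Idn_factor _ _ L f.
  - move=> a b; rewrite /f; case: (splitP a) => [t at_|c ac]; case: (splitP b) => [t' bt|c' bc].
    + by move=> /yI E; apply: val_inj; rewrite /= at_ bt E.
    + by move=> E; have := yb t; rewrite E mem_img.
    + by move=> E; have := yb t'; rewrite -E mem_img.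
    + by move=> /Idn_inj E; apply: val_inj; rewrite /= ac bc E.
  - rewrite /f; case: splitP => [t _|b _]; first exact: Ly.
    by apply: (subsetP Lb); exact: mem_img.
  exists s; split=> t; rewrite -fs /f.
    by rewrite -[lshift e t]/(unsplit (inl t)) unsplitK.
  by rewrite -[rshift K t]/(unsplit (inr t)) unsplitK.
have [s [sx sb]] := fac I x xI xb Ix Ib.
have [s' [sq sb']] := fac J q qI qb Jq Jb.
exists ((-1) ^+ s * (-1) ^+ s'); first by rewrite -signr_addb signr_eq0.
move=> v v0; pose A := \matrix_(a, b) testmx J bas q v (val I a) b.
have sgn2 (t : 'S_(K + e)) : (-1) ^+ t * (-1) ^+ t = 1 :> C by rewrite -expr2 sqrr_sign.
have dA : \det A = (-1) ^+ s * (-1) ^+ s' * \det (\matrix_(a, b) A (s a) (s' b)).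
  have -> : \matrix_(a, b) A (s a) (s' b) = perm_mx s *m A *m perm_mx s'^-1.
    by rewrite -row_permE -col_permE; apply/matrixP => a b; rewrite !mxE.
  rewrite !det_mulmx !det_perm odd_permV.
  by rewrite mulrACA sgn2 mulr1 mulrA sgn2 mul1r.
rewrite ffunE -/A dA; congr (_ * _).
have -> : (\matrix_(a, b) A (s a) (s' b)) =
    block_mx (\matrix_(t, u) v (x t) u) 0 0 (1%:M : 'M_e).
  apply/matrixP => a b; rewrite mxE [A _ _]mxE [testmx _ _ _ _ _ _]mxE.
  case: (splitP a) => [t at_|c ac]; case: (splitP b) => [t' bt|c' bc].
  - have -> : a = lshift e t by apply: val_inj.
    have -> : b = lshift e t' by apply: val_inj.
    rewrite block_mxEul mxE sx sq (negPf (qb t')) (bigD1 t') //= eqxx mul1r big1 ?addr0 //.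
    by move=> u nu; rewrite (inj_eq qI) eq_sym (negPf nu) mul0r.
  - have -> : a = lshift e t by apply: val_inj.
    have -> : b = rshift K c' by apply: val_inj.
    rewrite block_mxEur mxE sx sb' mem_img.
    by case: eqP => // E; have := xb t; rewrite E mem_img.
  - have -> : a = rshift K c by apply: val_inj.
    have -> : b = lshift e t' by apply: val_inj.
    rewrite block_mxEdl mxE sb sq (negPf (qb t')); apply: big1 => u _.
    by rewrite v0 ?mulr0 ?mem_img.
  - have -> : a = rshift K c by apply: val_inj.
    have -> : b = rshift K c' by apply: val_inj.
    by rewrite block_mxEdr mxE sb sb' mem_img (inj_eq (@Idn_inj _ _ bas)).
by rewrite det_ublock det1 mulr1.
Qed.

Lemma sum_indicator s k : (\sum_(0 <= j < k) (j == s) = (s < k))%N.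
Proof.
elim: k => [|k IH]; first by rewrite big_geq.
rewrite big_nat_recr //= IH; case: (ltngtP s k) => [sk|ks|->].
- by rewrite ltnS (ltnW sk).
- by rewrite ltnS leqNgt ks.
- by rewrite ltnSn.
Qed.

(** * Cross-ratio and triple-ratio obstructions *)

Section Obstructions.
Variables (d N : nat) (w : Idn d N) (Ns : seq nat).
Hypothesis lev : levi_ok N Ns.
Hypothesis st : stable w Ns.

Notation n k := (nth 0%N Ns k).
Notation h := (hh w Ns).
Notation top m := (topset N Ns m).

Lemma img_w : img w = top h.
Proof. by apply/setP => i; rewrite (mem_imgE lev st) inE /threshold leq_subLR addnC. Qed.

Lemma block_lt (i j : 'I_N) : (blk Ns i < blk Ns j)%N -> (i < j)%N.
Proof. by move=> b; rewrite ltnNge; apply/negP => /(@blk_mono Ns); rewrite leqNgt b. Qed.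

(** All index sets below share the last [c b] rows of each block [b] and differ only in two or three
    extra rows just above these. *)
Variable c : nat -> nat.

(* the t-th row above the c b bottom rows of block b *)
Lemma extra_row b t : (b < size Ns)%N -> (c b + t < n b)%N ->
  exists p : 'I_N, [/\ blk Ns p = b, (p + c b + t.+1 = bst Ns b.+1)%N &
    forall m, (p \in top m) = (c b + t < m b)%N].
Proof.
move=> bN ct; have e := bstS Ns b; have le := bst_leN lev b.+1.
have pN : (bst Ns b.+1 - (c b + t.+1) < N)%N by lia.
have pb : blk Ns (bst Ns b.+1 - (c b + t.+1))%N = b by apply: blkE => //; apply/andP; split; lia.
exists (Ordinal pN); split=> //=; first by lia.
by move=> m; rewrite inE /= pb; lia.
Qed.

Lemma testmx_minor_seq K e (I J : Idn d N) (bas : Idn e N) (p0 : 'I_N) (xs qs : seq 'I_N) :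
  d = (K + e)%N -> size xs = K -> size qs = K -> uniq xs -> uniq qs ->
  all (fun p => (p \notin img bas) && (p \in img I)) xs ->
  all (fun p => (p \notin img bas) && (p \in img J)) qs ->
  img bas \subset img I -> img bas \subset img J ->
  exists2 eps : C, eps != 0 &
  forall v : 'I_N -> 'I_K -> C, (forall i t, i \in img bas -> v i t = 0) ->
    pl (testmx J bas (fun t => nth p0 qs t) v) I =
    eps * \det (\matrix_(t, s) v (nth p0 xs t) s).
Proof.
move=> dE sx sq ux uq /allP ax /allP aq bI bJ.
have inj (ys : seq 'I_N) : size ys = K -> uniq ys -> injective (fun t : 'I_K => nth p0 ys t).
  by move=> sy uy s t /eqP; rewrite nth_uniq ?sy // => /eqP/val_inj.
apply: testmx_minor => //; try exact: inj.
- by move=> t; have /andP[] := ax _ (@mem_nth _ p0 xs t ltac:(by rewrite sx)).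
- by move=> t; have /andP[] := aq _ (@mem_nth _ p0 qs t ltac:(by rewrite sq)).
- by move=> t; have /andP[] := ax _ (@mem_nth _ p0 xs t ltac:(by rewrite sx)).
- by move=> t; have /andP[] := aq _ (@mem_nth _ p0 qs t ltac:(by rewrite sq)).
Qed.

Hypothesis cn : forall b, (b < size Ns)%N -> (c b <= n b)%N.

Lemma base_sub I m : img I = top m -> (forall b, (c b <= m b)%N) ->
  forall (e : nat) (bas : Idn e N), img bas = top c -> img bas \subset img (I : Idn d N).
Proof.
move=> -> cm e bas ->; apply/subsetP => i; rewrite !inE => H.
by apply: leq_trans H _; rewrite leq_add2l.
Qed.

(* For four blocks i < j < k < l, the products p_ik p_jl and
   p_il p_jk have the same weight and are not proportional. *)
Theorem four_blocks i j k l : (i < j)%N -> (j < k)%N -> (k < l)%N -> (l < size Ns)%N ->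
  (c i < n i)%N -> (c j < n j)%N -> (c k < n k)%N -> (c l < n l)%N ->
  (\sum_(0 <= b < size Ns) c b + 2 = d)%N ->
  (forall b, (b <= size Ns)%N ->
    (\sum_(0 <= a < b) h a <= \sum_(0 <= a < b) c a + (k < b) + (l < b))%N) ->
  ~ mult_free w Ns.
Proof.
move=> ij jk kl lN ci cj' ck cl sc ps.
have kN := ltn_trans kl lN; have jN := ltn_trans jk kN; have iN := ltn_trans ij jN.
have [pi [bi _ Mi]] := @extra_row i 0 iN ltac:(by rewrite addn0).
have [pj [bj _ Mj]] := @extra_row j 0 jN ltac:(by rewrite addn0).
have [pk [bk _ Mk]] := @extra_row k 0 kN ltac:(by rewrite addn0).
have [pl' [bl _ Ml]] := @extra_row l 0 lN ltac:(by rewrite addn0).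
pose m s t b := (c b + (b == s) + (b == t))%N.
have msum s t b : (\sum_(0 <= a < b) m s t a = \sum_(0 <= a < b) c a + (s < b) + (t < b))%N.
  by rewrite !big_split /= !sum_indicator.
have mI s t : s != t -> (s < size Ns)%N -> (t < size Ns)%N -> (c s < n s)%N -> (c t < n t)%N ->
    exists I : Idn d N, img I = top (m s t).
  move=> nst sN tN cs ct; apply: topset_Idn => //.
    move=> b bN; rewrite /m; have := cn bN.
    have [->|] := eqVneq b s; first by rewrite (negPf nst); lia.
    by have [->|] := eqVneq b t; lia.
  by rewrite msum sN tN; lia.
have [Iik eik] := mI i k ltac:(lia) iN kN ci ck.
have [Ijl ejl] := mI j l ltac:(lia) jN lN cj' cl.
have [Iil eil] := mI i l ltac:(lia) iN lN ci cl.
have [Ijk ejk] := mI j k ltac:(lia) jN kN cj' ck.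
(* [J] labels the columns of the test matrices. Its extra rows lie in the last two blocks, and the
   hypothesis on prefix sums is what puts it below [w]. *)
have [J eJ] := mI k l ltac:(lia) kN lN ck cl.
have [bas ebas] := @topset_Idn N Ns lev c _ cn erefl.
have Jw : forall a, (val J a <= val w a)%N.
  apply: (@topset_le N Ns lev d J w (m k l) h eJ img_w).
  - move=> b bN; rewrite /m; have := cn bN.
    have [->|] := eqVneq b k; first by rewrite (_ : (k == l) = false); lia.
    by have [->|] := eqVneq b l; lia.
  - by move=> b _; apply: hh_le.
  - by move=> b bN; rewrite msum; apply: ps.
have pos (a b : 'I_N) : (blk Ns a < blk Ns b)%N -> (a == b = false) * (b == a = false).
  by move=> /block_lt lt; split; apply/eqP => E; rewrite E ltnn in lt.
have nij := pos pi pj ltac:(by rewrite bi bj).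
have njk := pos pj pk ltac:(by rewrite bj bk).
have nkl := pos pk pl' ltac:(by rewrite bk bl).
have nik := pos pi pk ltac:(by rewrite bi bk; lia).
have njl := pos pj pl' ltac:(by rewrite bj bl; lia).
have nil := pos pi pl' ltac:(by rewrite bi bl; lia).
(* Four points (1,1), (s,1), (0,1), (1,0) of a projective line with variable cross-ratio. The
   columns belong to [pl'] and [pk] in this order, so the zero of [pl'] in the second column is
   forced by the shape. *)
pose v (s : C) (y : 'I_N) (t : 'I_2) : C :=
  nth 0 (if y == pi then [:: 1; 1] else if y == pj then [:: s; 1]
         else if y == pk then [:: 0; 1] else if y == pl' then [:: 1; 0] else [::]) t.
have notbas p : p \in [:: pi; pj; pk; pl'] -> p \notin img bas.
  rewrite ebas !in_cons orbF => /or4P[]/eqP->; by rewrite ?Mi ?Mj ?Mk ?Ml addn0 ltnn.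
have v0 s y t : y \in img bas -> v s y t = 0.
  move=> yb; rewrite /v; have nb p : p \in [:: pi; pj; pk; pl'] -> (y == p) = false.
    by move=> /notbas nb; apply/eqP => E; rewrite -E yb in nb.
  by rewrite !nb ?inE ?eqxx ?orbT // nth_nil.
have minor2 I a b pa pb : img I = top (m a b) -> pa \in [:: pi; pj; pk; pl'] ->
    pb \in [:: pi; pj; pk; pl'] -> (pa == pb) = false -> pa \in top (m a b) -> pb \in top (m a b) ->
    exists2 eps : C, eps != 0 & forall s,
      pl (testmx J bas (fun t : 'I_2 => nth pi [:: pl'; pk] t) (v s)) I =
      eps * (v s pa 0 * v s pb 1 - v s pa 1 * v s pb 0).
  move=> eI pa4 pb4 nab paI pbI.
  have [|||||||||eps e0 He] := @testmx_minor_seq 2 _ I J bas pi [:: pa; pb] [:: pl'; pk].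
  - by rewrite -sc addnC.
  - by [].
  - by [].
  - by rewrite /= inE nab.
  - by rewrite /= inE nkl.
  - by rewrite /= !notbas //= eI paI pbI.
  - rewrite /= !notbas ?inE ?eqxx ?orbT //= eJ Mk Ml /m !eqxx; apply/and3P; split=> //; lia.
  - by apply: (base_sub eI) ebas => x; rewrite /m; lia.
  - by apply: (base_sub eJ) ebas => x; rewrite /m; lia.
  exists eps => // s; rewrite He; last by move=> y t; apply: v0.
  by rewrite det2 !mxE.
have [e1 e10 E1] := minor2 Iik i k pi pk eik ltac:(by rewrite !inE eqxx) ltac:(by rewrite !inE eqxx ?orbT) nik.1
   ltac:(by rewrite Mi /m eqxx; lia) ltac:(by rewrite Mk /m eqxx; lia).
have [e2 e20 E2] := minor2 Ijl j l pj pl' ejl ltac:(by rewrite !inE eqxx ?orbT) ltac:(by rewrite !inE eqxx ?orbT) njl.1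
   ltac:(by rewrite Mj /m eqxx; lia) ltac:(by rewrite Ml /m eqxx; lia).
have [e3 e30 E3] := minor2 Iil i l pi pl' eil ltac:(by rewrite !inE eqxx ?orbT) ltac:(by rewrite !inE eqxx ?orbT) nil.1
   ltac:(by rewrite Mi /m eqxx; lia) ltac:(by rewrite Ml /m eqxx; lia).
have [e4 e40 E4] := minor2 Ijk j k pj pk ejk ltac:(by rewrite !inE eqxx ?orbT) ltac:(by rewrite !inE eqxx ?orbT) njk.1
   ltac:(by rewrite Mj /m eqxx; lia) ltac:(by rewrite Mk /m eqxx; lia).
pose x s := pl (testmx J bas (fun t : 'I_2 => nth pi [:: pl'; pk] t) (v s)).
have vi s t : v s pi t = nth 0 [:: 1; 1] t by rewrite /v eqxx.
have vj s t : v s pj t = nth 0 [:: s; 1] t by rewrite /v nij eqxx.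
have vk s t : v s pk t = nth 0 [:: 0; 1] t by rewrite /v nik njk eqxx.
have vl s t : v s pl' t = nth 0 [:: 1; 0] t by rewrite /v nil njl nkl eqxx.
have F1 s : x s Iik = e1 by rewrite E1 !vi !vk /=; ring.
have F2 s : x s Ijl = - e2 by rewrite E2 !vj !vl /=; ring.
have F3 s : x s Iil = - e3 by rewrite E3 !vi !vl /=; ring.
have F4 s : x s Ijk = s * e4 by rewrite E4 !vj !vk /=; ring.
have xX s : inXhat w (x s).
  rewrite /x; apply: in_shape_Xhat.
  apply: (@testmx_shape d N 2 _ J bas (fun t : 'I_2 => nth pi [:: pl'; pk] t) w (v s) Jw) => y t qy.
  rewrite /v.
  have lt (p : 'I_N) t' : (blk Ns p < blk Ns (nth pi [:: pl'; pk] t'))%N -> (nth pi [:: pl'; pk] t' < y)%N -> (y == p) = false.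
    by move=> /block_lt l1 l2; apply/eqP => E; rewrite E in l2; lia.
  case: t qy => [[|[|//]] tH] /= qy.
    rewrite (lt pi 0%N) ?(lt pj 0%N) ?(lt pk 0%N) //= ?bi ?bj ?bk ?bl; try lia.
    by case: eqP => // E; rewrite E ltnn in qy.
  rewrite (lt pi 1%N) ?(lt pj 1%N) //= ?bi ?bj ?bk ?bl; try lia.
  case: eqP => [E|_]; first by rewrite E ltnn in qy.
  by case: ifP.
pose I1 : {ffun 'I_2 -> Idn d N} := [ffun t : 'I_2 => if t == 0 then Iik else Ijl].
pose I2 : {ffun 'I_2 -> Idn d N} := [ffun t : 'I_2 => if t == 0 then Iil else Ijk].
have two0 : (2%:R : C) != 0 by rewrite natrC_eq0.
clearbody x.
(* Among the four coordinates only [Ijk] depends on [s], linearly, so the nonzero values s = 1 and s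
   = 2 separate the two products. *)
apply: (@not_mult_free_of_products d N 2 w Ns st I1 I2 (x 1) (x 2%:R)) => //.
- by move=> t; rewrite ffunE; case: ifP => _; [apply: topset_block_top eik|apply: topset_block_top ejl].
- by move=> t; rewrite ffunE; case: ifP => _; [apply: topset_block_top eil|apply: topset_block_top ejk].
- move=> y; rewrite /mult !big_ord_recl !big_ord0 !ffunE /= eik ejl eil ejk !inE /m.
  set b := blk Ns y.
  have [->|nbi] := eqVneq b i.
    by rewrite (ltn_eqF ij) (ltn_eqF (ltn_trans ij jk)) (ltn_eqF (ltn_trans ij (ltn_trans jk kl))).
  have [->|nbj] := eqVneq b j; first by rewrite (ltn_eqF jk) (ltn_eqF (ltn_trans jk kl)).
  by rewrite !addn0 addnC.
- rewrite !big_ord_recl !big_ord0 !ffunE /= !F1 !F2 !F3 !F4.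
  move/eqP; rewrite -subr_eq0.
  have -> : e1 * (- e2 * 1) * (- e3 * (2%:R * e4 * 1)) - e1 * (- e2 * 1) * (- e3 * (1 * e4 * 1)) = e1 * e2 * e3 * e4 by ring.
  by rewrite !mulf_eq0 (negPf e10) (negPf e20) (negPf e30) (negPf e40).
- rewrite !big_ord_recl !big_ord0 !ffunE /= !F1 !F2; apply/eqP.
  by rewrite mulr1 mulf_neq0 // oppr_eq0.
- rewrite !big_ord_recl !big_ord0 !ffunE /= !F3 !F4; apply/eqP.
  by rewrite mulr1 mulf_neq0 ?oppr_eq0 ?mulf_neq0.
Qed.

(* For three blocks i < j < k, the products of type (2,1,0)(1,0,2)(0,2,1) and
   (2,0,1)(1,2,0)(0,1,2) have the same weight and are not proportional. *)
Theorem three_blocks i j k : (i < j)%N -> (j < k)%N -> (k < size Ns)%N ->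
  (c i + 2 <= n i)%N -> (c j + 2 <= n j)%N -> (c k + 2 <= n k)%N ->
  (\sum_(0 <= b < size Ns) c b + 3 = d)%N ->
  (forall b, (b <= size Ns)%N ->
    (\sum_(0 <= a < b) h a <= \sum_(0 <= a < b) c a + (j < b) + 2 * (k < b))%N) ->
  ~ mult_free w Ns.
Proof.
move=> ij jk kN ci cj' ck sc ps.
have jN := ltn_trans jk kN; have iN := ltn_trans ij jN.
have [a1 [ba1 ea1 Ma1]] := @extra_row i 0 iN ltac:(lia).
have [a2 [ba2 ea2 Ma2]] := @extra_row i 1 iN ltac:(lia).
have [b1 [bb1 eb1 Mb1]] := @extra_row j 0 jN ltac:(lia).
have [b2 [bb2 eb2 Mb2]] := @extra_row j 1 jN ltac:(lia).
have [c1 [bc1 ec1 Mc1]] := @extra_row k 0 kN ltac:(lia).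
have [c2 [bc2 ec2 Mc2]] := @extra_row k 1 kN ltac:(lia).
have l1 : (a2 < a1)%N by lia.
have l2 : (a1 < b2)%N by apply: block_lt; rewrite ba1 bb2.
have l3 : (b2 < b1)%N by lia.
have l4 : (b1 < c2)%N by apply: block_lt; rewrite bb1 bc2.
have l5 : (c2 < c1)%N by lia.
pose rows := [:: a2; a1; b2; b1; c2; c1].
have neq (p q : 'I_N) : (p < q)%N -> (p == q = false) * (q == p = false).
  by move=> lt; split; apply/eqP => E; rewrite E ltnn in lt.
pose m x y z b := (c b + x * (b == i) + y * (b == j) + z * (b == k))%N.
have msum x y z b : (\sum_(0 <= a < b) m x y z a =
    \sum_(0 <= a < b) c a + x * (i < b) + y * (j < b) + z * (k < b))%N.
  by rewrite !big_split /= -!big_distrr /= !sum_indicator.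
have mE x y z : (m x y z i = c i + x) * (m x y z j = c j + y) * (m x y z k = c k + z).
  by rewrite /m !eqxx (gtn_eqF ij) (ltn_eqF ij) (gtn_eqF jk) (ltn_eqF jk)
     (gtn_eqF (ltn_trans ij jk)) (ltn_eqF (ltn_trans ij jk)); do !split; lia.
have mn x y z : (x <= 2)%N -> (y <= 2)%N -> (z <= 2)%N ->
    forall b, (b < size Ns)%N -> (m x y z b <= n b)%N.
  move=> x2 y2 z2 b bN; have := cn bN; have [->|ni] := eqVneq b i; first by rewrite mE; lia.
  have [->|nj] := eqVneq b j; first by rewrite mE; lia.
  have [->|nk] := eqVneq b k; first by rewrite mE; lia.
  by rewrite /m (negPf ni) (negPf nj) (negPf nk); lia.
have mI x y z : (x <= 2)%N -> (y <= 2)%N -> (z <= 2)%N -> (x + y + z = 3)%N ->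
    exists I : Idn d N, img I = top (m x y z).
  move=> x2 y2 z2 s3; apply: topset_Idn => //; first exact: mn.
  by rewrite msum kN jN iN; lia.
have [I210 e210] := mI 2 1 0 isT isT isT erefl.
have [I102 e102] := mI 1 0 2 isT isT isT erefl.
have [I021 e021] := mI 0 2 1 isT isT isT erefl.
have [I201 e201] := mI 2 0 1 isT isT isT erefl.
have [I120 e120] := mI 1 2 0 isT isT isT erefl.
have [J eJ] := mI 0 1 2 isT isT isT erefl.
have [bas ebas] := @topset_Idn N Ns lev c _ cn erefl.
have Jw : forall a, (val J a <= val w a)%N.
  apply: (@topset_le N Ns lev d J w (m 0 1 2) h eJ img_w).
  - exact: mn.
  - by move=> b _; apply: hh_le.
  - by move=> b bN; rewrite msum; have := ps b bN; lia.
(* Each block contributes a flag in 3-space: a vector (rows [a1], [b1], [c1]) and a plane containing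
   it. The two products form the triple ratio of the three flags; with this choice only [I201], the
   minor on [a1], [a2], [c1], depends on [s]. *)
pose v (s : C) (y : 'I_N) (t : 'I_3) : C :=
  nth 0 (if y == a1 then [:: 1; 1; 0] else if y == a2 then [:: s; 0; 1]
         else if y == b1 then [:: 1; 0; 0] else if y == b2 then [:: 0; 1; 1]
         else if y == c1 then [:: 0; 0; 1] else if y == c2 then [:: 0; 1; 0] else [::]) t.
have n12 := neq _ _ l1; have n13 := neq _ _ l2; have n34 := neq _ _ l3.
have n45 := neq _ _ l4; have n56 := neq _ _ l5.
have n2b2 := neq _ _ (ltn_trans l1 l2); have n1b1 := neq _ _ (ltn_trans l2 l3).
have n2b1 := neq _ _ (ltn_trans l1 (ltn_trans l2 l3)).
have b2c2 := neq _ _ (ltn_trans l3 l4); have b1c1 := neq _ _ (ltn_trans l4 l5).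
have b2c1 := neq _ _ (ltn_trans l3 (ltn_trans l4 l5)).
have a1c2 := neq _ _ (ltn_trans l2 (ltn_trans l3 l4)).
have a1c1 := neq _ _ (ltn_trans (ltn_trans l2 (ltn_trans l3 l4)) l5).
have a2c2 := neq _ _ (ltn_trans l1 (ltn_trans l2 (ltn_trans l3 l4))).
have a2c1 := neq _ _ (ltn_trans l1 (ltn_trans (ltn_trans l2 (ltn_trans l3 l4)) l5)).
have va1 s t : v s a1 t = nth 0 [:: 1; 1; 0] t by rewrite /v eqxx.
have va2 s t : v s a2 t = nth 0 [:: s; 0; 1] t by rewrite /v n12 eqxx.
have vb1 s t : v s b1 t = nth 0 [:: 1; 0; 0] t by rewrite /v n1b1 n2b1 eqxx.
have vb2 s t : v s b2 t = nth 0 [:: 0; 1; 1] t by rewrite /v n13 n2b2 n34 eqxx.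
have vc1 s t : v s c1 t = nth 0 [:: 0; 0; 1] t by rewrite /v a1c1 a2c1 b1c1 b2c1 eqxx.
have vc2 s t : v s c2 t = nth 0 [:: 0; 1; 0] t.
  by rewrite /v a1c2 a2c2 n45 b2c2 n56 eqxx.
have notbas p : p \in rows -> p \notin img bas.
  rewrite ebas /rows !in_cons orbF => H.
  by do 5?[case/orP: H => [/eqP->|H]; first by rewrite ?(Ma1, Ma2, Mb1, Mb2, Mc1, Mc2); lia];
     rewrite (eqP H) Mc1; lia.
have v0 s y t : y \in img bas -> v s y t = 0.
  move=> yb; rewrite /v; have nb p : p \in rows -> (y == p) = false.
    by move=> /notbas nb; apply/eqP => E; rewrite -E yb in nb.
  by rewrite !nb ?inE ?eqxx ?orbT // nth_nil.
pose q := [:: b1; c2; c1].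
have minor3 I x y z xs : img I = top (m x y z) -> size xs = 3 -> uniq xs ->
    {subset xs <= rows} -> all (mem (top (m x y z))) xs ->
    exists2 eps : C, eps != 0 & forall s,
      pl (testmx J bas (fun t : 'I_3 => nth a1 q t) (v s)) I =
      eps * \det (\matrix_(t < 3, u < 3) v s (nth a1 xs t) u).
  move=> eI sx ux /= sub mem.
  have [|||||||||eps e0 He] := @testmx_minor_seq 3 _ I J bas a1 xs q.
  - by rewrite -sc addnC.
  - by [].
  - by [].
  - by [].
  - by rewrite /= !inE n45 b1c1 n56.
  - by apply/allP => p px; rewrite notbas ?sub //= eI; exact: (allP mem _ px).
  - rewrite /= !notbas ?inE ?eqxx ?orbT //= eJ Mb1 Mc1 Mc2 !mE; apply/and3P; split=> //; lia.
  - by apply: (base_sub eI) ebas => b; rewrite /m; lia.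
  - by apply: (base_sub eJ) ebas => b; rewrite /m; lia.
  by exists eps => // s; rewrite He // => y' t; apply: v0.
have inrows xs : all (mem rows) xs -> {subset xs <= rows} by move/allP.
have [e1 e10 E1] := minor3 I210 _ _ _ [:: a1; a2; b1] e210 erefl
   ltac:(by rewrite /= !inE n12 n1b1 n2b1) ltac:(by apply: inrows; rewrite /= !inE !eqxx !orbT)
   ltac:(rewrite /= Ma1 Ma2 Mb1 !mE; apply/and4P; split=> //; lia).
have [e2 e20 E2] := minor3 I102 _ _ _ [:: a1; c1; c2] e102 erefl
   ltac:(by rewrite /= !inE a1c1 a1c2 n56) ltac:(by apply: inrows; rewrite /= !inE !eqxx !orbT)
   ltac:(rewrite /= Ma1 Mc1 Mc2 !mE; apply/and4P; split=> //; lia).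
have [e3 e30 E3] := minor3 I021 _ _ _ [:: b1; b2; c1] e021 erefl
   ltac:(by rewrite /= !inE n34 b1c1 b2c1) ltac:(by apply: inrows; rewrite /= !inE !eqxx !orbT)
   ltac:(rewrite /= Mb1 Mb2 Mc1 !mE; apply/and4P; split=> //; lia).
have [e4 e40 E4] := minor3 I201 _ _ _ [:: a1; a2; c1] e201 erefl
   ltac:(by rewrite /= !inE n12 a1c1 a2c1) ltac:(by apply: inrows; rewrite /= !inE !eqxx !orbT)
   ltac:(rewrite /= Ma1 Ma2 Mc1 !mE; apply/and4P; split=> //; lia).
have [e5 e50 E5] := minor3 I120 _ _ _ [:: a1; b1; b2] e120 erefl
   ltac:(by rewrite /= !inE n1b1 n13 n34) ltac:(by apply: inrows; rewrite /= !inE !eqxx !orbT)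
   ltac:(rewrite /= Ma1 Mb1 Mb2 !mE; apply/and4P; split=> //; lia).
have [e6 e60 E6] := minor3 J _ _ _ [:: b1; c1; c2] eJ erefl
   ltac:(by rewrite /= !inE b1c1 n45 n56) ltac:(by apply: inrows; rewrite /= !inE !eqxx !orbT)
   ltac:(rewrite /= Mb1 Mc1 Mc2 !mE; apply/and4P; split=> //; lia).
pose x s := pl (testmx J bas (fun t : 'I_3 => nth a1 q t) (v s)).
pose vE := (va1, va2, vb1, vb2, vc1, vc2).
have F1 s : x s I210 = e1 by rewrite E1 det3 !mxE /= !vE /=; ring.
have F2 s : x s I102 = - e2 by rewrite E2 det3 !mxE /= !vE /=; ring.
have F3 s : x s I021 = e3 by rewrite E3 det3 !mxE /= !vE /=; ring.
have F4 s : x s I201 = - (s * e4) by rewrite E4 det3 !mxE /= !vE /=; ring.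
have F5 s : x s I120 = - e5 by rewrite E5 det3 !mxE /= !vE /=; ring.
have F6 s : x s J = - e6 by rewrite E6 det3 !mxE /= !vE /=; ring.
have xX s : inXhat w (x s).
  rewrite /x; apply: in_shape_Xhat.
  apply: (@testmx_shape d N 3 _ J bas (fun t : 'I_3 => nth a1 q t) w (v s) Jw) => y t qy.
  have lt (p : 'I_N) : (p <= nth a1 q t)%N -> (y == p) = false.
    by move=> le; apply/eqP => E; rewrite E ltnNge le in qy.
  clear -lt l1 l2 l3 l4 l5 qy; rewrite /v; case: t qy lt => [[|[|[|//]]] tH] /= qy lt.
  - rewrite (lt a1) ?(lt a2) ?(lt b1) ?(lt b2); try lia.
    by case: ifP => _ //; case: ifP.
  - rewrite (lt a1) ?(lt a2) ?(lt b1) ?(lt b2) ?(lt c2); try lia.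
    by case: ifP.
  - by rewrite (lt a1) ?(lt a2) ?(lt b1) ?(lt b2) ?(lt c1) ?(lt c2); try lia.
pose I1 : {ffun 'I_3 -> Idn d N} :=
  [ffun t : 'I_3 => if t == 0 then I210 else if t == 1 then I102 else I021].
pose I2 : {ffun 'I_3 -> Idn d N} :=
  [ffun t : 'I_3 => if t == 0 then I201 else if t == 1 then I120 else J].
have two0 : (2%:R : C) != 0 by rewrite natrC_eq0.
clearbody x.
apply: (@not_mult_free_of_products d N 3 w Ns st I1 I2 (x 1) (x 2%:R)) => //.
- move=> t; rewrite ffunE; case: ifP => _; first exact: topset_block_top e210.
  by case: ifP => _; [apply: topset_block_top e102|apply: topset_block_top e021].
- move=> t; rewrite ffunE; case: ifP => _; first exact: topset_block_top e201.
  by case: ifP => _; [apply: topset_block_top e120|apply: topset_block_top eJ].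
- move=> y; rewrite /mult !big_ord_recl !big_ord0 !ffunE /= e210 e102 e021 e201 e120 eJ !inE.
  set b := blk Ns y.
  have [->|nbi] := eqVneq b i; first by rewrite !mE.
  have [->|nbj] := eqVneq b j; first by rewrite !mE !addn0 addnC -addnA.
  have [->|nbk] := eqVneq b k; first by rewrite !mE !addn0 addnA addnC.
  by rewrite /m (negPf nbi) (negPf nbj) (negPf nbk) !muln0.
- rewrite !big_ord_recl !big_ord0 !ffunE /= !F1 !F2 !F3 !F4 !F5 !F6.
  move/eqP; rewrite -subr_eq0.
  set D := (X in X == 0); have -> : D = e1 * e2 * e3 * e4 * e5 * e6 by rewrite /D; ring.
  by rewrite !mulf_eq0 (negPf e10) (negPf e20) (negPf e30) (negPf e40) (negPf e50) (negPf e60).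
- rewrite !big_ord_recl !big_ord0 !ffunE /= !F1 !F2 !F3; apply/eqP.
  by rewrite mulr1 !mulf_neq0 // oppr_eq0.
- rewrite !big_ord_recl !big_ord0 !ffunE /= !F4 !F5 !F6; apply/eqP.
  by rewrite mulr1 !mulf_neq0 ?oppr_eq0 ?mulf_neq0.
Qed.

End Obstructions.


Local Close Scope ring_scope.

(** * The classification *)

(** The default [s + l] is the first index after the searched range, so one minimality statement
    covers both outcomes of the search. *)
Lemma head_filter_iota (P : pred nat) s l (r := head (s + l)%N [seq p <- iota s l | P p]) :
  [/\ (s <= r <= s + l)%N, (r < s + l)%N -> P r & forall q, (s <= q < r)%N -> ~~ P q].
Proof.
rewrite {}/r; elim: l s => [|l IH] s /=.
  by rewrite addn0 leqnn; split=> // q; lia.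
case: ifPn => [Ps|nPs] /=; first by split=> // [|q]; lia.
rewrite addnS -addSn; have [/andP[h1 h2] h3 h4] := IH s.+1.
split=> //; first by rewrite h2 andbT ltnW.
move=> q /andP[sq qr]; have [->//|nq] := eqVneq q s.
by apply: h4; rewrite qr andbT ltn_neqAle eq_sym nq.
Qed.

Lemma leq_sum_nat (F : nat -> nat) m n j : (m <= j < n)%N ->
  (F j <= \sum_(m <= k < n) F k)%N.
Proof.
by move=> h; rewrite (bigD1_seq j) ?mem_index_iota ?iota_uniq //= leq_addr.
Qed.

(** Base counts for [four_blocks]: [u] rows of [w] move from block 1 to block 0, and [al] and [be]
    rows are released in blocks [k] and [L]. The identity for prefix sums serves both the size
    condition and the comparison with [w]. *)
Lemma shifted_sums (h : nat -> nat) u k al L be :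
  (1 < k)%N -> (k < L)%N -> (u <= h 1)%N -> (al <= h k)%N -> (be <= h L)%N ->
  exists c, [/\ [/\ c 0 = h 0 + u, c 1 + u = h 1, c k + al = h k & c L + be = h L]%N,
    (forall t, t != 0 -> t != 1 -> t != k -> t != L -> c t = h t)%N &
    forall m, (\sum_(0 <= t < m) c t + u * (1 < m) + al * (k < m) + be * (L < m) =
               \sum_(0 <= t < m) h t + u * (0 < m))%N].
Proof.
move=> k1 kL uh alh beh.
have k0 := ltn_trans (ltn0Sn 0) k1; have L1 := ltn_trans k1 kL; have L0 := ltn_trans k0 kL.
pose c t := (if t == 0 then h 0 + u else if t == 1 then h 1 - u
             else if t == k then h k - al else if t == L then h L - be else h t)%N.
have c0 : (c 0 = h 0 + u)%N by [].
have c1 : (c 1 + u = h 1)%N by rewrite /c /= subnK.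
have ck : (c k + al = h k)%N by rewrite /c (gtn_eqF k0) (gtn_eqF k1) eqxx subnK.
have cL : (c L + be = h L)%N.
  by rewrite /c (gtn_eqF L0) (gtn_eqF L1) (gtn_eqF kL) eqxx subnK.
have ct t : t != 0 -> t != 1 -> t != k -> t != L -> c t = h t.
  by move=> /negPf n0 /negPf n1 /negPf nk /negPf nL; rewrite /c n0 n1 nk nL.
exists c; split=> // m.
rewrite -(sum_indicator 0) -(sum_indicator 1) -(sum_indicator k) -(sum_indicator L).
rewrite !big_distrr -!big_split /=; apply: eq_bigr => t _.
have [->|n0] := eqVneq t 0%N; first by rewrite !(ltn_eqF k0, ltn_eqF L0) !muln0 !addn0 c0 muln1.
have [->|n1] := eqVneq t 1%N; first by rewrite !(ltn_eqF k1, ltn_eqF L1) !muln0 !addn0 muln1.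
have [->|nk] := eqVneq t k; first by rewrite (ltn_eqF kL) !muln0 !addn0 muln1.
have [->|nL] := eqVneq t L; first by rewrite !muln0 !addn0 muln1.
by rewrite !muln0 !addn0 ct.
Qed.

Section Classification.
Variables (d N : nat) (w : Idn d N) (Ns : seq nat).
Hypotheses (d0 : (1 <= d)%N) (dN : (d < N)%N) (lev : levi_ok N Ns).
Hypotheses (st : stable w Ns) (red : reduced w).

Notation n k := (nth 0%N Ns k).
Notation h := (hh w Ns).
Notation b := (size Ns).

Lemma n_gt0 k : (k < b)%N -> (0 < n k)%N.
Proof. by case: lev => _ /allP H kb; apply: H; apply: mem_nth. Qed.

Lemma b_gt0 : (0 < b)%N.
Proof. by case: lev dN => + _; case: Ns => //= <-; rewrite ltn0. Qed.

Lemma h_le k : (h k <= n k)%N. Proof. exact: hh_le. Qed.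

Lemma thrE k : (threshold w Ns k = bst Ns k + (n k - h k))%N.
Proof. by have := h_le k; rewrite /threshold bstS; lia. Qed.

(** As [w] is increasing, its first entry differing from index 0 excludes index 0 altogether, so
    block 0 has a slack row. *)
Lemma h_first : (h 0 < n 0)%N.
Proof.
have N0 : (0 < N)%N by apply: leq_ltn_trans dN.
have bl : blk Ns 0 = 0%N.
  by apply: blkE; rewrite ?b_gt0 // bstS /bst take0 /= n_gt0 // b_gt0.
have : Ordinal N0 \notin img w.
  apply/imsetP => -[a _ e]; have [R _] := red.
  have d0' : (0 < d)%N by [].
  apply: (R (Ordinal d0')) => //; apply/eqP; rewrite -leqn0.
  rewrite -[X in (_ <= X)%N]/(val (Ordinal N0)) e.
  by have := Idn_le w (Ordinal d0') a; rewrite leq0n.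
rewrite (mem_imgE lev st) /= bl thrE /bst take0 /= -ltnNge; lia.
Qed.

Lemma h_last : (0 < h b.-1)%N.
Proof.
have dl : (d.-1 < d)%N by rewrite prednK.
have [_ /(_ (Ordinal dl) erefl) e] := red.
have : val w (Ordinal dl) \in img w by apply: mem_img.
have b0 := b_gt0.
have bN : bst Ns b = N by rewrite bst_size // (sumNs_N lev).
have nl : (0 < n b.-1)%N by apply: n_gt0; rewrite prednK.
have e1 := bstS Ns b.-1; rewrite (prednK b0) bN in e1.
have bl : blk Ns (val w (Ordinal dl)) = b.-1.
  apply: blkE; rewrite ?prednK // bN.
  by move: e => /= ->; apply/andP; split; lia.
rewrite (mem_imgE lev st) bl thrE.
have -> : (val w (Ordinal dl) = N.-1 :> nat) by [].
by have := h_le b.-1; lia.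
Qed.

Lemma edge_blocks i a : block_edge w Ns i a ->
  [/\ (blk Ns i < blk Ns (val w a))%N, (blk Ns (val w a) < b)%N,
      (h (blk Ns i) < n (blk Ns i))%N & (0 < h (blk Ns (val w a)))%N].
Proof.
case/andP => ni lt; have := slack_rowP lev st ni; have := img_colP lev st a.
have [-> _ _] : [/\ (blk Ns (val w a) < b)%N, (bst Ns (blk Ns (val w a)) <= val w a)%N
    & (val w a < bst Ns (blk Ns (val w a)).+1)%N] by apply: blkP; rewrite (sumNs_N lev).
rewrite !thrE bstS => h1 h2; split=> //; lia.
Qed.

Lemma mult_free_of_pattern : (exists Pf, reduces_to w Ns Pf) -> mult_free w Ns.
Proof.
move=> [Pf /reduces_generates [gen sh]].
exact: (mult_free_of_generates st d0 sh gen).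
Qed.

Lemma mf_row k0 l0 k1 : k1 <> k0 -> (n k1 <= h k1 + 1)%N ->
  (forall k l, (k < l)%N -> (l < b)%N -> (h k < n k)%N -> (0 < h l)%N ->
     (k = k0 /\ l = l0) \/ k = k1) -> mult_free w Ns.
Proof.
move=> nk s1 H; apply: mult_free_of_pattern; apply: (pattern_row lev st (l0 := l0) nk).
  move=> i a /edge_blocks [kl lb hk hl]; rewrite /inblk.
  by case: (H _ _ kl lb hk hl) => [[-> ->]|->]; [left; rewrite !eqxx|right].
by rewrite thrE; lia.
Qed.

Lemma mf_col k0 l0 l1 : l1 <> l0 -> (h l1 <= 1)%N ->
  (forall k l, (k < l)%N -> (l < b)%N -> (h k < n k)%N -> (0 < h l)%N ->
     (k = k0 /\ l = l0) \/ l = l1) -> mult_free w Ns.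
Proof.
move=> nk s1 H; apply: mult_free_of_pattern; apply: (pattern_col lev st (k0 := k0) nk).
  move=> i a /edge_blocks [kl lb hk hl]; rewrite /inblk.
  by case: (H _ _ kl lb hk hl) => [[-> ->]|->]; [left; rewrite !eqxx|right].
by have := h_le l1; rewrite thrE bstS; lia.
Qed.

Lemma mf_rowcol k1 l1 : (n k1 <= h k1 + 1)%N -> (h l1 <= 1)%N ->
  (forall k l, (k < l)%N -> (l < b)%N -> (h k < n k)%N -> (0 < h l)%N ->
     k = k1 \/ l = l1) -> mult_free w Ns.
Proof.
move=> s1 s2 H; apply: mult_free_of_pattern.
apply: (pattern_rowcol lev st (k1 := k1) (l1 := l1)).
- by move=> i a /edge_blocks [kl lb hk hl]; apply: H.
- by rewrite thrE; lia.
- by have := h_le l1; rewrite thrE bstS; lia.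
Qed.

(** The last block already contributes at least 1, by [h_last]. *)
Lemma tail_sum p : (p <= b.-1)%N -> (\sum_(p <= k < b) h k < 2)%N ->
  h b.-1 = 1%N /\ forall k, (p <= k < b.-1)%N -> h k = 0%N.
Proof.
have b0 := b_gt0; rewrite -{2}(prednK b0) => pb; rewrite big_nat_recr //=.
have := h_last => hl lt; split; first by lia.
by move=> k /(leq_sum_nat h); lia.
Qed.

Definition tail k := (\sum_(k <= j < b) h j)%N.

Lemma pwP : (4 <= b)%N -> let p := pw w Ns in
  [/\ (2 <= p <= b.-1)%N, (p < b.-1)%N -> (tail p < 2)%N &
      forall q, (2 <= q < p)%N -> (2 <= tail q)%N].
Proof.
move=> b4 /=; have e : (b.-1 = 2 + (b - 3))%N by lia.
have [h1 h2 h3] := head_filter_iota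
  (fun p => (\sum_(p.+1 <= k < b.+1) hk w Ns k < 2)%N) 2 (b - 3).
have tE q : (\sum_(q.+1 <= k < b.+1) hk w Ns k)%N = tail q by rewrite big_add1.
rewrite /pw /bL e; split=> // [|q /h3]; first by move=> /h2; rewrite tE.
by rewrite tE -leqNgt.
Qed.

(** The total slack of these blocks is at most 1 and block 0 uses it up by [h_first], so the other
    blocks are full. *)
Lemma head_sum_full m : (0 < m)%N -> (\sum_(0 <= k < m) n k <= \sum_(0 <= k < m) h k + 1)%N ->
  (n 0 <= h 0 + 1)%N /\ forall k, (0 < k < m)%N -> (n k <= h k)%N.
Proof.
move=> m0; have e : (\sum_(0 <= k < m) n k = \sum_(0 <= k < m) h k + \sum_(0 <= k < m) (n k - h k))%N.
  by rewrite -big_split /=; apply: eq_bigr => k _; rewrite subnKC // h_le.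
rewrite e leq_add2l big_ltn // => s1; have h0 := h_first.
split; first by lia.
by move=> k /(leq_sum_nat (fun k => n k - h k)%N); lia.
Qed.

(** A block pair [k < l] matters only if block [k] has slack and block [l] meets [w]. Each case
    leaves few enough such pairs for one of the forest patterns. *)
Lemma mult_free_if :
  ((bL Ns <= 2)%N
    \/ (bL Ns = 3 /\
        (Nk Ns 2 = 1%N
         \/ (Nk Ns 1 <= hk w Ns 1 + 1)%N
         \/ (Nk Ns 2 = hk w Ns 2 /\ (Nk Ns 1 <= hk w Ns 1 + 2)%N)
         \/ ((0 < hk w Ns 2)%N /\ (hk w Ns 3 < 2)%N)
         \/ (hk w Ns 2 = 0%N /\ (hk w Ns 3 <= 2)%N)))
    \/ ((4 <= bL Ns)%N /\
        (pw w Ns = 2%N \/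
         ((2 < pw w Ns)%N /\
          (\sum_(1 <= k < pw w Ns) Nk Ns k <= \sum_(1 <= k < pw w Ns) hk w Ns k + 1)%N)))) ->
  mult_free w Ns.
Proof.
rewrite /bL; case=> [b2|[[b3 H]|[b4 H]]].
(* Only the pair (0, 1) can occur; the non-existent block 2 serves as an empty column block. *)
- apply: (@mf_col 0 1 2) => //; last by move=> k l; lia.
  by have := h_le 2; rewrite nth_default //; lia.
- rewrite /Nk /= -![hk _ _ _]/(h _) in H; rewrite -/(h 0) -/(h 1) -/(h 2) in H.
  have hl := h_last; rewrite b3 /= in hl.
  have h1 := h_le 1; have h0 := h_first.
  case: H => [n1|[s0|[[s1 s0]|[[p1 l2]|[z1 l2]]]]].
  (* A middle block of size 1 is either a single slack row without columns or a single column
     without slack. *)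
  + have [e|ne] := eqVneq (h 1) 0%N.
      apply: (@mf_row 0 2 1) => //; first by lia.
      move=> k l kl lb hk hl'; have [l1|nl1] := eqVneq l 1%N; first by rewrite l1 e in hl'.
      by lia.
    apply: (@mf_col 0 2 1) => //; first by lia.
    move=> k l kl lb hk hl'; have [k1|nk1] := eqVneq k 1%N; first by rewrite k1 in hk; lia.
    by lia.
  + apply: (@mf_row 1 2 0) => // k l; lia.
  + apply: mult_free_of_pattern; apply: (pattern_two_rows lev st (k0 := 0) (l0 := 1) (l1 := 2)) => //.
      move=> i a /edge_blocks [kl lb hk hl'].
      have : blk Ns i <> 1%N by move=> e; rewrite e in hk; lia.
      by lia.
    by rewrite thrE; lia.
  + apply: (@mf_col 0 1 2) => //; lia.
  + apply: mult_free_of_pattern; apply: (pattern_two_cols lev st (k0 := 0) (k1 := 1) (l0 := 2)) => //.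
      move=> i a /edge_blocks [kl lb hk hl'].
      have : blk Ns (val w a) <> 1%N by move=> e; rewrite e in hl'; lia.
      by lia.
    by have := h_le 2; rewrite thrE bstS; lia.
have [/andP[p2 pb] pt _] := pwP b4; set p := pw w Ns in p2 pb pt H.
case: H => [pe|[p3 H]].
  (* From block 2 on, only the last block meets [w], in one column; the one other possible pair is
     (0, 1). *)
  have t2 : (tail 2 < 2)%N by move: pt; rewrite pe; apply; lia.
  have [|hl1 hz] := @tail_sum 2 _ t2; first by lia.
  apply: (@mf_col 0 1 b.-1) => //; [by lia|by rewrite hl1|].
  move=> k l kl lb hk hl; have [l2|l2] := leqP 2 l; last by lia.
  by right; have [lt|] := ltnP l b.-1; [rewrite hz ?l2 // in hl|lia].
have e : p = p.-1.+1 by lia.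
(* With blocks numbered from 0, the condition concerns blocks 0 to p-2: block 0 has a single slack
   row and the others none. If [p < b - 1], every other edge ends in the single column of the last
   block; otherwise only the pair of the last two blocks remains. *)
have {}H : (\sum_(0 <= k < p.-1) n k <= \sum_(0 <= k < p.-1) h k + 1)%N.
  by move: H; rewrite e !big_add1.
have [|s0 full] := head_sum_full _ H; first by lia.
have [plt|pge] := ltnP p b.-1.
  have [hl1 hz] := tail_sum (ltnW plt) (pt plt).
  apply: (@mf_rowcol 0 b.-1) => //; first by rewrite hl1.
  move=> k l kl lb hk hl; have [->|k0] := posnP k; first by left.
  have [kp|pk] := ltnP k p.-1; first by have := full k; rewrite k0 kp; lia.
  by right; have [lt|] := ltnP l b.-1; [rewrite hz // in hl; lia|lia].
apply: (@mf_row p.-1 b.-1 0) => //; first by lia.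
move=> k l kl lb hk hl; have [->|k0] := posnP k; first by right.
have [kp|pk] := ltnP k p.-1; first by have := full k; rewrite k0 kp; lia.
by left; lia.
Qed.

Lemma mult_free_only_if3 : b = 3 -> mult_free w Ns ->
  n 1 = 1%N \/ (n 0 <= h 0 + 1)%N \/ (n 1 = h 1 /\ (n 0 <= h 0 + 2)%N) \/
  ((0 < h 1)%N /\ (h 2 < 2)%N) \/ (h 1 = 0%N /\ (h 2 <= 2)%N).
Proof.
move=> b3 mf; apply: contrapT => H.
have h0 := h_le 0; have h1 := h_le 1; have h2 := h_le 2.
have n1 : (0 < n 1)%N by apply: n_gt0; rewrite b3.
have hl := h_last; rewrite b3 /= in hl.
have sd := sum_hh w lev; rewrite b3 !big_nat_recr //= big_geq //= in sd.
suff [x [y [z [Hx [Hy [Hz [Hs [H1 H2]]]]]]]] : exists x y z : nat,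
    (x + 2 <= n 0)%N /\ (y + 2 <= n 1)%N /\ (z + 2 <= n 2)%N /\ (x + y + z + 3 = d)%N /\
    (h 0 <= x)%N /\ (h 0 + h 1 <= x + y + 1)%N.
  clear H; pose c k := (if k == 0 then x else if k == 1 then y else if k == 2 then z else 0)%N.
  apply: (@three_blocks d N w Ns lev st c _ 0 1 2) mf => //.
  - by move=> k; rewrite b3; case: k => [|[|[|//]]] _; rewrite /c /=; lia.
  - by rewrite b3.
  - by rewrite b3 !big_nat_recr //= big_geq.
  - move=> k; rewrite b3; case: k => [|[|[|[|//]]]] _; do ?[rewrite big_nat_recr //=];
      rewrite !big_geq // /c /= ?add0n ?addn0; lia.
(* The test columns have block counts [(x, y + 1, z + 2)]. They reproduce [w] in the generic case;
   if block 1 misses [w], one column moves there from block 2, and if block 1 is full, one column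
   moves from it to block 0. The negated conditions provide exactly this room. *)
have [e|ne] := eqVneq (h 1) 0%N.
  by exists (h 0), 0%N, (h 2 - 3)%N; lia.
have [e|ne'] := eqVneq (n 1) (h 1).
  by exists (h 0).+1, (h 1 - 2)%N, (h 2 - 2)%N; lia.
by exists (h 0), (h 1).-1, (h 2 - 2)%N; lia.
Qed.

(** If the condition fails, blocks 0 to p-2 have total slack at least 2, and by minimality of [p]
    the blocks from p-1 on contain at least two elements of [w]. This yields four blocks 0 < j < k <
    L for [four_blocks]. *)
Lemma mult_free_only_if4 : (4 <= b)%N -> mult_free w Ns ->
  pw w Ns = 2%N \/ ((2 < pw w Ns)%N /\
    (\sum_(0 <= k < (pw w Ns).-1) n k <= \sum_(0 <= k < (pw w Ns).-1) h k + 1)%N).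
Proof.
move=> b4 mf; apply: contrapT => H.
have [/andP[p2 pb] _ ptail] := pwP b4; set p := pw w Ns in p2 pb ptail H.
have p3 : (2 < p)%N by apply: contrapT => np; apply: H; left; lia.
have slack : (\sum_(0 <= k < p.-1) h k + 2 <= \sum_(0 <= k < p.-1) n k)%N.
  rewrite leqNgt; apply/negP => lt; apply: H; right; split=> //.
  by rewrite addn1 -ltnS -addn2.
have t2 : (2 <= tail p.-1)%N by apply: ptail; lia.
have hl := h_last; have h0 := h_first.
set L := b.-1 in hl pb.
have Lb : (L < b)%N by rewrite /L; lia.
(* Either some block [j] after block 0 has slack, with [u = 0], or all slack sits in block 0. Then
   one row of [w] is moved from the full block 1 to block 0, with [u = 1], which opens a slack row
   in block 1 and still leaves one in block 0. *)
have [j [u [j1 [jp [uj [u0 [cj' u1]]]]]]] : exists j u : nat,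
    (0 < j)%N /\ (j < p.-1)%N /\ (u <= (j == 1))%N /\ (h 0 + u < n 0)%N /\
    (h j < n j + u)%N /\ (u <= h 1)%N.
  have [[j [jj jn]]|no] := EM (exists j, (0 < j < p.-1)%N /\ (h j < n j)%N).
    by exists j, 0%N; lia.
  have eq1 k : (0 < k < p.-1)%N -> n k = h k.
    by move=> kp; have := h_le k; have [lt|] := ltnP (h k) (n k); [case: no; exists k|lia].
  have h1 : h 1 = n 1 by rewrite eq1 //; lia.
  have n1 : (0 < n 1)%N by apply: n_gt0; lia.
  exists 1%N, 1%N; split=> //; split; first by lia.
  split=> //; split; last by lia.
  move: slack; rewrite big_ltn ?[X in (_ <= X)%N]big_ltn; try lia.
  rewrite [X in (_ <= _ + X)%N](eq_big_nat _ _ (F2 := h)); last by move=> k kp; rewrite eq1.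
  by lia.
(* Two rows of [w] are to be released in blocks [k] and [L]: one in each if an intermediate block
   meets [w], and otherwise both in [L], with [k = p - 1] an empty block. *)
have [k [al [pk [kL [al1 [hk [hL ck]]]]]]] : exists k al : nat,
    (p.-1 <= k)%N /\ (k < L)%N /\ (al <= 1)%N /\ (al <= h k)%N /\ (2 - al <= h L)%N /\
    (h k < n k + al)%N.
  have [[k [kk hk]]|no] := EM (exists k, (p.-1 <= k < L)%N /\ (0 < h k)%N).
    by exists k, 1%N; have := h_le k; lia.
  have z k : (p.-1 <= k < L)%N -> h k = 0%N.
    by move=> kk; have [//|hk] := posnP (h k); case: no; exists k.
  exists p.-1, 0%N; split=> //; split; first by lia.
  split=> //; split=> //; split.
    move: t2; rewrite /tail (_ : b = L.+1); last by lia.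
    rewrite big_nat_recr /=; last by lia.
    by rewrite big_nat_cond big1 // => k /andP[kk _]; apply: z.
  by rewrite z ?addn0; [apply: n_gt0; lia|lia].
clear H slack t2 ptail.
have [|||||c [[c0 c1 ck' cL] ct sE]] := @shifted_sums h u k al L (2 - al); try (clear -p3 pk kL al1 hk hL u1; lia).
have j0 : j != 0%N by rewrite -lt0n.
have cjn : (c j < n j)%N.
  have [e|nj1] := eqVneq j 1%N.
    by rewrite e in uj cj' *; clear -c1 cj' uj; lia.
  rewrite ct //; last 2 first.
  - by rewrite ltn_eqF // (leq_trans jp pk).
  - by rewrite ltn_eqF // (leq_trans jp) // (leq_trans pk (ltnW kL)).
  by move: uj cj'; rewrite (negPf nj1) leqn0 => /eqP ->; rewrite addn0.
have k1 : (1 < k)%N by clear -p3 pk; lia.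
have L1 : (1 < L)%N by apply: ltn_trans kL.
have sd := sum_hh w lev.
apply: (@four_blocks d N w Ns lev st c _ 0 j k L) mf => //.
- move=> t tb; have := h_le t.
  have [->|t0] := eqVneq t 0%N; first by rewrite c0 => _; apply: ltnW.
  have [->|t1] := eqVneq t 1%N; first by apply: leq_trans; rewrite -c1 leq_addr.
  have [->|tk] := eqVneq t k; first by apply: leq_trans; rewrite -ck' leq_addr.
  have [->|tL] := eqVneq t L; first by apply: leq_trans; rewrite -cL leq_addr.
  by rewrite ct.
- exact: leq_trans jp pk.
- by rewrite c0.
- by clear -ck' ck; lia.
- by have := h_le L; clear -cL al1; lia.
- have := sE b; rewrite sd (ltn_trans kL Lb) (ltn_trans L1 Lb) Lb b_gt0 //.
  by clear -al1; lia.
move=> m mb; have := sE m; clear -k1 kL al1; have [Lm|mL] := ltnP L m.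
  rewrite (ltn_trans kL Lm) (ltn_trans k1 (ltn_trans kL Lm)) (leq_ltn_trans _ Lm) //.
  by lia.
have [km|mk] := ltnP k m.
  by rewrite (ltn_trans k1 km) (leq_ltn_trans _ km) //; lia.
have [m1|m1] := ltnP 1 m; first by rewrite (leq_ltn_trans _ m1) //; lia.
by lia.
Qed.

End Classification.

Theorem theorem5p5 (d N : nat) (w : Idn d N) (Ns : seq nat) :
  (1 <= d)%N -> (d < N)%N -> levi_ok N Ns ->
  stable w Ns -> reduced w ->
  (mult_free w Ns <->
   ((bL Ns <= 2)%N
    \/ (bL Ns = 3 /\
        (Nk Ns 2 = 1%N
         \/ (Nk Ns 1 <= hk w Ns 1 + 1)%N
         \/ (Nk Ns 2 = hk w Ns 2 /\ (Nk Ns 1 <= hk w Ns 1 + 2)%N)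
         \/ ((0 < hk w Ns 2)%N /\ (hk w Ns 3 < 2)%N)
         \/ (hk w Ns 2 = 0%N /\ (hk w Ns 3 <= 2)%N)))
    \/ ((4 <= bL Ns)%N /\
        (pw w Ns = 2%N \/
         ((2 < pw w Ns)%N /\
          (\sum_(1 <= k < pw w Ns) Nk Ns k <= \sum_(1 <= k < pw w Ns) hk w Ns k + 1)%N))))).
Proof.
move=> d0 dN lev st red; split; last exact: mult_free_if.
move=> mf; have [b2|b2] := leqP (bL Ns) 2; first by left.
right; have [b4|b4] := leqP 4 (bL Ns); last first.
  have b3 : bL Ns = 3 by lia.
  by left; split; [exact: b3|exact: (mult_free_only_if3 d0 dN lev st red b3 mf)].
right; split=> //.
have [?|[p2 H]] := mult_free_only_if4 d0 dN lev st red b4 mf; first by left.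
right; split=> //; move: H p2; case: (pw w Ns) => // p H _.
by rewrite !big_add1.
Qed.
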